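(* Let $(X_t,\sigma_t)_{t\in\mathbb{Z}}$ be a (stationary) SV model with Gamma-type log-volatility. Assume that for a given $h\in\mathbb{N}$ there exists a unique solution $(\kappa_i)_{i\in\mathbb{N}_0}$ to the optimization problem $$\sum_{i=0}^\infty\kappa_i\to\min!\quad\text{under the constraints}\quad\sum_{i=h}^\infty\alpha_{i-h}\kappa_i\ge1,\ \sum_{i=0}^\infty\alpha_i\kappa_i\ge1,\ \kappa_i\ge0\ \ \forall i\in\mathbb{N}_0.$$ In addition, suppose that $E\bigl((\varepsilon_0^+)^{\sum_{i=0}^\infty\kappa_i+\delta}\bigr)<\infty$ for some $\delta>0$. (i) If $\kappa_i,\kappa_j>0$ for some $i\ne j$, then for all $s_0,s_h>0$ $$\lim_{x\to\infty}\frac{P(\sigma_0>s_0x,\sigma_h>s_hx)}{P(\min\{\sigma_0,\sigma_h\}>x)}=\lim_{x\to\infty}\frac{P(X_0>s_0x,X_h>s_hx)}{P(\min\{X_0,X_h\}>x)}=\bigl(s_0^{\alpha_i-\alpha_j}s_h^{\alpha_{j-h}-\alpha_{i-h}}\bigr)^{1/(\alpha_j\alpha_{i-h}-\alpha_i\alpha_{j-h})},$$ where $\alpha_k:=0$ for $k<0$. (ii) If $\kappa_i>0$ for exactly one $i\in\mathbb{N}_0$ and $\kappa_j=0$ for all other $j$, then $i\ge h$, $\alpha_i=\alpha_{i-h}$, and for all $s_0,s_h>0$ $$\lim_{x\to\infty}\frac{P(\sigma_0>s_0x,\sigma_h>s_hx)}{P(\min\{\sigma_0,\sigma_h\}>x)}=\frac{E\Bigl(\min\bigl(s_0^{-1}\prod_{j\ge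 h,j\ne i}e^{\alpha_{j-h}\eta_{h-j}},\ s_h^{-1}\prod_{j\in\mathbb{N}_0\setminus\{i\}}e^{\alpha_j\eta_{h-j}}\bigr)^{1/\alpha_i}\Bigr)}{E\Bigl(\min\bigl(\prod_{j\ge h,j\ne i}e^{\alpha_{j-h}\eta_{h-j}},\ \prod_{j\in\mathbb{N}_0\setminus\{i\}}e^{\alpha_j\eta_{h-j}}\bigr)^{1/\alpha_i}\Bigr)}$$ and $$\lim_{x\to\infty}\frac{P(X_0>s_0x,X_h>s_hx)}{P(\min\{X_0,X_h\}>x)}=\frac{E\Bigl(\min\bigl(s_0^{-1}\varepsilon_0^+\prod_{j\ge h,j\ne i}e^{\alpha_{j-h}\eta_{h-j}},\ s_h^{-1}\varepsilon_h^+\prod_{j\in\mathbb{N}_0\setminus\{i\}}e^{\alpha_j\eta_{h-j}}\bigr)^{1/\alpha_i}\Bigr)}{E\Bigl(\min\bigl(\varepsilon_0^+\prod_{j\ge h,j\ne i}e^{\alpha_{j-h}\eta_{h-j}},\ \varepsilon_h^+\prod_{j\in\mathbb{N}_0\setminus\{i\}}e^{\alpha_j\eta_{h-j}}\bigr)^{1/\alpha_i}\Bigr)}.$$ In both cases, $(\sigma_0,\sigma_h)$ and $(X_0,X_h)$ are regularly varying on $\mathbb{E}^2=(0,\infty)^2$ with index $-\sum_{i=0}^\infty\kappa_i$.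
   Context: SV model with Gamma-type log-volatility: $X_t=\sigma_t\varepsilon_t$, $t\in\mathbb{Z}$, where $\varepsilon_t$, $t\in\mathbb{Z}$, are i.i.d. with $P(\varepsilon_0>0)>0$ and $E(|\varepsilon_0|^{1+\delta})<\infty$ for some $\delta>0$, and $\log\sigma_t=\sum_{i=0}^\infty\alpha_i\eta_{t-i}$, $t\in\mathbb{Z}$, with (a) coefficients $\alpha_i\in[0,1]$, $i\in\mathbb{N}_0$, such that $\max_{i\in\mathbb{N}_0}\alpha_i=1$ and $\alpha_i=O(i^{-\theta})$ as $i\to\infty$ for some $\theta>1$; (b) i.i.d. random variables $\eta_t$, $t\in\mathbb{Z}$, independent of $(\varepsilon_t)_{t\in\mathbb{Z}}$, with $E(\eta_0^2)<\infty$ and $P(\eta_0>z)\sim Kz^\beta e^{-z}$ as $z\to\infty$, for a real constant $\beta\ne-1$ and a constant $K>0$. Here $f\sim g$ means $f/g\to1$, and $x^+=\max\{x,0\}$. Regular variation on $\mathbb{E}^2$: a random vector $\mathbf{Z}$ in $\mathbb{R}^2$ is regularly varying on $\mathbb{E}^2=(0,\infty)^2$ with index $-\alpha<0$ if there is a measure $\nu\ne0$ on $\mathcal{B}(\mathbb{E}^2)$, finite on $(x,\infty)^2$ for all $x>0$ and homogeneous of order $-\alpha$ (i.e. $\nu(tB)=t^{-\alpha}\nu(B)$), such that $P(\mathbf{Z}\in xB)/P(\min\{Z_1,Z_2\}>x)\to\nu(B)$ as $x\to\infty$ for all Borel sets $B\subset\mathbb{E}^2$ bounded away from the topological boundary of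 $\mathbb{E}^2$ with $\nu(\partial B)=0$. *)

(* Defs.v *)
From HB Require Import structures.
From mathcomp Require Import all_boot all_order all_algebra.
From mathcomp Require Import all_classical all_reals all_analysis.

Set Implicit Arguments.
Unset Strict Implicit.
Unset Printing Implicit Defensive.

Import Order.TTheory GRing.Theory Num.Theory.
Import numFieldNormedType.Exports.

Local Open Scope classical_set_scope.
Local Open Scope ring_scope.

(* Measures are unspecified outside the measurable sets, so the test sets
   below are always required to be measurable. *)
Definition independent_family d (T : measurableType d) (R : realType)
    (P : probability T R) (I : choiceType) (Y : I -> {RV P >-> R}) : Prop :=
  forall (J : seq I) (B : I -> set R), uniq J ->
    (forall i, measurable (B i)) ->
    fine (P (\bigcap_(i in [set` J]) (Y i @^-1` B i))) =
    \prod_(i <- J) fine (P (Y i @^-1` B i)).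

Definition identically_distributed d (T : measurableType d) (R : realType)
    (P : probability T R) (I : Type) (Y : I -> {RV P >-> R}) : Prop :=
  forall (i j : I) (B : set R), measurable B ->
    distribution P (Y i) B = distribution P (Y j) B.

Definition iid d (T : measurableType d) (R : realType)
    (P : probability T R) (I : choiceType) (Y : I -> {RV P >-> R}) : Prop :=
  independent_family Y /\ identically_distributed Y.

Definition sigma_generated d (T : measurableType d) (R : realType)
    (P : probability T R) (I : Type) (Y : I -> {RV P >-> R}) : set (set T) :=
  <<s \bigcup_i preimage_set_system setT (Y i) measurable >>.

Definition independent_of d (T : measurableType d) (R : realType)
    (P : probability T R) (I J : Type) (Y : I -> {RV P >-> R})
    (Z : J -> {RV P >-> R}) : Prop :=
  forall A B : set T, sigma_generated Y A -> sigma_generated Z B ->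
    P (A `&` B) = (P A * P B)%E.

Record gamma_SV_model d (T : measurableType d) (R : realType)
    (P : probability T R) (alpha : nat -> R) (theta beta K : R)
    (eps eta sigma X : int -> {RV P >-> R}) : Prop := GammaSVModel {
  sv_X : forall t w, X t w = sigma t w * eps t w;
  sv_eps_iid : iid eps;
  sv_eps_pos : (0 < P [set w | (0 < eps 0 w)%R])%E;
  sv_eps_moment : exists2 delta : R, 0 < delta &
    ('E_P[fun w => (`|eps 0 w| `^ (1 + delta))%R] < +oo)%E;
  sv_log_sigma : forall t : int, {ae P, forall w, 0 < sigma t w /\
    \sum_(0 <= i < n) alpha i * eta (t - i%:Z) w @[n --> \oo]
      --> ln (sigma t w)};
  sv_alpha01 : forall i, 0 <= alpha i <= 1;
  sv_alpha_max : exists i, alpha i = 1;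
  sv_theta : 1 < theta;
  sv_alphaO : (alpha : nat -> R^o) =O_\oo
    (fun i : nat => i%:R `^ (- theta) : R^o);
  sv_eta_iid : iid eta;
  sv_eta_eps : independent_of eta eps;
  sv_eta_moment : ('E_P[fun w => (eta 0 w ^+ 2)%R] < +oo)%E;
  sv_beta : beta != -1;
  sv_K : 0 < K;
  sv_eta_tail :
    fine (P [set w | z < eta 0 w]) / (K * z `^ beta * expR (- z))
      @[z --> +oo] --> (1 : R) }.

(* Terms are nonnegative on the feasible set, so that all sums make sense in
   [0, +oo]; kappa is not assumed to be summable. *)
Definition objective (R : realType) (kappa : nat -> R) : \bar R :=
  (\sum_(0 <= i <oo) (kappa i)%:E)%E.

Definition feasible (R : realType) (alpha : nat -> R) (h : nat)
    (kappa : nat -> R) : Prop :=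
  [/\ (1 <= \sum_(h <= i <oo) (alpha (i - h)%N * kappa i)%:E)%E,
      (1 <= \sum_(0 <= i <oo) (alpha i * kappa i)%:E)%E &
      forall i, 0 <= kappa i].

Definition solution (R : realType) (alpha : nat -> R) (h : nat)
    (kappa : nat -> R) : Prop :=
  feasible alpha h kappa /\
  forall kappa', feasible alpha h kappa' ->
    (objective kappa <= objective kappa')%E.

(* alpha_{i-h}, with the convention alpha_k = 0 for k < 0 *)
Definition lagged (R : realType) (alpha : nat -> R) (h i : nat) : R :=
  if (h <= i)%N then alpha (i - h)%N else 0.

Definition joint_tail_ratio d (T : measurableType d) (R : realType)
    (P : probability T R) (Y Z : T -> R) (s t x : R) : R :=
  fine (P [set w | s * x < Y w /\ t * x < Z w]) /
  fine (P [set w | x < Num.min (Y w) (Z w)]).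

(* prod_(j >= h, j <> i) exp(alpha_{j-h} eta_{h-j}), the part of sigma_0 not
   involving eta_{h-i} *)
Definition sigma0_without d (T : measurableType d) (R : realType)
    (P : probability T R) (alpha : nat -> R) (eta : int -> {RV P >-> R})
    (h i : nat) (w : T) : R :=
  limn (fun n => \prod_(h <= j < n | j != i)
                   expR (alpha (j - h)%N * eta (h%:Z - j%:Z) w)).

(* prod_(j >= 0, j <> i) exp(alpha_j eta_{h-j}), the part of sigma_h not
   involving eta_{h-i} *)
Definition sigmah_without d (T : measurableType d) (R : realType)
    (P : probability T R) (alpha : nat -> R) (eta : int -> {RV P >-> R})
    (h i : nat) (w : T) : R :=
  limn (fun n => \prod_(0 <= j < n | j != i)
                   expR (alpha j * eta (h%:Z - j%:Z) w)).

Definition min_moment d (T : measurableType d) (R : realType)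
    (P : probability T R) (p : R) (Y Z : T -> R) : R :=
  fine 'E_P[fun w => (Num.min (Y w) (Z w)) `^ p].

Definition E2 (R : realType) : set (R * R) := [set z | 0 < z.1 /\ 0 < z.2].

Definition boundary (S : topologicalType) (A : set S) : set S :=
  closure A `\` interior A.

Definition dilate (R : realType) (t : R) (B : set (R * R)) : set (R * R) :=
  [set (t * b.1, t * b.2) | b in B].

Definition bounded_away (R : realType) (B C : set (R * R)) : Prop :=
  exists2 r : R, 0 < r & forall b c, B b -> C c -> ~ ball b r c.

(* A measure on the Borel sets of E2 is encoded as a Borel measure nu on the
   plane vanishing outside E2. For B bounded away from the boundary of E2, the
   boundaries of B in E2 and in the plane coincide. *)
Definition regularly_varying_E2 d (T : measurableType d) (R : realType)
    (P : probability T R) (Z1 Z2 : T -> R) (a : R) : Prop :=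
  0 < a /\
  exists nu : {measure set (R * R) -> \bar R},
    [/\ nu (~` @E2 R) = 0%E, nu (@E2 R) != 0%E,
        (forall x : R, 0 < x ->
          (nu [set z : R * R | (x < z.1)%R /\ (x < z.2)%R] < +oo)%E),
        (forall (t : R) (B : set (R * R)), 0 < t -> measurable B ->
          B `<=` @E2 R -> nu (dilate t B) = ((t `^ (- a))%:E * nu B)%E) &
        (forall B : set (R * R), measurable B -> B `<=` @E2 R ->
          bounded_away B (boundary (@E2 R)) -> nu (boundary B) = 0%E ->
          (fine (P [set w | dilate x B (Z1 w, Z2 w)]) /
           fine (P [set w | x < Num.min (Z1 w) (Z2 w)]))%:E
            @[x --> +oo] --> nu B)].

(* Main.v *)
(* Write l_k for the lagged coefficient alpha_{k-h}. Then sigma_0 and sigma_h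
   are exponentials of the series of l_k eta_{h-k} and of alpha_k eta_{h-k},
   and the linear program decides which summands carry a joint exceedance.
   Perturbing its unique solution yields dual weights y > 0 with
   y_0 l_k + y_1 alpha_k = 1 on the support of kappa and < 1 elsewhere.

   Two positive weights kappa_i, kappa_j. The tail of eta is asymptotically
   exponential, P(eta > z + m) ~ exp(-m) P(eta > z). Conditioning on everything
   but eta_{h-i}, a shift of eta_{h-i} by m multiplies the joint tail by exp(-m)
   and changes the thresholds by exp(m l_i), exp(m alpha_i), provided the joint
   tail without the i-th summand is negligible; this follows from a Chernoff
   bound at perturbed dual weights against a lower bound of the joint tail.
   The shifts in the directions i and j together reach all thresholds.

   One positive weight kappa_i. Here l_i = alpha_i, so the joint tail is that of
   exp(alpha_i eta_{h-i}) times the minimum of two independent products, and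
   Breiman's lemma (dominated convergence) applies.

   Regular variation follows from convergence on quadrants: the limit measure is
   an explicit image of a product measure, its homogeneity is checked on
   quadrants, and the convergence extends from quadrants to unions of
   rectangles, to open sets (liminf) and to sets with null boundary. *)

Require Import Defs.
From HB Require Import structures.
From mathcomp Require Import all_boot all_order all_algebra.
From mathcomp Require Import all_classical all_reals all_analysis.
From mathcomp Require Import measurable_realfun ring lra.

Set Implicit Arguments.
Unset Strict Implicit.
Unset Printing Implicit Defensive.

Import Order.TTheory GRing.Theory Num.Theory.
Import numFieldNormedType.Exports.

Local Open Scope classical_set_scope.
Local Open Scope ring_scope.

(** * The linear program *)

(** The exponential moments of the noise are known to be finite for orders below 1 only, while the
    dual weights put order exactly 1 on the support of [kappa]. The moment bounds therefore concern
    products with an index removed, and they need a strict dual inequality at the other indices.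
    This strict complementarity is what uniqueness of the optimum provides; optimality alone would
    give non-strict inequalities. No duality theory in infinitely many variables is involved:
    perturbing three coordinates of [kappa] at a time suffices, and strictness becomes uniform
    because the coefficients tend to 0. The tail of the noise enters through the limit of
    [F (z + m) / F z]. This determines rates up to factors [x ^ e] with small [e], so a negligible
    term has to lose by a genuine power of [x]; hence the tilting of the dual weights. Volatility
    and observed process are treated at once: at positive levels both are a nonnegative factor
    independent of the noise times the exponential of a series. *)

Lemma nneseries_EFin (R : realType) (f : nat -> R) (S : R) :
  series f n @[n --> \oo] --> S -> (\sum_(0 <= i <oo) (f i)%:E)%E = S%:E.
Proof.
move=> fS; apply/cvg_lim => //.
rewrite (_ : (fun n => _) = EFin \o series f).
  by apply: cvg_EFin => //; exact: nearW.
by apply/funext => n; rewrite sumEFin.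
Qed.

Lemma nneseries_fin (R : realType) (f : nat -> R) :
  (forall i, 0 <= f i) -> (\sum_(0 <= i <oo) (f i)%:E < +oo)%E ->
  exists S : R, series f n @[n --> \oo] --> S.
Proof.
move=> f0 fin.
have := @is_cvg_nneseries R (fun i => (f i)%:E) xpredT 0%N
  ltac:(by move=> n _ _; rewrite lee_fin).
move=> /cvg_ex[l fl].
have lE : (\sum_(0 <= i <oo) (f i)%:E)%E = l by apply/cvg_lim.
have l0 : (0 <= l)%E by rewrite -lE; apply: nneseries_ge0 => n _ _; rewrite lee_fin.
rewrite lE in fin.
case: l l0 fin lE fl => // r _ _ _ fl.
exists r; move/fine_cvgP: fl => [_].
apply: cvg_trans; rewrite (_ : fine \o _ = series f) //; apply/funext => n /=.
by rewrite sumEFin.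
Qed.

Lemma feasible_lagged (R : realType) (alpha kappa : nat -> R) h :
  (\sum_(h <= i <oo) (alpha (i - h)%N * kappa i)%:E)%E =
  (\sum_(0 <= i <oo) (lagged alpha h i * kappa i)%:E)%E.
Proof.
rewrite eseries_cond eseries_mkcondr; apply: congr_lim; apply/funext => n.
apply: eq_bigr => i _; rewrite /lagged.
by case: ifP => // _; rewrite mul0r.
Qed.

Lemma series_finite_change (R : realType) (f w : nat -> R) (S : R) N :
  (forall k, (N <= k)%N -> w k = 0) -> series f n @[n --> \oo] --> S ->
  series (fun k => f k + w k) n @[n --> \oo] --> S + \sum_(k < N) w k.
Proof.
move=> w0 fS.
have : (fun n => series f n + \sum_(k < N) w k) @ \oo --> S + \sum_(k < N) w k.
  by apply: cvgD => //; exact: cvg_cst.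
apply: cvg_trans; apply: near_eq_cvg; near=> n.
rewrite /series /= big_split /=; congr (_ + _).
rewrite (@big_cat_nat _ _ _ N) //=; last by near: n; exact: nbhs_infty_ge.
rewrite [X in _ + X]big_nat_cond [X in _ + X]big1 ?addr0 ?big_mkord//.
by move=> i /andP[/andP[/w0]].
Unshelve. all: by end_near. Qed.

(** A sum of indicators, so that coinciding indices are allowed and their weights add up; directions
    with one or two points are instances. *)
Definition three_point (R : realType) (i j k : nat) (ci cj ck : R) (n : nat) : R :=
  ci * (n == i)%:R + cj * (n == j)%:R + ck * (n == k)%:R.

Lemma sum_three_point (R : realType) (f : nat -> R) i j k (ci cj ck : R) N :
  (i < N)%N -> (j < N)%N -> (k < N)%N ->
  \sum_(n < N) f n * three_point i j k ci cj ck n = f i * ci + f j * cj + f k * ck.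
Proof.
have H m c : (m < N)%N -> \sum_(n < N) f n * (c * (n == m :> nat)%:R) = f m * c.
  move=> mN; rewrite (bigD1 (Ordinal mN)) //= eqxx mulr1 big1 ?addr0//.
  by move=> o /negbTE; rewrite -val_eqE /= => ->; rewrite !mulr0.
move=> iN jN kN; rewrite -(H i)// -(H j)// -(H k)// -!big_split /=.
by apply: eq_bigr => n _; rewrite !mulrDr.
Qed.

(** * Perturbing the unique optimum *)

Section optimality.
Context {R : realType} (alpha : nat -> R) (h : nat) (kappa : nat -> R).
Hypothesis alpha01 : forall i, 0 <= alpha i <= 1.
Hypothesis alpha_max : exists i, alpha i = 1.
Hypothesis alpha0 : alpha n @[n --> \oo] --> (0 : R).
Hypothesis kappa_opt : unique (solution alpha h) kappa.
Let l := lagged alpha h.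

Lemma lagged01 i : 0 <= l i <= 1.
Proof. by rewrite /l /lagged; case: ifP => //; rewrite lexx ler01. Qed.

Lemma feasibleE (k : nat -> R) : feasible alpha h k <->
  [/\ (1 <= \sum_(0 <= i <oo) (l i * k i)%:E)%E,
      (1 <= \sum_(0 <= i <oo) (alpha i * k i)%:E)%E & forall i, 0 <= k i].
Proof. by rewrite /feasible feasible_lagged. Qed.

Lemma kappa_ge0 i : 0 <= kappa i.
Proof. by case: kappa_opt => -[[_ _]]. Qed.

Lemma objective_fin : (objective kappa < +oo)%E.
Proof.
have [m am] := alpha_max.
(* The weight at [m] meets the second constraint, as [alpha m = 1]; the weight at [m + h] meets the
   first, as [l (m + h) = alpha m]. *)
pose k := three_point m (m + h) 0 (1 : R) 1 0.
have k0 i : 0 <= k i by rewrite /k /three_point !addr_ge0 ?mulr_ge0.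
have sumE (f : nat -> R) : (\sum_(0 <= i <oo) (f i * k i)%:E)%E = (f m + f (m + h)%N)%:E.
  apply: nneseries_EFin.
  pose N := (m + h).+1.
  have fk0 n : (N <= n)%N -> f n * k n = 0.
    move=> Nn; rewrite /k /three_point mul0r !mul1r addr0.
    have -> : (n == m) = false by apply/eqP => nm; move: Nn; rewrite /N nm ltnNge leq_addr.
    have -> : (n == m + h)%N = false by apply/eqP => nm; move: Nn; rewrite /N nm ltnn.
    by rewrite addr0 mulr0.
  have := @series_finite_change R (cst 0) (fun n => f n * k n) 0 N fk0.
  rewrite (@sum_three_point _ f m (m + h) 0) ?ltnS ?leq_addr// !mulr1 mulr0 addr0 add0r.
  rewrite (_ : (fun n => cst 0 n + _) = fun n => f n * k n); last first.
    by apply/funext => n; rewrite add0r.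
  apply; rewrite (_ : (fun n => _) = cst 0); first exact: cvg_cst.
  by apply/funext => n; rewrite /series /= big1.
have : feasible alpha h k.
  apply/feasibleE; split; last by [].
    by rewrite sumE lee_fin /l /lagged leq_addl addnK am lerDr -/l; have /andP[] := lagged01 m.
  by rewrite sumE lee_fin am lerDl; have /andP[] := alpha01 (m + h)%N.
case: kappa_opt => -[_ opt] _ /opt /le_lt_trans; apply.
have -> : objective k = (\sum_(0 <= i <oo) ((cst 1 : nat -> R) i * k i)%:E)%E.
  by apply: congr_lim; apply/funext => n; apply: eq_bigr => i _; rewrite /= mul1r.
by rewrite sumE ltry.
Qed.

Lemma constraint_series (f : nat -> R) : (forall i, 0 <= f i <= 1) ->
  exists u : R, series (fun i => f i * kappa i) n @[n --> \oo] --> u.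
Proof.
move=> f01; apply: nneseries_fin => [i|].
  by rewrite mulr_ge0 ?kappa_ge0//; have /andP[] := f01 i.
apply: le_lt_trans objective_fin; apply: lee_nneseries => i _ /=.
  by rewrite lee_fin mulr_ge0 ?kappa_ge0//; have /andP[] := f01 i.
by rewrite lee_fin ler_piMl ?kappa_ge0//; have /andP[] := f01 i.
Qed.

Definition lag_total : R := sval (cid (constraint_series lagged01)).
Definition total : R := sval (cid (constraint_series alpha01)).

Lemma lag_total_cvg : series (fun i => l i * kappa i) n @[n --> \oo] --> lag_total.
Proof. exact: (svalP (cid (constraint_series lagged01))). Qed.

Lemma total_cvg : series (fun i => alpha i * kappa i) n @[n --> \oo] --> total.
Proof. exact: (svalP (cid (constraint_series alpha01))). Qed.

Lemma lag_total_ge1 : 1 <= lag_total.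
Proof.
have [[/feasibleE[+ _ _] _] _] := kappa_opt.
by rewrite (nneseries_EFin lag_total_cvg) lee_fin.
Qed.

Lemma total_ge1 : 1 <= total.
Proof.
have [[/feasibleE[_ + _] _] _] := kappa_opt.
by rewrite (nneseries_EFin total_cvg) lee_fin.
Qed.

(* A perturbation of kappa that stays feasible and does not increase the
   objective would be a second solution. *)
Lemma perturbation (w : nat -> R) N :
  (forall k, (N <= k)%N -> w k = 0) -> (forall k, 0 <= kappa k + w k) ->
  1 <= lag_total + \sum_(k < N) l k * w k ->
  1 <= total + \sum_(k < N) alpha k * w k ->
  \sum_(k < N) w k <= 0 -> forall k, w k = 0.
Proof.
move=> w0 kw0 c1 c2 sw k.
have [S kS] := nneseries_fin kappa_ge0 objective_fin.
have objE : objective (fun k => kappa k + w k) = (S + \sum_(k < N) w k)%:E.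
  by apply: nneseries_EFin; exact: series_finite_change.
suff sol : solution alpha h (fun k => kappa k + w k).
  have /(congr1 (fun f => f k)) /= := (proj2 kappa_opt) _ sol.
  by move=> H; apply: (addrI (kappa k)); rewrite -H addr0.
split; last first.
  move=> k' /(proj2 (proj1 kappa_opt)); apply: le_trans.
  by rewrite objE /objective (nneseries_EFin kS) lee_fin gerDl.
have sumE (f : nat -> R) u : series (fun i => f i * kappa i) n @[n --> \oo] --> u ->
      (\sum_(0 <= i <oo) (f i * (kappa i + w i))%:E)%E = (u + \sum_(k < N) f k * w k)%:E.
    move=> fu; apply: nneseries_EFin.
    have fw0 k' : (N <= k')%N -> f k' * w k' = 0 by move=> /w0 ->; rewrite mulr0.
    have := series_finite_change fw0 fu.
    by under [X in series X]eq_fun do rewrite -mulrDr.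
apply/feasibleE; split => //.
- by rewrite (sumE _ _ lag_total_cvg) lee_fin.
- by rewrite (sumE _ _ total_cvg) lee_fin.
Qed.

Lemma small_near (A d : R) : 0 < d -> \forall e \near (0 : R)^'+, e * A <= d.
Proof.
move=> d0; near=> e.
have e0 : 0 < e by near: e; exact: nbhs_right_gt.
rewrite (le_trans (ler_norm _))// normrM (gtr0_norm e0).
rewrite (@le_trans _ _ (e * (`|A| + 1)))// ?ler_wpM2l ?(ltW e0) ?lerDl//.
rewrite -ler_pdivlMr ?ltr_wpDl//; near: e; apply: nbhs_right_le.
by rewrite divr_gt0// ltr_wpDl.
Unshelve. all: by end_near. Qed.

(** A small step in a direction that is negative only where [kappa] is positive stays nonnegative,
    and each constraint either has slack to absorb the change or is not lowered. The step is thus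
    feasible, and by uniqueness it must strictly increase the objective. *)
Lemma perturbation3 i j k (ci cj ck : R) :
  (ci < 0 -> 0 < kappa i) -> (cj < 0 -> 0 < kappa j) -> (ck < 0 -> 0 < kappa k) ->
  1 < lag_total \/ 0 <= l i * ci + l j * cj + l k * ck ->
  1 < total \/ 0 <= alpha i * ci + alpha j * cj + alpha k * ck ->
  (exists n, three_point i j k ci cj ck n != 0) ->
  0 < ci + cj + ck.
Proof.
move=> hi hj hk hl ha [n0 w0]; rewrite ltNge; apply/negP => sw.
(* The three indices may coincide, so each of the three terms may use up at most a third of
   [kappa n]. *)
have term m c : (c < 0 -> 0 < kappa m) ->
    \forall e \near (0 : R)^'+, forall n, - (kappa n / 3%:R) <= e * (c * (n == m)%:R).
  move=> mc; have [c0|c0] := leP 0 c.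
    near=> e => n; have e0 : 0 < e by near: e; exact: nbhs_right_gt.
    by rewrite (@le_trans _ _ 0)// ?oppr_le0 ?divr_ge0 ?kappa_ge0// !mulr_ge0// ltW.
  have km : 0 < kappa m / 3%:R by rewrite divr_gt0// mc.
  near=> e => n; have e0 : 0 < e by near: e; exact: nbhs_right_gt.
  have [->|_] := eqVneq n m.
    by rewrite mulr1 lerNl -mulrN; near: e; exact: small_near.
  by rewrite !mulr0 oppr_le0 divr_ge0 ?kappa_ge0.
have constr u A : 1 <= u -> 1 < u \/ 0 <= A ->
    \forall e \near (0 : R)^'+, 1 <= u + e * A.
  move=> u1 [u1'|A0]; near=> e; have e0 : 0 < e by near: e; exact: nbhs_right_gt.
    have : e * - A <= u - 1 by near: e; apply: small_near; rewrite subr_gt0.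
    by rewrite mulrN; lra.
  by rewrite (le_trans u1)// lerDl mulr_ge0// ltW.
suff [e e0] : exists2 e : R, 0 < e & forall n, e * three_point i j k ci cj ck n = 0.
  by move=> /(_ n0)/eqP; rewrite mulf_eq0 (negbTE w0) orbF gt_eqF.
near (0 : R)^'+ => e; exists e; first by near: e; exact: nbhs_right_gt.
pose N := (i + j + k).+1.
have iN : (i < N)%N by rewrite /N ltnS -addnA leq_addr.
have jN : (j < N)%N by rewrite /N ltnS addnAC leq_addl.
have kN : (k < N)%N by rewrite /N ltnS leq_addl.
have sumE (f : nat -> R) : \sum_(n < N) f n * (e * three_point i j k ci cj ck n)
    = e * (f i * ci + f j * cj + f k * ck).
  rewrite -(sum_three_point f ci cj ck iN jN kN) mulr_sumr.
  by apply: eq_bigr => ? _; rewrite mulrCA.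
apply: (@perturbation _ N).
- move=> n Nn; rewrite /three_point.
  have E m : (m < N)%N -> (n == m) = false by move=> mN; rewrite gtn_eqF// (leq_trans mN).
  by rewrite !E// !mulr0 !addr0 mulr0.
- move=> n; rewrite /three_point !mulrDr.
  have Hi : forall n, - (kappa n / 3%:R) <= e * (ci * (n == i)%:R) by near: e; exact: term.
  have Hj : forall n, - (kappa n / 3%:R) <= e * (cj * (n == j)%:R) by near: e; exact: term.
  have Hk : forall n, - (kappa n / 3%:R) <= e * (ck * (n == k)%:R) by near: e; exact: term.
  have := Hi n; have := Hj n; have := Hk n.
  lra.
- by rewrite sumE; near: e; apply: constr => //; exact: lag_total_ge1.
- by rewrite sumE; near: e; apply: constr => //; exact: total_ge1.
- under eq_bigr do rewrite -[_ * _]mul1r.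
  rewrite (sumE (cst 1)) /= !mul1r.
  have e0 : 0 < e by near: e; exact: nbhs_right_gt.
  by rewrite pmulr_rle0.
Unshelve. all: by end_near. Qed.

Lemma support_series i j (f : nat -> R) : i != j ->
  (forall k, k != i -> k != j -> kappa k = 0) ->
  series (fun k => f k * kappa k) n @[n --> \oo] --> f i * kappa i + f j * kappa j.
Proof.
move=> ij k0.
pose w := three_point i j i (kappa i) (kappa j) 0.
have kE k : kappa k = w k.
  rewrite /w /three_point mul0r addr0.
  have [->|ki] := eqVneq k i; first by rewrite (negbTE ij) mulr1 mulr0 addr0.
  have [->|kj] := eqVneq k j; first by rewrite mulr1 mulr0 add0r.
  by rewrite !mulr0 addr0 k0.
pose N := (i + j).+1.
have iN : (i < N)%N by rewrite /N ltnS leq_addr.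
have jN : (j < N)%N by rewrite /N ltnS leq_addl.
have fw0 n : (N <= n)%N -> f n * w n = 0.
  move=> Nn; rewrite -kE k0 ?mulr0// neq_ltn.
    by rewrite (leq_trans iN Nn) orbT.
  by rewrite (leq_trans jN Nn) orbT.
have := @series_finite_change R (cst 0) (fun n => f n * w n) 0 N fw0.
rewrite /w sum_three_point // mulr0 addr0 add0r.
rewrite (_ : (fun n => cst 0 n + _) = fun n => f n * kappa n); last first.
  by apply/funext => n; rewrite /= add0r [in RHS]kE.
apply; rewrite (_ : (fun n => _) = cst 0); first exact: cvg_cst.
by apply/funext => n; rewrite /series /= big1.
Qed.

Lemma support_totals i j : i != j ->
  (forall k, k != i -> k != j -> kappa k = 0) ->
  [/\ objective kappa = (kappa i + kappa j)%:E,
      lag_total = l i * kappa i + l j * kappa j &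
      total = alpha i * kappa i + alpha j * kappa j].
Proof.
move=> ij k0; split.
- have := @support_series i j (cst 1) ij k0; rewrite /= !mul1r => /nneseries_EFin <-.
  by apply: congr_lim; apply/funext => n; apply: eq_bigr => m _; rewrite mul1r.
- exact: (cvg_unique _ lag_total_cvg (@support_series i j l ij k0)).
- exact: (cvg_unique _ total_cvg (@support_series i j alpha ij k0)).
Qed.

(** * Dual weights for two positive weights *)

Section two_positive.
Variables i j : nat.
Hypotheses (ij : i != j) (ki : 0 < kappa i) (kj : 0 < kappa j).

Lemma perturbation2 (ci cj : R) :
  1 < lag_total \/ 0 <= l i * ci + l j * cj ->
  1 < total \/ 0 <= alpha i * ci + alpha j * cj ->
  ci != 0 \/ cj != 0 -> 0 < ci + cj.
Proof.
move=> hl ha c0; rewrite -[ci + cj]addr0.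
apply: (@perturbation3 i j i ci cj 0) => //; rewrite ?mulr0 ?addr0//.
case: c0 => c0; [exists i|exists j]; rewrite /three_point eqxx mul0r addr0.
  by rewrite (negbTE ij) mulr0 addr0 mulr1.
by rewrite (eq_sym j) (negbTE ij) mulr0 add0r mulr1.
Qed.

(** If the first constraint had slack, weight could be moved at no cost to whichever of [i] and [j]
    has the larger [alpha], which does not lower the second constraint. *)
Lemma two_lag_total : lag_total = 1.
Proof.
apply/eqP; rewrite eq_le lag_total_ge1 andbT leNgt; apply/negP => lt1.
have [ge|/ltW ge] := leP (alpha i) (alpha j).
  have := @perturbation2 (-1) 1 (or_introl lt1).
  rewrite addNr ltxx; move=> H; suff: false by []; apply: H.
    by right; rewrite mulrN1 mulr1 addrC subr_ge0.
  by right; exact: oner_neq0.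
have := @perturbation2 1 (-1) (or_introl lt1).
rewrite subrr ltxx; move=> H; suff: false by []; apply: H.
  by right; rewrite mulrN1 mulr1 subr_ge0.
by left; exact: oner_neq0.
Qed.

Lemma two_total : total = 1.
Proof.
apply/eqP; rewrite eq_le total_ge1 andbT leNgt; apply/negP => lt1.
have [ge|/ltW ge] := leP (l i) (l j).
  have := @perturbation2 (-1) 1 _ (or_introl lt1).
  rewrite addNr ltxx; move=> H; suff: false by []; apply: H.
    by right; rewrite mulrN1 mulr1 addrC subr_ge0.
  by right; exact: oner_neq0.
have := @perturbation2 1 (-1) _ (or_introl lt1).
rewrite subrr ltxx; move=> H; suff: false by []; apply: H.
  by right; rewrite mulrN1 mulr1 subr_ge0.
by left; exact: oner_neq0.
Qed.

Let D := l i * alpha j - l j * alpha i.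

(** With determinant zero, some nonzero direction supported on [i] and [j] leaves both constraints
    unchanged. So does its opposite, and they cannot both have positive cost. *)
Lemma two_det_neq0 : D != 0.
Proof.
apply/eqP => D0.
have kernel (ci cj : R) : l i * ci + l j * cj = 0 ->
    alpha i * ci + alpha j * cj = 0 -> ci != 0 \/ cj != 0 -> False.
  move=> hl ha c0.
  have := @perturbation2 ci cj.
  rewrite hl ha lexx => /(_ (or_intror isT) (or_intror isT) c0).
  have := @perturbation2 (- ci) (- cj).
  rewrite !mulrN -!opprD hl ha oppr0 lexx !oppr_eq0.
  by move=> /(_ (or_intror isT) (or_intror isT) c0); lra.
have [li0|li0] := eqVneq (l i) 0; last first.
  apply: (@kernel (l j) (- l i)); rewrite ?oppr_eq0; [ring| |by right].
  by rewrite -[RHS]oppr0 -D0 /D; ring.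
have [lj0|lj0] := eqVneq (l j) 0; last first.
  apply: (@kernel (l j) (- l i)); rewrite ?oppr_eq0; [ring| |by left].
  by rewrite -[RHS]oppr0 -D0 /D; ring.
have [aj0|aj0] := eqVneq (alpha j) 0; last first.
  apply: (@kernel (alpha j) (- alpha i)); rewrite ?li0 ?lj0; [ring|ring|by left].
have [ai0|ai0] := eqVneq (alpha i) 0; last first.
  apply: (@kernel (alpha j) (- alpha i)); rewrite ?li0 ?lj0 ?oppr_eq0; [ring|ring|by right].
apply: (@kernel 1 0); rewrite ?li0 ?lj0 ?ai0 ?aj0; [ring|ring|left; exact: oner_neq0].
Qed.

(** Cramer's solution of [y1 * l k + y2 * alpha k = 1] for [k = i] and [k = j]. *)
Let y1 := (alpha j - alpha i) / D.
Let y2 := (l i - l j) / D.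

Lemma two_dual_lt1 k : k != i -> k != j -> y1 * l k + y2 * alpha k < 1.
Proof.
move=> nki nkj; have D0 := two_det_neq0.
(* By Cramer's rule, weights [ci] at [i] and [cj] at [j] contribute to both constraints exactly as a
   unit weight at [k]. Exchanging them for that unit keeps both constraints, so it must have
   positive cost [1 - ci - cj]. *)
pose ci := (l k * alpha j - alpha k * l j) / D.
pose cj := (l i * alpha k - alpha i * l k) / D.
have : 0 < - ci + - cj + 1.
  apply: (@perturbation3 i j k) => //.
  - by rewrite ltr10.
  - right; rewrite le_eqVlt; apply/orP; left; apply/eqP.
    by rewrite /ci /cj /D; field.
  - right; rewrite le_eqVlt; apply/orP; left; apply/eqP.
    by rewrite /ci /cj /D; field.
  - exists k; rewrite /three_point (negbTE nki) (negbTE nkj) eqxx !mulr0 !add0r mulr1.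
    exact: oner_neq0.
suff -> : y1 * l k + y2 * alpha k = ci + cj by lra.
by rewrite /y1 /y2 /ci /cj; field.
Qed.

(** If [kappa k] were positive, the exchange used for [two_dual_lt1] could be reversed, and its cost
    would be positive in both directions. *)
Lemma two_support k : k != i -> k != j -> kappa k = 0.
Proof.
move=> nki nkj; have D0 := two_det_neq0.
apply/eqP; rewrite eq_le kappa_ge0 andbT leNgt; apply/negP => kk.
pose ci := (l k * alpha j - alpha k * l j) / D.
pose cj := (l i * alpha k - alpha i * l k) / D.
have := two_dual_lt1 nki nkj.
have : 0 < ci + cj - 1.
  apply: (@perturbation3 i j k) => //.
  - right; rewrite le_eqVlt; apply/orP; left; apply/eqP.
    by rewrite /ci /cj /D; field.
  - right; rewrite le_eqVlt; apply/orP; left; apply/eqP.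
    by rewrite /ci /cj /D; field.
  - exists k; rewrite /three_point (negbTE nki) (negbTE nkj) eqxx !mulr0 !add0r mulr1.
    by rewrite oppr_eq0 oner_neq0.
suff -> : y1 * l k + y2 * alpha k = ci + cj by lra.
by rewrite /y1 /y2 /ci /cj; field.
Qed.

(** [y1] is the cost of raising the first constraint by one while keeping the second, by weights
    [alpha j / D] at [i] and [- (alpha i / D)] at [j]; [y2] is the cost with the constraints
    exchanged. Both directions are nonzero, so both costs are positive. *)
Lemma two_dual_gt0 : 0 < y1 /\ 0 < y2.
Proof.
have D0 := two_det_neq0; have D10 : D^-1 != 0 by rewrite invr_eq0.
have nz : (alpha j / D != 0 \/ - (alpha i / D) != 0) /\
          (- (l j / D) != 0 \/ l i / D != 0).
  split; apply/orP; rewrite -negb_and ?oppr_eq0 !mulf_eq0 !(negbTE D10) !orbF; apply/negP.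
    by move=> /andP[/eqP aj /eqP ai]; move: D0; rewrite /D aj ai !mulr0 subrr eqxx.
  by move=> /andP[/eqP aj /eqP ai]; move: D0; rewrite /D aj ai !mul0r subrr eqxx.
split.
  rewrite /y1 mulrBl; apply: perturbation2; last exact: nz.1; right.
    by rewrite (_ : _ + _ = 1) ?ler01// /D; field.
  by rewrite (_ : _ + _ = 0)//; field.
rewrite /y2 mulrBl addrC; apply: perturbation2; last exact: nz.2; right.
  by rewrite (_ : _ + _ = 0)//; field.
by rewrite (_ : _ + _ = 1) ?ler01// /D; field.
Qed.

End two_positive.

(** * Dual weights for one positive weight *)

Section one_positive.
Variable i : nat.
Hypotheses (ki : 0 < kappa i) (k0 : forall k, k != i -> kappa k = 0).

Lemma one_totals : [/\ objective kappa = (kappa i)%:E,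
  lag_total = l i * kappa i & total = alpha i * kappa i].
Proof.
have ij : i != i.+1 by rewrite neq_ltn ltnSn.
have kS : kappa i.+1 = 0 by rewrite k0// eq_sym.
have [|] := @support_totals i i.+1 ij; first by move=> k /k0.
by rewrite kS !mulr0 !addr0.
Qed.

Lemma one_perturbation k k' (ci c c' : R) : k != i -> k' != i -> 0 < c -> 0 <= c' ->
  1 < lag_total \/ 0 <= l i * ci + l k * c + l k' * c' ->
  1 < total \/ 0 <= alpha i * ci + alpha k * c + alpha k' * c' ->
  0 < ci + c + c'.
Proof.
move=> nk nk' c0 c0' hl ha; apply: (@perturbation3 i k k') => //.
- by rewrite ltNge ltW.
- by rewrite ltNge c0'.
- exists k; rewrite /three_point (negbTE nk) eqxx mulr0 add0r mulr1 gt_eqF//.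
  by rewrite ltr_wpDr// mulr_ge0.
Qed.

Lemma one_perturbation1 k (ci : R) : k != i ->
  1 < lag_total \/ 0 <= l i * ci + l k ->
  1 < total \/ 0 <= alpha i * ci + alpha k -> 0 < ci + 1.
Proof.
move=> nk hl ha; rewrite -[ci + 1]addr0.
by apply: (@one_perturbation k k) => //; rewrite ?ler01 ?ltr01// !mulr0 !mulr1 !addr0.
Qed.

Lemma one_some_tight : ~ (1 < lag_total /\ 1 < total).
Proof.
move=> [ll tt]; have : 0 < -1 + 0 + 0 :> R; last by move=> ?; lra.
apply: (@perturbation3 i i i) => //; [by left|by left|].
by exists i; rewrite /three_point eqxx !mulr1 !addr0 oppr_eq0 oner_neq0.
Qed.

Lemma one_coef_gt0 : 0 < l i /\ 0 < alpha i.
Proof.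
have [_ lE aE] := one_totals.
have := lt_le_trans ltr01 lag_total_ge1; have := lt_le_trans ltr01 total_ge1.
by rewrite lE aE !(pmulr_lgt0 _ ki).
Qed.

(** If only the first constraint were tight, exchanging [(l i)^-1] units at [i] for one unit at
    [m + h], where [l] is 1, would force [(l i)^-1 < 1]. Hence [i = m + h], so [l i = 1] and
    [kappa i = 1], and the second total is [alpha i <= 1], not slack after all. The other case is
    symmetric, with [m] in place of [m + h]. *)
Lemma one_tight : lag_total = 1 /\ total = 1.
Proof.
have [_ lE aE] := one_totals; have [li0 ai0] := one_coef_gt0.
have [m am] := alpha_max.
have lm : l (m + h)%N = 1 by rewrite /l /lagged leq_addl addnK.
have l1 := lag_total_ge1; have t1 := total_ge1.
have [/andP[_ li1] /andP[_ ai1]] := (lagged01 i, alpha01 i); rewrite -/l in li1.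
have [t1'|t1'] := ltP 1 total.
  have ll : lag_total = 1.
    by apply/eqP; rewrite eq_le l1 andbT leNgt; apply/negP => ?; exact: one_some_tight.
  suff li : l i = 1 by move: ll t1'; rewrite lE aE li mul1r => ->; rewrite mulr1 ltNge ai1.
  have [<-//|nm] := eqVneq (m + h)%N i.
  have := @one_perturbation1 _ (- (l i)^-1) nm.
  rewrite lm mulrN mulfV ?gt_eqF// addNr lexx => /(_ (or_intror isT) (or_introl t1')).
  rewrite addrC subr_gt0 invf_lt1// ltNge => /negP; case; exact: li1.
have tt : total = 1 by apply/eqP; rewrite eq_le t1'.
split=> //; apply/eqP; rewrite eq_le l1 andbT leNgt; apply/negP => ll1.
suff ai : alpha i = 1 by move: tt ll1; rewrite lE aE ai mul1r => ->; rewrite mulr1 ltNge li1.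
have [<-//|nm] := eqVneq m i.
have := @one_perturbation1 _ (- (alpha i)^-1) nm (or_introl ll1).
rewrite am mulrN mulfV ?gt_eqF// addNr lexx => /(_ (or_intror isT)).
rewrite addrC subr_gt0 invf_lt1// ltNge => /negP; case; exact: ai1.
Qed.

Lemma one_lagged : l i = alpha i.
Proof.
have [lt tt] := one_tight; have [_ lE aE] := one_totals.
by apply: (mulIf (lt0r_neq0 ki)); rewrite -lE -aE lt tt.
Qed.

Lemma one_kappa : kappa i = (alpha i)^-1.
Proof.
have [lt tt] := one_tight; have [_ lE aE] := one_totals; have [_ ai0] := one_coef_gt0.
by apply: (mulfI (lt0r_neq0 ai0)); rewrite -aE tt mulfV ?gt_eqF.
Qed.

Lemma one_lag_le : (h <= i)%N.
Proof. by rewrite leqNgt; apply/negP => ih; have [] := one_coef_gt0; rewrite /l /lagged leqNgt ih ltxx. Qed.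

(* The dual weight of the first constraint is squeezed between the bounds
   imposed by the indices with [l k < alpha k] and those with
   [alpha k < l k]; only finitely many of them are active. *)
Lemma one_dual : exists lam : R, 0 < lam < 1 /\
  forall k, k != i -> lam * l k + (1 - lam) * alpha k < alpha i.
Proof.
have [_ ai0] := one_coef_gt0; set a := alpha i in ai0 *.
have li : l i = a := one_lagged.
(* Exchanging [alpha k / a] units at [i] for one unit at [k] keeps the second constraint and does
   not lower the first, so the exchange costs something: [alpha k / a < 1]. *)
have min_lt k : k != i -> alpha k <= l k -> alpha k < a.
  move=> nk le; have := @one_perturbation1 k (- (alpha k / a)) nk.
  rewrite li -/a mulrN mulrCA mulfV ?gt_eqF// mulr1 addNr lexx addrC subr_ge0.
  by move=> /(_ (or_intror le) (or_intror isT)); rewrite addrC subr_gt0 ltr_pdivrMr// mul1r.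
have min_lt' k : k != i -> l k <= alpha k -> l k < a.
  move=> nk le; have := @one_perturbation1 k (- (l k / a)) nk.
  rewrite li -/a mulrN mulrCA mulfV ?gt_eqF// mulr1 addNr lexx (addrC (- l k)) subr_ge0.
  by move=> /(_ (or_intror isT) (or_intror le)); rewrite addrC subr_gt0 ltr_pdivrMr// mul1r.
have [N NP] : exists N, forall k, (N <= k)%N -> alpha k < a /\ l k < a.
  move/cvgrPdist_lt : alpha0 => /(_ a ai0)[N0 _ N0P].
  have al k : (N0 <= k)%N -> alpha k < a.
    by move=> /N0P /=; rewrite sub0r normrN; apply: le_lt_trans; exact: ler_norm.
  exists (N0 + h)%N => k Nk; split; first by apply: al; rewrite (leq_trans _ Nk)// leq_addr.
  by rewrite /l /lagged (leq_trans _ Nk) ?leq_addl// al// leq_subRL ?(leq_trans _ Nk) ?leq_addl// addnC.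
pose lo := \big[Num.max/0]_(k < N | (k != i :> nat) && (l k < alpha k))
  ((alpha k - a) / (alpha k - l k)).
pose hi := \big[Num.min/1]_(k < N | (k != i :> nat) && (alpha k < l k))
  ((a - alpha k) / (l k - alpha k)).
have lohi : lo < hi.
  apply/bigmax_ltP; split.
    apply/bigmin_gtP; split => [|k /andP[nk lt]]; first exact: ltr01.
    by rewrite divr_gt0 ?subr_gt0// min_lt// ltW.
  move=> k /andP[nk lt]; apply/bigmin_gtP; split => [|k' /andP[nk' lt']].
    by rewrite ltr_pdivrMr ?subr_gt0// mul1r ltrD2l ltrN2 min_lt'// ltW.
  rewrite ltr_pdivrMr ?subr_gt0// mulrAC ltr_pdivlMr ?subr_gt0//.
  set D := l k' - alpha k'; set D' := alpha k - l k.
  have D0 : 0 < D by rewrite subr_gt0.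
  have D'0 : 0 < D' by rewrite subr_gt0.
  have a0 : a != 0 by rewrite gt_eqF.
  (* Weights [D] at [k] and [D'] at [k'] add the same amount [q] to both constraints, as [q / a]
     units at [i] do. The positive cost of this exchange, [q < a * (D + D')], is the required
     comparison of the two bounds on the dual weight. *)
  pose q := D * alpha k + D' * alpha k'.
  have := @one_perturbation k k' (- (q / a)) D D' nk nk' D0 (ltW D'0).
  rewrite li -/a (_ : _ + _ + _ = 0); last by rewrite /q /D /D'; field.
  rewrite (_ : a * _ + _ + _ = 0); last by rewrite /q /D /D'; field.
  rewrite lexx => /(_ (or_intror isT) (or_intror isT)).
  rewrite -(ltr_pM2r ai0) mul0r (_ : _ * a = (a * D' + a * D) - q); last first.
    by rewrite /q; field.
  by rewrite /q; nra.
have lo0 : 0 <= lo by exact: bigmax_ge_id.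
have hi1 : hi <= 1 by exact: bigmin_le_id.
exists ((lo + hi) / 2); split; first by lra.
move=> k nk; have [Nk|kN] := leqP N k.
  by have [] := NP _ Nk; nra.
have [lt|lt|eq] := ltgtP (alpha k) (l k).
- have : (lo + hi) / 2 < (a - alpha k) / (l k - alpha k).
    apply: (@lt_le_trans _ _ hi); first by lra.
    by apply: (@bigmin_le_cond _ _ _ _ (Ordinal kN)); rewrite nk.
  by rewrite ltr_pdivlMr ?subr_gt0//; lra.
- have : (alpha k - a) / (alpha k - l k) < (lo + hi) / 2.
    apply: (@le_lt_trans _ _ lo); last by lra.
    by apply: (@le_bigmax_cond _ _ _ _ (Ordinal kN)); rewrite nk.
  by rewrite ltr_pdivrMr ?subr_gt0//; lra.
- by rewrite -eq; have := min_lt k nk; rewrite -eq lexx => /(_ isT); lra.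
Qed.

End one_positive.

End optimality.

(** * Independence *)

Section independence.
Context d (T : measurableType d) (R : realType) (P : probability T R).

(** [B |-> P (A]&[B)] and [B |-> P A * P B] are finite measures that agree on a pi-system containing
    the whole space, hence on the sigma-algebra it generates. *)
Lemma indep_sigma_algebra (A : set T) (G : set (set T)) :
  measurable A -> G `<=` measurable -> setI_closed G -> G setT ->
  (forall B, G B -> P (A `&` B) = (P A * P B)%E) ->
  forall B, <<s G >> B -> P (A `&` B) = (P A * P B)%E.
Proof.
move=> mA Gm GI GT AG B sB.
have PA0 : 0 <= fine (P A) by rewrite fine_ge0.
pose m1 : {measure set T -> \bar R} := mrestr P mA.
pose m2 : {measure set T -> \bar R} := mscale (NngNum PA0) P.
have := @g_sigma_algebra_measure_unique _ R T G Gm (fun=> setT) (fun=> GT) _ m1 m2 GI.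
rewrite bigcup_const //= => /(_ erefl) H.
have m12 C : G C -> m1 C = m2 C.
  move=> GC; rewrite /m1 /m2 /= /mrestr /mscale /= setIC AG//.
  by rewrite fineK// fin_num_measure.
have m1oo : forall k : nat, (m1 setT < +oo)%E.
  by move=> _; rewrite /m1 /= /mrestr setTI ltey_eq fin_num_measure.
have := H m12 m1oo _ sB.
rewrite /m1 /m2 /= /mrestr /mscale /= setIC => ->.
by rewrite fineK// fin_num_measure.
Qed.

(** The law of the pair is the product of the laws, so Tonelli applies. The variable [V] is kept
    outside: with its value frozen, [U] is integrated under its own law, which replaces conditional
    expectations throughout. *)
Lemma integral_independent d1 d2 (T1 : measurableType d1) (T2 : measurableType d2)
    (U : T -> T1) (V : T -> T2) (F : T1 * T2 -> \bar R) :
  measurable_fun setT U -> measurable_fun setT V -> measurable_fun [set: T1 * T2] F ->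
  (forall z, (0 <= F z)%E) ->
  (forall A B, measurable A -> measurable B ->
    P (U @^-1` A `&` V @^-1` B) = (P (U @^-1` A) * P (V @^-1` B))%E) ->
  (\int[P]_w F (U w, V w) = \int[P]_w \int[P]_w' F (U w', V w))%E.
Proof.
move=> mU mV mF F0 UV.
pose hU := isMeasurableFun.Build _ _ _ _ _ mU.
pose U' : {RV P >-> T1} := HB.pack U hU.
pose hV := isMeasurableFun.Build _ _ _ _ _ mV.
pose V' : {RV P >-> T2} := HB.pack V hV.
have mW : measurable_fun setT (fun w => (U w, V w)) by exact: measurable_fun_pair.
pose hW := isMeasurableFun.Build _ _ _ _ _ mW.
pose W' : {RV P >-> (T1 * T2)%type} := HB.pack (fun w => (U w, V w)) hW.
transitivity (\int[distribution P W']_z F z)%E.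
  by rewrite ge0_integral_distribution.
pose m : probability T2 R := distribution P V'.
pose m' : probability T1 R := distribution P U'.
have E A : measurable A -> (m' \x m)%E A = distribution P W' A.
  apply: product_measure_unique => A' B' mA mB.
  exact: UV.
transitivity (\int[m' \x m]_z F z)%E.
  by apply: eq_measure_integral => A mA _; apply/esym; exact: E.
rewrite fubini_tonelli1// /fubini_F fubini_tonelli//.
rewrite /m ge0_integral_distribution//; last first.
- by move=> y; apply: integral_ge0 => x _.
- exact: (@measurable_fun_fubini_tonelli_G _ _ T1 T2 R m' F).
apply: eq_integral => w _ /=; rewrite /m' ge0_integral_distribution//=.
exact: measurableT_comp.
Qed.

Lemma integral_independent_mul d1 d2 (T1 : measurableType d1) (T2 : measurableType d2)
    (U : T -> T1) (V : T -> T2) (f : T1 -> R) (g : T2 -> R) :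
  measurable_fun setT U -> measurable_fun setT V ->
  measurable_fun setT f -> measurable_fun setT g ->
  (forall u, 0 <= f u) -> (forall v, 0 <= g v) ->
  (forall A B, measurable A -> measurable B ->
    P (U @^-1` A `&` V @^-1` B) = (P (U @^-1` A) * P (V @^-1` B))%E) ->
  (\int[P]_w (f (U w) * g (V w))%:E =
   (\int[P]_w (f (U w))%:E) * \int[P]_w (g (V w))%:E)%E.
Proof.
move=> mU mV mf mg f0 g0 UV.
have mfU : measurable_fun setT (fun w => (f (U w))%:E).
  by apply/measurable_EFinP; exact: measurableT_comp.
have mgV : measurable_fun setT (fun w => (g (V w))%:E).
  by apply/measurable_EFinP; exact: measurableT_comp.
pose F (z : T1 * T2) := (f z.1 * g z.2)%:E.
have mF : measurable_fun [set: T1 * T2] F.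
  apply/measurable_EFinP; apply: measurable_funM.
    exact: measurableT_comp.
  exact: measurableT_comp.
rewrite (integral_independent mU mV mF _ UV); last first.
  by move=> z; rewrite lee_fin mulr_ge0.
have If0 : (0 <= \int[P]_w (f (U w))%:E)%E.
  by apply: integral_ge0 => w _; rewrite lee_fin.
rewrite -ge0_integralZl//; last by move=> w _; rewrite lee_fin.
apply: eq_integral => w _; rewrite /F /= muleC -ge0_integralZl//.
- by apply: eq_integral => w' _; rewrite -EFinM mulrC.
- by move=> w' _; rewrite lee_fin.
- by rewrite lee_fin.
Qed.

End independence.

(** * Independence of one noise variable from all the others *)

Section sigma_others.
Context d (T : measurableType d) (R : realType) (P : probability T R).
Variables eta eps : int -> {RV P >-> R}.
Hypothesis eta_indep : independent_family eta.
Hypothesis eta_eps : independent_of eta eps.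

Let meas_pre (X : {RV P >-> R}) (B : set R) : measurable B -> measurable (X @^-1` B).
Proof. by move=> mB; rewrite -[X in measurable X]setTI; exact: measurable_funP. Qed.

(* A pi-system generating the sigma-algebra of all the [eps s] and of the
   [eta s] with s different from t. *)
Definition others (t : int) : set (set T) :=
  [set C | exists (J : seq int) (B : int -> set R) (F : set T),
     [/\ uniq J, t \notin J, forall i, measurable (B i), sigma_generated eps F &
       C = \bigcap_(i in [set` J]) (eta i @^-1` B i) `&` F]].

Lemma sigma_generated_measurable (Y : int -> {RV P >-> R}) :
  sigma_generated Y `<=` measurable.
Proof.
apply: smallest_sub; first exact: sigma_algebra_measurable.
by move=> _ [i _ [B mB <-]]; rewrite setTI; exact: meas_pre.
Qed.

Lemma sigma_generated_bigcap (Y : int -> {RV P >-> R}) (J : seq int) B :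
  (forall i, measurable (B i)) ->
  sigma_generated Y (\bigcap_(i in [set` J]) (Y i @^-1` B i)).
Proof.
move=> mB; apply: (@fin_bigcap_measurable _ (g_sigma_algebraType _)) => //.
move=> i _; apply: sub_sigma_algebra; exists i => //; exists (B i) => //.
by rewrite setTI.
Qed.

Lemma others_measurable t : others t `<=` measurable.
Proof.
move=> _ [J [B [F [_ _ mB sF ->]]]]; apply: measurableI.
  by apply: (sigma_generated_measurable (Y := eta)); exact: sigma_generated_bigcap.
exact: (sigma_generated_measurable (Y := eps) sF).
Qed.

Lemma sigma_generatedT (Y : int -> {RV P >-> R}) : sigma_generated Y setT.
Proof. exact: (@measurableT _ (g_sigma_algebraType _)). Qed.

Lemma othersT t : others t setT.
Proof.
exists [::], (fun=> setT), setT; split => //; first exact: sigma_generatedT.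
by rewrite setIT; apply/esym/bigcapT.
Qed.

Lemma others_setI t : setI_closed (others t).
Proof.
move=> _ _ [J [B [F [uJ tJ mB sF ->]]]] [J' [B' [F' [uJ' tJ' mB' sF' ->]]]].
exists (undup (J ++ J')).
exists (fun i => (if i \in J then B i else setT) `&` (if i \in J' then B' i else setT)).
exists (F `&` F'); split.
- exact: undup_uniq.
- by rewrite mem_undup mem_cat negb_or tJ.
- by move=> i; apply: measurableI; case: ifP.
- exact: (@measurableI _ (g_sigma_algebraType _)).
- rewrite setIACA; congr (_ `&` _); apply/seteqP; split => w.
    move=> [w1 w2] i /=; rewrite mem_undup mem_cat => _; split.
      by case: ifP => // iJ; exact: w1.
    by case: ifP => // iJ; exact: w2.
  move=> ww; split => i /= iJ.
    have := ww i; rewrite /= mem_undup mem_cat iJ => /(_ isT)[].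
    by [].
  have := ww i; rewrite /= mem_undup mem_cat iJ orbT => /(_ isT)[_].
  by [].
Qed.

(** On the generating pi-system, independence of [eta] and [eps] splits off the event [F]; what
    remains is independence inside [eta] for the index list [t :: J]. *)
Lemma others_indep t (A : set R) (C : set T) : measurable A -> <<s others t >> C ->
  P (eta t @^-1` A `&` C) = (P (eta t @^-1` A) * P C)%E.
Proof.
move=> mA; apply: indep_sigma_algebra.
- exact: meas_pre.
- exact: others_measurable.
- exact: others_setI.
- exact: othersT.
move=> _ [J [B [F [uJ tJ mB sF ->]]]].
pose B' i := if i == t then A else B i.
have mB' i : measurable (B' i) by rewrite /B'; case: ifP.
have capE : eta t @^-1` A `&` \bigcap_(i in [set` J]) (eta i @^-1` B i) =
    \bigcap_(i in [set` t :: J]) (eta i @^-1` B' i).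
  apply/seteqP; split => w.
    move=> [wA wB] i /=; rewrite inE /B'; case: eqP => [-> //|_ /= iJ].
    exact: wB.
  move=> ww; split; first by have := ww t; rewrite /= inE /B' eqxx => /(_ isT).
  move=> i /= iJ; have := ww i; rewrite /= inE iJ orbT => /(_ isT).
  by rewrite /B'; case: eqP => // it; move: tJ; rewrite -it iJ.
have sB : sigma_generated eta (\bigcap_(i in [set` J]) (eta i @^-1` B i)).
  exact: sigma_generated_bigcap.
rewrite setIA eta_eps//; last by rewrite capE; exact: sigma_generated_bigcap.
rewrite (eta_eps sB sF) muleA; congr (_ * _)%E.
have PE Q : measurable Q -> P Q = (fine (P Q))%:E.
  by move=> mQ; rewrite fineK// fin_num_measure.
have mcap : measurable (\bigcap_(i in [set` J]) (eta i @^-1` B i)).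
  exact: (sigma_generated_measurable (Y := eta) sB).
rewrite PE; last by apply: measurableI => //; exact: meas_pre.
rewrite [in RHS]PE; last exact: meas_pre.
rewrite [X in (_ * X)%E]PE// -EFinM; congr EFin.
rewrite capE eta_indep ?cons_uniq ?tJ// big_cons {1}/B' eqxx; congr (_ * _).
rewrite eta_indep//; apply: eq_big_seq => i iJ.
by rewrite /B'; case: eqP => // it; move: tJ; rewrite -it iJ.
Qed.

Lemma eta_others t s : s != t ->
  measurable_fun [set: g_sigma_algebraType (others t)] (eta s : T -> R).
Proof.
move=> st _ B mB; rewrite setTI; apply: sub_sigma_algebra.
exists [:: s], (fun=> B), setT; split => //; first by rewrite inE eq_sym.
  exact: sigma_generatedT.
rewrite setIT; apply/seteqP; split => w /=; first by move=> wB i /=; rewrite inE => /eqP ->.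
by move=> /(_ s); apply; rewrite /= inE.
Qed.

Lemma eps_others t s :
  measurable_fun [set: g_sigma_algebraType (others t)] (eps s : T -> R).
Proof.
move=> _ B mB; rewrite setTI; apply: sub_sigma_algebra.
exists [::], (fun=> B), (eps s @^-1` B); split => //.
  apply: sub_sigma_algebra; exists s => //; exists B => //.
  by rewrite setTI.
by rewrite (_ : \bigcap_(i in _) _ = setT) ?setTI//; apply/seteqP; split => // w _ i.
Qed.

Lemma others_measurable_fun t d' (T' : measurableType d') (V : T -> T') :
  measurable_fun [set: g_sigma_algebraType (others t)] V -> measurable_fun setT V.
Proof.
move=> mV _ B mB; rewrite setTI.
have : <<s others t >> (V @^-1` B) by rewrite -[X in <<s _ >> X]setTI; exact: mV.
by apply: smallest_sub; [exact: sigma_algebra_measurable|exact: others_measurable].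
Qed.

Lemma eta_indep_others t d' (T' : measurableType d') (V : T -> T') A B :
  measurable_fun [set: g_sigma_algebraType (others t)] V ->
  measurable A -> measurable B ->
  P (eta t @^-1` A `&` V @^-1` B) = (P (eta t @^-1` A) * P (V @^-1` B))%E.
Proof.
move=> mV mA mB; apply: others_indep => //.
by rewrite -[X in <<s _ >> X]setTI; exact: mV.
Qed.

End sigma_others.

(** * Asymptotically exponential tails *)

Lemma cvg_near_eq (R : realType) (I : Type) (F : set_system I) (FF : Filter F)
    (f g : I -> R) (l : R) :
  (\forall x \near F, f x = g x) -> f x @[x --> F] --> l -> g x @[x --> F] --> l.
Proof.
move=> fg; apply: cvg_trans; apply: near_eq_cvg.
by apply: filterS fg => x ->.
Qed.

Section exponential_tail.
Context {R : realType} (F : R -> R).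
Hypothesis F_anti : forall x y, x <= y -> F y <= F x.
Hypothesis F_gt0 : forall x, 0 < F x.
Hypothesis F_le1 : forall x, F x <= 1.
Hypothesis F_shift : forall m : R, F (z + m) / F z @[z --> +oo] --> expR (- m).

Lemma near_pinfty_exists (Q : R -> Prop) : (\forall z \near +oo, Q z) ->
  exists2 z0 : R, 0 < z0 & forall z, z0 <= z -> Q z.
Proof.
move=> [M [_ MQ]]; exists (Num.max M 0 + 1) => [|z Mz].
  by rewrite ltr_wpDl// le_max lexx orbT.
by apply: MQ; apply: lt_le_trans Mz; rewrite ltr_pwDr// le_max lexx.
Qed.

Lemma tail_step (e : R) : 0 < e -> exists2 z0 : R, 0 < z0 & forall z, z0 <= z ->
  expR (- (1 + e)) * F z <= F (z + 1) <= expR (- (1 - e)) * F z.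
Proof.
move=> e0; apply: near_pinfty_exists.
have lo : expR (- (1 + e)) < expR (- 1) by rewrite ltr_expR; lra.
have hi : expR (- 1) < expR (- (1 - e)) by rewrite ltr_expR; lra.
near=> z.
have h1 : expR (- (1 + e)) < F (z + 1) / F z.
  by near: z; exact: (cvgr_gt _ (@F_shift 1) _ lo).
have h2 : F (z + 1) / F z < expR (- (1 - e)).
  by near: z; exact: (cvgr_lt _ (@F_shift 1) _ hi).
by apply/andP; split; [rewrite -ler_pdivlMr// ltW|rewrite -ler_pdivrMr// ltW].
Unshelve. all: by end_near. Qed.

Lemma tail_iter (e z0 : R) :
  (forall z, z0 <= z ->
    expR (- (1 + e)) * F z <= F (z + 1) <= expR (- (1 - e)) * F z) ->
  forall (n : nat) z, z0 <= z ->
    expR (- (1 + e) * n%:R) * F z <= F (z + n%:R) <= expR (- (1 - e) * n%:R) * F z.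
Proof.
move=> step; elim=> [|n IH] z zz; first by rewrite !mulr0 expR0 !mul1r addr0 lexx.
have /andP[a b] := IH _ zz.
have /andP[a' b'] : expR (- (1 + e)) * F (z + n%:R) <= F (z + n%:R + 1)
    <= expR (- (1 - e)) * F (z + n%:R).
  by apply: step; rewrite ler_wpDr.
rewrite -natr1 addrA; apply/andP; split.
  apply: le_trans a'; rewrite mulrDr mulr1 expRD [X in X * _]mulrC -mulrA.
  by rewrite ler_pM2l ?expR_gt0.
apply: (le_trans b'); rewrite mulrDr mulr1 expRD [X in _ <= X * _]mulrC -mulrA.
by rewrite ler_pM2l ?expR_gt0.
Qed.

(** Rounding [m] to an integer costs at most one unit step, that is a factor [expR (1 - e)] in the
    first bound and [expR (1 + e)] in the second, both below [expR 2]. *)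
Lemma tail_growth (e : R) : 0 < e < 1 -> exists2 z0 : R, 0 < z0 &
  forall z m, z0 <= z -> 0 <= m ->
    F (z + m) <= expR 2 * expR (- (1 - e) * m) * F z /\
    F z <= expR 2 * expR ((1 + e) * m) * F (z + m).
Proof.
move=> /andP[e0 e1]; have [z0 z00 step] := tail_step e0; exists z0 => // z m zz m0.
have iter := tail_iter step.
have := truncn_itv m0; set n := Num.trunc m => /andP[nm mn].
have /andP[_ b] := iter n _ zz; have /andP[a _] := iter n.+1 _ zz.
split.
  apply: (@le_trans _ _ (F (z + n%:R))); first by apply: F_anti; rewrite lerD2l.
  apply: (le_trans b); rewrite ler_pM2r// -expRD ler_expR.
  rewrite -natr1 in mn; nra.
rewrite mulrAC -ler_pdivrMr ?expR_gt0// -expRN mulrC -ler_pdivrMl ?expR_gt0//.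
rewrite -expRN mulrA -expRD.
apply: (@le_trans _ _ (F (z + n.+1%:R))); last by apply: F_anti; rewrite lerD2l ltW.
apply: le_trans a; rewrite ler_pM2r// ler_expR -natr1.
nra.
Qed.

(** A Potter bound valid for all real [m]. When [z + m] falls below [z0], where the growth estimates
    say nothing, [F (z + m) <= 1] is compared with the growth from [z0] up to [z], at the price of
    the factor [(F z0)^-1]. *)
Lemma tail_potter (e : R) : 0 < e < 1 -> exists2 C : R, 0 < C &
  exists2 z0 : R, 0 < z0 & forall z m, z0 <= z ->
    F (z + m) <= C * expR (- m + e * `|m|) * F z.
Proof.
move=> e01; have [z0 z00 growth] := tail_growth e01; have /andP[e0 e1] := e01.
have iF : 1 <= (F z0)^-1 by rewrite invf_ge1.
exists (expR 2 * (F z0)^-1); first by rewrite mulr_gt0 ?expR_gt0 ?invr_gt0.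
exists z0 => // z m zz.
suff : F (z + m) <= expR 2 * expR (- m + e * `|m|) * F z \/
       F (z + m) <= (F z0)^-1 * (expR 2 * expR (- m + e * `|m|) * F z).
  have pos : 0 <= expR 2 * expR (- m + e * `|m|) * F z by rewrite !mulr_ge0 ?expR_ge0// ltW.
  rewrite (_ : expR 2 / F z0 * _ * _ = (F z0)^-1 * (expR 2 * expR (- m + e * `|m|) * F z)); last by ring.
  by case=> // /le_trans; apply; rewrite ler_peMl.
have [m0|m0] := leP 0 m.
  left; have [+ _] := growth z m zz m0; move=> /le_trans; apply.
  by rewrite (ger0_norm m0) (_ : - (1 - e) * m = - m + e * m) //; ring.
rewrite (ltr0_norm m0).
have [zm|zm] := leP z0 (z + m).
  left; have [_] := growth (z + m) (- m) zm ltac:(by rewrite oppr_ge0 ltW).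
  rewrite addrK => /le_trans; apply.
  by rewrite (_ : (1 + e) * - m = - m + e * - m) //; ring.
right; apply: (le_trans (F_le1 _)); rewrite mulrC ler_pdivlMr// mul1r.
have [_] := growth z0 (z - z0) (lexx _) ltac:(by rewrite subr_ge0).
rewrite (addrC z0) subrK => /le_trans; apply.
rewrite ler_pM2r// ler_pM2l ?expR_gt0// ler_expR; nra.
Qed.

Lemma tail_lower (e : R) : 0 < e < 1 -> exists2 c : R, 0 < c &
  exists2 z0 : R, 0 < z0 & forall z, z0 <= z -> c * expR (- (1 + e) * z) <= F z.
Proof.
move=> e01; have [z0 z00 growth] := tail_growth e01; have /andP[e0 e1] := e01.
exists (F z0 * expR (- 2)); first by rewrite mulr_gt0 ?expR_gt0.
exists z0 => // z zz.
have [_] := growth z0 (z - z0) (lexx _) ltac:(by rewrite subr_ge0).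
rewrite (addrC z0) subrK mulrAC -ler_pdivrMr ?expR_gt0// -expRN => H.
apply: le_trans (_ : F z0 * expR (- ((1 + e) * (z - z0))) * expR (- 2) <= _); last first.
  by rewrite [X in _ * X]expRN ler_pdivrMr ?expR_gt0// [leRHS]mulrC.
rewrite mulrAC ler_pM2r ?expR_gt0// ler_pM2l// ler_expR.
nra.
Qed.

Lemma tail_upper (e : R) : 0 < e < 1 -> exists2 z0 : R, 0 < z0 &
  forall n : nat, F (z0 + n%:R) <= expR (- (1 - e) * n%:R).
Proof.
move=> /andP[e0 e1]; have [z0 z00 step] := tail_step e0; exists z0 => // n.
have /andP[_ /le_trans] := tail_iter step n (lexx _); apply.
by rewrite ler_piMr ?expR_ge0.
Qed.

End exponential_tail.

(** * The Gamma-type tail has exponential shift ratios *)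

Section gamma_tail.
Context {R : realType} (F : R -> R) (K beta : R).
Hypothesis K0 : 0 < K.
Hypothesis F_anti : forall x y, x <= y -> F y <= F x.
Hypothesis F_ge0 : forall x, 0 <= F x.
Hypothesis F_gamma :
  F z / (K * z `^ beta * expR (- z)) @[z --> +oo] --> (1 : R).

Lemma gamma_tail_gt0 x : 0 < F x.
Proof.
have : \forall z \near +oo, 0 < F z / (K * z `^ beta * expR (- z)).
  exact: (cvgr_gt _ F_gamma _ ltr01).
move=> /near_pinfty_exists[z0 z00 pos].
apply: (@lt_le_trans _ _ (F (Num.max x z0))); last first.
  by apply: F_anti; rewrite le_max lexx.
rewrite lt_neqAle F_ge0 andbT eq_sym; apply/eqP => F0.
have := pos (Num.max x z0); rewrite le_max lexx orbT => /(_ isT).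
by rewrite F0 mul0r ltxx.
Qed.

(** In [(z + m) ^ beta = z ^ beta * (1 + m / z) ^ beta] the last factor tends to 1, so only the
    exponential survives in the ratio. *)
Lemma gamma_tail_shift (m : R) : F (z + m) / F z @[z --> +oo] --> expR (- m).
Proof.
pose g z := K * z `^ beta * expR (- z).
have A : F (z + m) / g (z + m) @[z --> +oo] --> (1 : R).
  by rewrite (cvg_shiftr m (fun z => F z / g z)).
have B : g z / F z @[z --> +oo] --> (1 : R).
  rewrite -[X in _ --> X]invr1.
  apply: cvg_near_eq (cvgV (oner_neq0 _) F_gamma).
  by near=> z; rewrite /= invf_div.
have C : (1 + m / z) `^ beta @[z --> +oo] --> (1 : R).
  have inv0 : (z : R)^-1 @[z --> +oo] --> (0 : R).
    by apply/gtr0_cvgV0; [exact: nbhs_pinfty_gt|exact: cvg_id].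
  have l1 : ln (1 + m / z) @[z --> +oo] --> (0 : R).
    rewrite -ln1; apply: continuous_cvg; first exact: continuous_ln.
    rewrite -[X in _ --> X]addr0 -[X in _ + X](mulr0 m).
    by apply: cvgD; [exact: cvg_cst|apply: cvgM => //; exact: cvg_cst].
  have : expR (beta * ln (1 + m / z)) @[z --> +oo] --> expR (beta * 0).
    apply: continuous_cvg; first exact: continuous_expR.
    by apply: cvgM => //; exact: cvg_cst.
  rewrite mulr0 expR0; apply: cvg_near_eq; near=> z.
  rewrite /powR gt_eqF//.
  have z0 : 0 < z by near: z; exact: nbhs_pinfty_gt.
  rewrite -(pmulr_lgt0 _ z0) mulrDl mul1r divfK ?gt_eqF//.
  by rewrite -ltrBlDr sub0r; near: z; exact: (nbhs_pinfty_gt (num_real _)).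
have : (F (z + m) / g (z + m)) * (g z / F z) * ((1 + m / z) `^ beta * expR (- m))
    @[z --> +oo] --> 1 * 1 * (1 * expR (- m)).
  by apply: cvgM; [exact: cvgM|apply: cvgM => //; exact: cvg_cst].
rewrite !mul1r; apply: cvg_near_eq; near=> z.
have z0 : 0 < z by near: z; exact: nbhs_pinfty_gt.
have zm0 : 0 < z + m by rewrite -ltrBlDr sub0r; near: z; exact: (nbhs_pinfty_gt (num_real _)).
have gE : g (z + m) = g z * ((1 + m / z) `^ beta * expR (- m)).
  rewrite /g -{1}[z + m](mulfVK (lt0r_neq0 z0)) [X in X `^ _](_ : _ = z * (1 + m / z)); last first.
    by field; exact: lt0r_neq0.
  rewrite powRM ?(ltW z0)//; last first.
    rewrite -(pmulr_lge0 _ z0) mulrDl mul1r divfK ?gt_eqF// ltW//.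
  by rewrite opprD expRD; ring.
have gz0 : g z != 0 by rewrite /g !mulf_neq0 ?gt_eqF ?powR_gt0 ?expR_gt0.
have gzm0 : g (z + m) != 0 by rewrite /g !mulf_neq0 ?gt_eqF ?powR_gt0 ?expR_gt0.
have cm0 : (1 + m / z) `^ beta * expR (- m) != 0.
  by apply: contra_neq gzm0; rewrite gE => ->; rewrite mulr0.
move: cm0; rewrite mulf_eq0 negb_or => /andP[c1 c2].
rewrite gE; field; rewrite c1 c2 gz0 /=.
by rewrite gt_eqF// gamma_tail_gt0.
Unshelve. all: by end_near. Qed.

End gamma_tail.

(** Convergence becomes an equality of two extended real functions together with finiteness, which
    is a measurable condition on a parameter. *)
Lemma cvgn_limn_esup (R : realType) (u : nat -> R) :
  cvgn u <-> let s := limn_esup (fun n => (u n)%:E) in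
    s = limn_einf (fun n => (u n)%:E) /\ s \is a fin_num.
Proof.
move=> /=; set v := fun n => (u n)%:E; split.
  move=> /cvg_ex[l ul].
  have vl : v n @[n --> \oo] --> l%:E by apply: cvg_EFin => //; exact: nearW.
  by have [-> ->] := cvg_limn_einf_sup vl.
move=> [se sfin]; have [l lE] : exists l, limn_esup v = l%:E.
  by exists (fine (limn_esup v)); rewrite fineK.
have vl : v n @[n --> \oo] --> l%:E.
  apply: (@squeeze_cvge _ _ _ _ (einfs v) _ (esups v)).
  - apply: nearW => n; apply/andP; split.
      by apply: ereal_inf_lbound; exists n => /=.
    by apply: ereal_sup_ubound; exists n => /=.
  - rewrite -lE se limn_einf_lim; exact: is_cvg_einfs.
  - rewrite -lE limn_esup_lim; exact: is_cvg_esups.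
apply/cvg_ex; exists l; move/fine_cvgP: vl => [_].
by apply: cvg_trans; apply: near_eq_cvg; exact: nearW.
Qed.

(** No convergence is assumed: where the sequence diverges, [limn] is the constant [point]. Thus the
    limit is measurable everywhere, also for the sigma-algebra generated by [others], where changing
    it on a null set would not be harmless. *)
Lemma measurable_limn d (T : measurableType d) (R : realType) (f : nat -> T -> R) :
  (forall n, measurable_fun setT (f n)) ->
  measurable_fun setT (fun w => limn (fun n => f n w)).
Proof.
move=> mf.
pose s w := limn_esup (fun n => (f n w)%:E).
pose i w := limn_einf (fun n => (f n w)%:E).
have mE n : measurable_fun setT (fun w => (f n w)%:E) by exact/measurable_EFinP.
have ms : measurable_fun setT s by exact: measurable_fun_limn_esup.
have mi : measurable_fun setT i.
  rewrite (_ : i = fun w => - limn_esup (fun n => - (f n w)%:E))%E; last first.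
    by apply/funext => w; rewrite (limn_esupN (fun n => (f n w)%:E)) oppeK.
  apply: measurableT_comp => //; apply: measurable_fun_limn_esup => n.
  exact: measurableT_comp.
pose b w := (s w == i w) && (s w \is a fin_num).
have mb : measurable_fun setT b.
  apply: measurable_and; first exact: measurable_fun_eqe.
  apply: (measurable_fun_bool true); exact: emeasurable_fin_num.
rewrite (_ : (fun w => _) = fun w => if b w then fine (s w) else point); last first.
  apply/funext => w; rewrite /b; case: ifPn => [/andP[/eqP si sf]|nb].
    have /cvg_ex[l fl] : cvgn (fun n => f n w) by apply/cvgn_limn_esup.
    have fl' : (f n w)%:E @[n --> \oo] --> l%:E by apply: cvg_EFin => //; exact: nearW.
    by rewrite (cvg_lim _ fl)// /s (cvg_limn_einf_sup fl').2.
  apply: dvgP => /cvgn_limn_esup[/= si sf]; move/negP: nb; apply.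
  by rewrite sf andbT; apply/eqP.
apply: measurable_fun_ifT => //.
exact: (measurableT_comp (fine_measurable measurableT)).
Qed.

Lemma expR_mul_le (R : realType) (t x : R) : 0 <= t <= 1 ->
  expR (t * x) <= 1 + t * expR x.
Proof.
move=> t01; have /andP[t0 t1] := t01.
have := @convex_expR R (Itv01 t0 t1) x 0.
rewrite !convRE /= mulr0 addr0 expR0 mulr1.
by move=> /le_trans; apply; rewrite addrC lerD2r /unstable.onem gerBl.
Qed.

Section exp_moment.
Context d (T : measurableType d) (R : realType) (P : probability T R).
Variable X : {RV P >-> R}.
Let F z := fine (P [set w | z < X w]).
Hypothesis F_gt0 : forall z, 0 < F z.
Hypothesis F_shift : forall m : R, F (z + m) / F z @[z --> +oo] --> expR (- m).

Lemma measurable_gt_set (Y : {RV P >-> R}) (z : R) : measurable [set w | z < Y w].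
Proof.
rewrite (_ : [set w | z < Y w] = Y @^-1` `]z, +oo[); first exact: measurable_funPTI.
by apply/seteqP; split => w /=; rewrite in_itv /= andbT.
Qed.

Lemma tail_anti x y : x <= y -> F y <= F x.
Proof.
move=> xy; apply: fine_le; rewrite ?fin_num_measure//; try exact: measurable_gt_set.
apply: le_measure; rewrite ?inE; try exact: measurable_gt_set.
by move=> w /=; exact: le_lt_trans.
Qed.

Lemma tail_le1 x : F x <= 1.
Proof.
rewrite -lee_fin fineK ?fin_num_measure//; last exact: measurable_gt_set.
by apply: probability_le1; exact: measurable_gt_set.
Qed.

(** The range is cut at the points [z0 + n]. Where [z0 + n < X <= z0 + n + 1] the integrand is at
    most [expR (s * (z0 + n + 1))], and this has probability at most [expR (- (1 - e) * n)]; since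
    [s < 1 - e], the resulting series is geometric. *)
Lemma exp_moment_lty (s : R) : 0 <= s < 1 ->
  (\int[P]_w (expR (s * X w))%:E < +oo)%E.
Proof.
move=> /andP[s0 s1].
have [e e01 es] : exists2 e : R, 0 < e < 1 & s < 1 - e.
  by exists ((1 - s) / 2) => //; lra.
have [z0 z00 up] := tail_upper F_gt0 tail_le1 (@F_shift) e01.
pose g n w := (expR (s * (z0 + n.+1%:R)) * \1_[set w | z0 + n%:R < X w] w)%:E : \bar R.
have mind n : measurable_fun setT (fun w => \1_[set w | z0 + n%:R < X w] w : R).
  by apply: measurable_indic; exact: measurable_gt_set.
have mg n : measurable_fun setT (g n).
  by apply/measurable_EFinP; apply: measurable_funM => //; exact: mind.
have g0 n w : (0 <= g n w)%E by rewrite lee_fin mulr_ge0 ?expR_ge0.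
have meX : measurable_fun setT (fun w => (expR (s * X w))%:E).
  apply/measurable_EFinP; apply: measurableT_comp => //.
  by apply: measurable_funM => //; exact: measurable_funP.
have mser : measurable_fun setT (fun w => (\sum_(0 <= n <oo) g n w)%E).
  exact: ge0_emeasurable_sum.
apply: (@le_lt_trans _ _ (\int[P]_w ((expR (s * z0))%:E + \sum_(0 <= n <oo) g n w))%E).
  apply: ge0_le_integral => //.
    by apply: emeasurable_funD => //; exact: measurable_cst.
  move=> w _.
  have ex : exists n : nat, X w <= z0 + n%:R.
    have := archi_boundP (normr_ge0 (X w - z0)); set n := Num.bound _ => h.
    by exists n; have := ler_norm (X w - z0); lra.
  case: (ex_minnP ex) => -[|n] Xn nmin.
    rewrite addr0 in Xn; rewrite (@le_trans _ _ (expR (s * z0))%:E)//.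
      by rewrite lee_fin ler_expR ler_wpM2l.
    by rewrite leeDl// nneseries_ge0.
  have nX : z0 + n%:R < X w.
    by rewrite ltNge; apply/negP => /nmin; rewrite ltnn.
  rewrite (@le_trans _ _ (g n w))//.
    by rewrite /g indicE mem_set// mulr1 lee_fin ler_expR ler_wpM2l.
  rewrite (@le_trans _ _ (\sum_(0 <= n <oo) g n w)%E) ?leeDr ?lee_fin ?expR_ge0//.
  rewrite (nneseriesD1 (fun k _ => g0 k w) (n := n))// leeDl//.
  by apply: nneseries_ge0.
rewrite ge0_integralD//; last by move=> w _; exact: nneseries_ge0.
rewrite integral_cst//= probability_setT mule1 integral_nneseries//.
rewrite lte_add_pinfty ?ltry//.
pose q := expR (- (1 - e - s)).
have q1 : q < 1 by rewrite /q -[ltRHS]expR0 ltr_expR; lra.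
have q0 : 0 < q by exact: expR_gt0.
apply: (@le_lt_trans _ _ (\sum_(0 <= n <oo) (geometric (expR (s * (z0 + 1))) q n)%:E)%E).
  apply: lee_nneseries => [n *|n * /=]; first by apply: integral_ge0 => w _; exact: g0.
  rewrite (eq_integral (fun w => (expR (s * (z0 + n.+1%:R)))%:E *
     (\1_[set w | (z0 + n%:R < X w)%R] w)%:E)%E) //.
  rewrite ge0_integralZl//; last first.
  - by apply/measurable_EFinP; exact: mind.
  have mS := measurable_gt_set X (z0 + n%:R).
  rewrite integral_indic// setIT.
  have PE : (F (z0 + n%:R))%:E = P [set w | z0 + n%:R < X w] by rewrite fineK ?fin_num_measure.
  rewrite [X in (_ * X <= _)%E](_ : _ = (F (z0 + n%:R))%:E); last by rewrite PE.
  rewrite -EFinM lee_fin.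
  apply: (@le_trans _ _ (expR (s * (z0 + n.+1%:R)) * expR (- (1 - e) * n%:R))).
    by rewrite ler_pM2l ?expR_gt0.
  rewrite /q -expRM_natr -!expRD ler_expR -natr1; lra.
by rewrite (nneseries_EFin (cvg_geometric_series _)) ?ltry// ger0_norm// ltW.
Qed.

End exp_moment.

(** * Exponentials of series of noise *)

(** Setting a coefficient to zero, rather than skipping its index, keeps the reduced product of the
    form [exp_series]. *)
Definition zero_at (R : realType) (r : nat) (c : nat -> R) (k : nat) : R :=
  if k == r then 0 else c k.

Lemma powR_expR (R : realType) (x p : R) : expR x `^ p = expR (p * x).
Proof. by rewrite /powR gt_eqF ?expR_gt0// expRK. Qed.

Lemma cvg_powR (R : realType) (g : nat -> R) (l p : R) :
  g n @[n --> \oo] --> l -> 0 < l -> g n `^ p @[n --> \oo] --> l `^ p.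
Proof.
move=> gl l0; have : expR (p * ln (g n)) @[n --> \oo] --> l `^ p.
  rewrite /powR gt_eqF//; apply: continuous_cvg; first exact: continuous_expR.
  apply: cvgM; first exact: cvg_cst.
  by apply: continuous_cvg => //; exact: continuous_ln.
apply: cvg_near_eq; near=> n; rewrite /powR gt_eqF//.
by near: n; exact: (cvgr_gt _ gl _ l0).
Unshelve. all: by end_near. Qed.

Section lognormal_series.
Context d (T : measurableType d) (R : realType) (P : probability T R).
Variables (eta eps : int -> {RV P >-> R}) (h : nat).
Hypothesis eta_indep : independent_family eta.
Hypothesis eta_ident : identically_distributed eta.
Hypothesis eta_eps : independent_of eta eps.
Let F z := fine (P [set w | z < eta 0 w]).
Hypothesis F_gt0 : forall z, 0 < F z.
Hypothesis F_shift : forall m : R, F (z + m) / F z @[z --> +oo] --> expR (- m).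

Definition noise (k : nat) : {RV P >-> R} := eta (h%:Z - k%:Z).

Definition exp_prod (c : nat -> R) (n : nat) (w : T) : R :=
  \prod_(k < n) expR (c k * noise k w).

Definition exp_series (c : nat -> R) (w : T) : R :=
  limn (fun n => exp_prod c n w).

Definition convergent_noise (c : nat -> R) : Prop :=
  {ae P, forall w, exists S : R, \sum_(k < n) c k * noise k w @[n --> \oo] --> S}.

(** Measurability is asked for every [t], so that such a factor can accompany the remaining product
    whichever noise variable is split off. Functions of [eps] and constants qualify. *)
Definition eps_measurable (Z : T -> R) : Prop :=
  forall t, measurable_fun [set: g_sigma_algebraType (others eta eps t)] Z.

Lemma eps_measurableT Z : eps_measurable Z -> measurable_fun setT Z.
Proof. by move=> /(_ 0); exact: others_measurable_fun. Qed.

Lemma exp_prod_sum c n w : exp_prod c n w = expR (\sum_(k < n) c k * noise k w).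
Proof. by rewrite expR_sum. Qed.

Lemma exp_prod_gt0 c n w : 0 < exp_prod c n w.
Proof. by rewrite exp_prod_sum expR_gt0. Qed.

Lemma exp_series_ae c : convergent_noise c ->
  {ae P, forall w, exp_prod c n w @[n --> \oo] --> exp_series c w /\ 0 < exp_series c w}.
Proof.
apply: filterS => w [S cS].
have cE : exp_prod c n w @[n --> \oo] --> expR S.
  rewrite (_ : (fun n => _) = expR \o (fun n => \sum_(k < n) c k * noise k w)); last first.
    by apply/funext => n; rewrite exp_prod_sum.
  exact: (continuous_cvg _ (@continuous_expR R S) cS).
have -> : exp_series c w = expR S by exact/cvg_lim.
by split => //; exact: expR_gt0.
Qed.

Lemma noise_others r k : k != r ->
  measurable_fun [set: g_sigma_algebraType (others eta eps (h%:Z - r%:Z))]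
    (noise k : T -> R).
Proof.
move=> kr; apply: eta_others; apply: contra_neq kr => /(addrI h%:Z)/oppr_inj [].
by [].
Qed.

Lemma exp_prod_others r c n : (forall k, (k < n)%N -> k = r -> c k = 0) ->
  measurable_fun [set: g_sigma_algebraType (others eta eps (h%:Z - r%:Z))] (exp_prod c n).
Proof.
move=> cr; apply: measurable_prod => /= k _.
have [kr|kr] := eqVneq (k : nat) r.
  rewrite cr// (_ : (fun w => _) = cst 1); first exact: measurable_cst.
  by apply/funext => w; rewrite mul0r expR0.
apply: measurableT_comp => //; apply: measurable_funM => //.
exact: noise_others.
Qed.

Lemma exp_series_others r c : c r = 0 ->
  measurable_fun [set: g_sigma_algebraType (others eta eps (h%:Z - r%:Z))] (exp_series c).
Proof.
by move=> cr; apply: measurable_limn => n; apply: exp_prod_others => k _ ->.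
Qed.

Lemma exp_prod_measurable c n : measurable_fun setT (exp_prod c n).
Proof.
apply: measurable_prod => k _; apply: measurableT_comp => //.
by apply: measurable_funM => //; exact: measurable_funP.
Qed.

Lemma exp_series_measurable c : measurable_fun setT (exp_series c).
Proof. by apply: measurable_limn => n; exact: exp_prod_measurable. Qed.

Lemma integral_eta (t : int) (f : R -> \bar R) :
  measurable_fun setT f -> (forall x, (0 <= f x)%E) ->
  (\int[P]_w f (eta t w) = \int[P]_w f (eta 0 w))%E.
Proof.
move=> mf f0.
rewrite -[LHS](ge0_integral_distribution (eta t) mf f0).
rewrite -[RHS](ge0_integral_distribution (eta 0) mf f0).
by apply: eq_measure_integral => A mA _; exact: eta_ident.
Qed.

Lemma tail_noise k z : fine (P [set w | z < noise k w]) = F z.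
Proof.
congr fine; have mI : measurable (`]z, +oo[%classic : set R) by exact: measurable_itv.
have E (X : {RV P >-> R}) : P [set w | z < X w] = distribution P X `]z, +oo[%classic.
  congr (P _); apply/seteqP; split => w /=; by rewrite in_itv /= andbT.
by rewrite !E; exact: eta_ident.
Qed.

Definition mgf (s : R) : R := fine (\int[P]_w (expR (s * eta 0 w))%:E).

Lemma mgfE s k : 0 <= s < 1 -> (\int[P]_w (expR (s * noise k w))%:E = (mgf s)%:E)%E.
Proof.
move=> s01.
have mf : measurable_fun setT (fun x : R => (expR (s * x))%:E).
  by apply/measurable_EFinP; apply: measurableT_comp => //; exact: mulrl_measurable.
rewrite (integral_eta (h%:Z - k%:Z) mf); last by move=> x; rewrite lee_fin expR_ge0.
rewrite /mgf fineK// ge0_fin_numE; last by apply: integral_ge0 => w _; rewrite lee_fin expR_ge0.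
exact: exp_moment_lty.
Qed.

Lemma mgf_ge0 s : 0 <= mgf s.
Proof. by apply/fine_ge0/integral_ge0 => w _; rewrite lee_fin expR_ge0. Qed.

(** By convexity [expR (s * x) <= 1 + s / rho * expR (rho * x)], so the moment is at most 1 plus a
    multiple of [s]. The linear dependence on [s] bounds products of moments over summable
    coefficients. *)
Lemma mgf_le (rho s : R) : 0 < rho < 1 -> 0 <= s <= rho ->
  mgf s <= expR (mgf rho / rho * s).
Proof.
move=> /andP[r0 r1] /andP[s0 sr].
have s01 : 0 <= s < 1 by rewrite s0 (le_lt_trans sr).
have r01 : 0 <= rho < 1 by rewrite (ltW r0).
apply: (@le_trans _ _ (1 + mgf rho / rho * s)); last exact: expR_ge1Dx.
have mE (t : R) : measurable_fun setT (fun w => (expR (t * noise 0 w))%:E).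
  apply/measurable_EFinP; apply: measurableT_comp => //.
  by apply: measurable_funM => //; exact: measurable_funP.
rewrite -lee_fin -(mgfE 0 s01).
have -> : (1 + mgf rho / rho * s)%:E =
    (\int[P]_w (1 + (s / rho)%:E * (expR (rho * noise 0 w))%:E))%E.
  rewrite ge0_integralD//; last 2 first.
  - by move=> w _; rewrite -EFinM lee_fin mulr_ge0 ?expR_ge0// divr_ge0// ltW.
  - apply/measurable_EFinP; apply: measurable_funM => //.
    exact/measurable_EFinP/mE.
  rewrite integral_cst//= probability_setT mule1 ge0_integralZl//; last first.
    by rewrite lee_fin divr_ge0// ltW.
  by rewrite mgfE// -EFinM -EFinD; congr (_ + _)%:E; field; rewrite gt_eqF.
apply: ge0_le_integral => //.
  apply/measurable_EFinP; apply: measurable_funD => //; apply: measurable_funM => //.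
  exact/measurable_EFinP/mE.
move=> w _; rewrite -EFinM -EFinD lee_fin.
rewrite [X in expR X](_ : _ = (s / rho) * (rho * noise 0 w)); last by field; rewrite gt_eqF.
by apply: expR_mul_le; rewrite divr_ge0 ?(ltW r0)//= ler_pdivrMr// mul1r.
Qed.

(** The noise variables are integrated out one at a time, the last one being independent of [Z] and
    of all earlier ones. *)
Lemma exp_prod_moment (rho : R) (c : nat -> R) (Z : T -> R) n :
  0 < rho < 1 -> (forall k, 0 <= c k <= rho) -> eps_measurable Z ->
  (forall w, 0 <= Z w) ->
  (\int[P]_w (Z w * exp_prod c n w)%:E <=
   (\int[P]_w (Z w)%:E) * (expR (mgf rho / rho * \sum_(k < n) c k))%:E)%E.
Proof.
move=> rho01 c0 mZ Z0; elim: n => [|n IH].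
  rewrite big_ord0 mulr0 expR0 mule1 le_eqVlt; apply/orP; left; apply/eqP.
  by apply: eq_integral => w _; rewrite /exp_prod big_ord0 mulr1.
have /andP[r0 r1] := rho01.
have cn1 : 0 <= c n < 1.
  by have /andP[-> /= /le_lt_trans] := c0 n; apply.
pose V w := Z w * exp_prod c n w.
have V0 w : 0 <= V w by rewrite mulr_ge0// ltW// exp_prod_gt0.
have mV : measurable_fun [set: g_sigma_algebraType (others eta eps (h%:Z - n%:Z))] V.
  apply: measurable_funM; first exact: mZ.
  by apply: exp_prod_others => k + kn; rewrite kn ltnn.
have E : (\int[P]_w (Z w * exp_prod c n.+1 w)%:E =
    (\int[P]_w (expR (c n * noise n w))%:E) * \int[P]_w (V w)%:E)%E.
  (* The absolute value makes the function applied to [V] nonnegative on the whole line, as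
     [integral_independent_mul] asks; on the values of [V] it changes nothing. *)
  transitivity (\int[P]_w (expR (c n * noise n w) * `|V w|)%:E)%E.
    apply: eq_integral => w _; rewrite ger0_norm// /V /exp_prod big_ord_recr /=.
    by congr EFin; ring.
  rewrite (@integral_independent_mul _ _ _ P _ _ _ _ (noise n) V
    (fun x => expR (c n * x)) (fun v => `|v|))//.
  - by congr (_ * _)%E; apply: eq_integral => w _; rewrite ger0_norm.
  - exact: others_measurable_fun mV.
  - by apply: measurableT_comp => //; exact: mulrl_measurable.
  - move=> A B mA mB; exact: (eta_indep_others eta_indep eta_eps mV mA mB).
rewrite E mgfE// big_ord_recr /= mulrDr expRD EFinM muleA muleC.
apply: lee_pmul => //.
- by apply: integral_ge0 => w _; rewrite lee_fin.
- by rewrite lee_fin mgf_ge0.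
by rewrite lee_fin mgf_le.
Qed.

(** The two powers merge into one product with coefficients [q * c k + q' * c' k], which must stay
    below some [rho < 1] for moments to exist. The bounds on partial products are uniform in [n] and
    pass to the limit by Fatou's lemma. *)
Lemma exp_series_moment (rho S q q' : R) (c c' : nat -> R) (e e' : T -> R) :
  0 < rho < 1 -> 0 <= q -> 0 <= q' -> (forall k, 0 <= c k) -> (forall k, 0 <= c' k) ->
  (forall k, q * c k + q' * c' k <= rho) ->
  (forall n, \sum_(k < n) (q * c k + q' * c' k) <= S) ->
  eps_measurable e -> eps_measurable e' ->
  (forall w, 0 <= e w) -> (forall w, 0 <= e' w) ->
  (\int[P]_w (e w `^ q * e' w `^ q')%:E < +oo)%E ->
  convergent_noise c -> convergent_noise c' ->
  (\int[P]_w ((e w * exp_series c w) `^ q * (e' w * exp_series c' w) `^ q')%:E < +oo)%E.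
Proof.
move=> rho01 q0 q0' c0 c0' crho cS me me' e0 e0' eoo cc cc'.
pose Z w := e w `^ q * e' w `^ q'.
pose b k := q * c k + q' * c' k.
pose f n w := (Z w * exp_prod b n w)%:E.
have mpow p (g : T -> R) : measurable_fun setT g -> measurable_fun setT (fun w => g w `^ p).
  by move=> mg; exact: (measurableT_comp (measurable_powR p)).
have mZ : eps_measurable Z.
  by move=> t; apply: measurable_funM; exact: (measurableT_comp (measurable_powR _)).
have Z0 w : 0 <= Z w by rewrite mulr_ge0 ?powR_ge0.
have mf n : measurable_fun setT (f n).
  apply/measurable_EFinP; apply: measurable_funM; first exact: eps_measurableT.
  exact: exp_prod_measurable.
have f0 n w : (0 <= f n w)%E by rewrite lee_fin mulr_ge0// ltW// exp_prod_gt0.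
have mlim : measurable_fun setT (fun w => limn_einf (f ^~ w)).
  rewrite (_ : (fun w => _) = fun w => - limn_esup (fun n => - f n w))%E; last first.
    by apply/funext => w; rewrite (limn_esupN (fun n => f n w)) oppeK.
  apply: measurableT_comp => //; apply: measurable_fun_limn_esup => n.
  exact: measurableT_comp.
have einf0 w : (0 <= limn_einf (f ^~ w))%E.
  rewrite limn_einf_lim; apply: lime_ge; first exact: is_cvg_einfs.
  by apply: nearW => n; apply: le_ereal_inf_tmp => _ [k _ <-].
have mtarget : measurable_fun setT
    (fun w => ((e w * exp_series c w) `^ q * (e' w * exp_series c' w) `^ q')%:E).
  apply/measurable_EFinP; apply: measurable_funM; apply: mpow; apply: measurable_funM.
  - exact: eps_measurableT.
  - exact: exp_series_measurable.
  - exact: eps_measurableT.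
  - exact: exp_series_measurable.
rewrite (@ge0_ae_eq_integral _ _ _ P setT _ (fun w => limn_einf (f ^~ w)))//; last 2 first.
- by move=> w _; rewrite lee_fin mulr_ge0// powR_ge0.
- have := exp_series_ae cc; have := exp_series_ae cc'; apply: filterS2 => w [cv' p'] [cv p] _.
  suff fl : f n w @[n --> \oo] --> ((e w * exp_series c w) `^ q * (e' w * exp_series c' w) `^ q')%:E.
    by have [-> _] := cvg_limn_einf_sup fl.
  apply: cvg_EFin; first exact: nearW.
  have -> : (e w * exp_series c w) `^ q * (e' w * exp_series c' w) `^ q' =
      Z w * (exp_series c w `^ q * exp_series c' w `^ q').
    by rewrite (powRM _ (e0 w) (ltW p)) (powRM _ (e0' w) (ltW p')) mulrACA.
  have : Z w * (exp_prod c n w `^ q * exp_prod c' n w `^ q') @[n --> \oo] -->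
      Z w * (exp_series c w `^ q * exp_series c' w `^ q').
    by apply: cvgM; [exact: cvg_cst|apply: cvgM; exact: cvg_powR].
  apply: cvg_near_eq.
  apply: nearW => n /=; rewrite /f /=; congr (_ * _).
  rewrite !exp_prod_sum !powR_expR -expRD; congr expR.
  rewrite !mulr_sumr -big_split /=; apply: eq_bigr => k _; rewrite /b; ring.
apply: (le_lt_trans (fatou P measurableT mf (fun n w _ => f0 n w))).
set M := ((\int[P]_w (Z w)%:E) * (expR (mgf rho / rho * S))%:E)%E.
apply: (@le_lt_trans _ _ M); last first.
  apply: lte_mul_pinfty; rewrite ?lee_fin ?expR_ge0 ?ltry//.
    by apply: integral_ge0 => w _; rewrite lee_fin.
  rewrite ge0_fin_numE//; apply: integral_ge0 => w _; rewrite lee_fin; exact: Z0.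
rewrite limn_einf_lim; apply: lime_le; first exact: is_cvg_einfs.
apply: nearW => n; apply: (@le_trans _ _ (\int[P]_w f n w)%E).
  by apply: ereal_inf_lbound; exists n => /=.
have b0 k : 0 <= b k <= rho by rewrite crho andbT addr_ge0// mulr_ge0.
apply: (le_trans (exp_prod_moment n rho01 b0 mZ Z0)).
apply: lee_pmul => //.
- by apply: integral_ge0 => w _; rewrite lee_fin.
have /andP[r0 _] := rho01.
by rewrite lee_fin ler_expR ler_wpM2l// divr_ge0 ?mgf_ge0// ltW.
Qed.

Lemma sum_zero_at (c : nat -> R) r n w : (r < n)%N ->
  \sum_(k < n) c k * noise k w =
  \sum_(k < n) zero_at r c k * noise k w + c r * noise r w.
Proof.
move=> rn; rewrite (bigD1 (Ordinal rn))//= [in RHS](bigD1 (Ordinal rn))//=.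
rewrite /zero_at eqxx mul0r add0r addrC; congr (_ + _).
apply: eq_bigr => k /negbTE; rewrite -val_eqE /= => kr.
by rewrite kr.
Qed.

Lemma convergent_zero_at r (c : nat -> R) :
  convergent_noise c -> convergent_noise (zero_at r c).
Proof.
apply: filterS => w [S cS]; exists (S - c r * noise r w).
have : \sum_(k < n) c k * noise k w - c r * noise r w @[n --> \oo] --> S - c r * noise r w.
  by apply: cvgB => //; exact: cvg_cst.
apply: cvg_near_eq; near=> n; rewrite (@sum_zero_at c r) ?addrK//.
by near: n; exact: nbhs_infty_gt.
Unshelve. all: by end_near. Qed.

Lemma exp_series_zero_at r (c : nat -> R) : convergent_noise c ->
  {ae P, forall w, exp_series c w = exp_series (zero_at r c) w * expR (c r * noise r w)}.
Proof.
move=> cc; have := exp_series_ae cc; have := exp_series_ae (convergent_zero_at r cc).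
apply: filterS2 => w [dS _] [cS _]; apply/(cvg_unique _ cS) => //.
have : exp_prod (zero_at r c) n w * expR (c r * noise r w) @[n --> \oo] -->
    exp_series (zero_at r c) w * expR (c r * noise r w).
  by apply: cvgM => //; exact: cvg_cst.
apply: cvg_near_eq; near=> n; rewrite !exp_prod_sum -expRD -sum_zero_at//.
by near: n; exact: nbhs_infty_gt.
Unshelve. all: by end_near. Qed.

End lognormal_series.

(** * Joint tails *)

(** Applied to the values of one noise variable that produce a joint exceedance, the rest being
    frozen. Openness from the left makes the ray open, so its probability is exactly a tail of that
    variable. *)
Lemma up_ray (R : realType) (A : set R) (Z : R) :
  (forall u v, A u -> u <= v -> A v) -> (forall u, A u -> exists2 v, v < u & A v) ->
  ~ A Z -> A = set0 \/ exists2 tau, Z <= tau & A = [set u | tau < u].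
Proof.
move=> up op nZ; have [->|/set0P[a Aa]] := eqVneq A set0; first by left.
right; have lbZ : lbound A Z.
  by move=> u Au; rewrite leNgt; apply/negP => /ltW uZ; exact/nZ/(up u).
have hA : has_inf A by split; [exists a|exists Z].
exists (inf A); first by apply: lb_le_inf => //; exists a.
apply/seteqP; split => u /=.
  by move=> /op[v vu Av]; rewrite (le_lt_trans _ vu)// ge_inf//; exact: hA.2.
by move=> /(inf_lt hA.1)[v Av /ltW]; exact: up.
Qed.

Lemma integral_indicT d (T : measurableType d) (R : realType)
    (mu : {measure set T -> \bar R}) (S : set T) : measurable S ->
  mu S = (\int[mu]_w (\1_S w)%:E)%E.
Proof. by move=> mS; rewrite integral_indic// setIT. Qed.

(** Markov's inequality for [V0 ^ q0 * V1 ^ q1], which is at least [(C * x) ^ (q0 + q1)] on the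
    event. *)
Lemma joint_chernoff d (T : measurableType d) (R : realType) (P : probability T R)
    (V0 V1 : T -> R) (q0 q1 C x : R) :
  measurable_fun setT V0 -> measurable_fun setT V1 -> 0 <= q0 -> 0 <= q1 -> 0 < C -> 0 < x ->
  (\int[P]_w (V0 w `^ q0 * V1 w `^ q1)%:E < +oo)%E ->
  fine (P [set w | C * x < V0 w /\ C * x < V1 w]) <=
  fine (\int[P]_w (V0 w `^ q0 * V1 w `^ q1)%:E) * (C * x) `^ (- (q0 + q1)).
Proof.
move=> mV0 mV1 q00 q10 C0 x0 fin; have Cx : 0 < C * x by rewrite mulr_gt0.
have mN : measurable [set w | C * x < V0 w /\ C * x < V1 w].
  rewrite (_ : [set w | _] = V0 @^-1` `]C * x, +oo[ `&` V1 @^-1` `]C * x, +oo[).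
    by apply: measurableI; rewrite -[X in measurable X]setTI; [exact: mV0|exact: mV1].
  by apply/seteqP; split => w /=; rewrite !in_itv /= !andbT.
have mint : measurable_fun setT (fun w => (V0 w `^ q0 * V1 w `^ q1)%:E : \bar R).
  by apply/measurable_EFinP; apply: measurable_funM; exact: (measurableT_comp (measurable_powR _)).
have I0 : (0 <= \int[P]_w (V0 w `^ q0 * V1 w `^ q1)%:E)%E.
  by apply: integral_ge0 => w _; rewrite lee_fin mulr_ge0 ?powR_ge0.
rewrite -lee_fin EFinM !fineK ?fin_num_measure ?ge0_fin_numE//.
rewrite (integral_indicT P mN) muleC -ge0_integralZl//; last 2 first.
- by move=> w _; rewrite lee_fin mulr_ge0 ?powR_ge0.
- by rewrite lee_fin powR_ge0.
apply: ge0_le_integral => //.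
- exact/measurable_EFinP/measurable_indic.
- by apply: emeasurable_funM.
move=> w _; rewrite -EFinM lee_fin indicE.
have [|_] := boolP (w \in [set w | C * x < V0 w /\ C * x < V1 w]); last first.
  by rewrite !mulr_ge0 ?powR_ge0.
rewrite inE /= => -[h0 h1].
rewrite powRN mulrC ler_pdivlMr ?powR_gt0// mul1r powRD ?(gt_eqF Cx) ?implybT//.
by rewrite ler_pM ?powR_ge0// ge0_ler_powR// ?nnegrE ?ltW// (lt_trans Cx).
Qed.

(** * Shifting a single noise variable in a joint tail *)

Section one_noise.
Context d (T : measurableType d) (R : realType) (P : probability T R).
Variables (U : {RV P >-> R}) (V0 V1 : T -> R).
Hypothesis mV0 : measurable_fun setT V0.
Hypothesis mV1 : measurable_fun setT V1.
Hypothesis UV : forall (A : set R) (B : set (R * R)), measurable A -> measurable B ->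
  P (U @^-1` A `&` (fun w => (V0 w, V1 w)) @^-1` B) =
  (P (U @^-1` A) * P ((fun w => (V0 w, V1 w)) @^-1` B))%E.
Let V w := (V0 w, V1 w).

Let mV : measurable_fun setT V.
Proof. exact: measurable_fun_pair. Qed.

Lemma prob_section (E : set (R * (R * R))) : measurable E ->
  P [set w | E (U w, V w)] = (\int[P]_w P [set w' | E (U w', V w)])%E.
Proof.
move=> mE; pose f (z : R * (R * R)) := (\1_E z)%:E : \bar R.
have mUV : measurable_fun setT (fun w => (U w, V w)).
  by apply: measurable_fun_pair => //; exact: measurable_funP.
transitivity (\int[P]_w f (U w, V w))%E.
  have mS : measurable [set w | E (U w, V w)] by rewrite -[X in measurable X]setTI; exact: mUV.
  by rewrite (integral_indicT P mS); apply: eq_integral => w _; rewrite /f !indicE.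
rewrite (integral_independent (measurable_funP U) mV _ _ UV); last 2 first.
- exact/measurable_EFinP/measurable_indic.
- by move=> z; rewrite lee_fin.
apply: eq_integral => w _.
have mU : measurable_fun setT (fun w' => (U w', V w)).
  by apply: measurable_fun_pair => //; exact: measurable_funP.
have mS : measurable [set w' | E (U w', V w)] by rewrite -[X in measurable X]setTI; exact: mU.
by rewrite (integral_indicT P mS); apply: eq_integral => w' _; rewrite /f !indicE.
Qed.

Lemma measurable_section (E : set (R * (R * R))) : measurable E ->
  measurable_fun setT (fun w => P [set w' | E (U w', V w)]).
Proof.
move=> mE; have := measurable_fun_ysection (distribution P U) mE.
move=> /measurableT_comp /(_ mV); apply: eq_measurable_fun => w _ /=.
rewrite /pushforward; congr (P _); apply/seteqP; split => w' /=; rewrite ?inE//.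
  by rewrite /ysection /= inE.
by rewrite /ysection /= inE.
Qed.

Definition exceed (b0 b1 s t x : R) : set (R * (R * R)) :=
  [set z | s * x < z.2.1 * expR (b0 * z.1) /\ t * x < z.2.2 * expR (b1 * z.1)].

Lemma measurable_exceed b0 b1 s t x : measurable (exceed b0 b1 s t x).
Proof.
have m1 : measurable_fun [set: R * (R * R)] (fun z : R * (R * R) => z.2.1 * expR (b0 * z.1)).
  apply: measurable_funM; first exact: (measurableT_comp measurable_fst measurable_snd).
  apply: measurableT_comp => //; apply: measurable_funM; [exact: measurable_cst|exact: measurable_fst].
have m2 : measurable_fun [set: R * (R * R)] (fun z : R * (R * R) => z.2.2 * expR (b1 * z.1)).
  apply: measurable_funM; first exact: (measurableT_comp measurable_snd measurable_snd).
  apply: measurableT_comp => //; apply: measurable_funM; [exact: measurable_cst|exact: measurable_fst].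
rewrite (_ : exceed _ _ _ _ _ =
  (fun z : R * (R * R) => z.2.1 * expR (b0 * z.1)) @^-1` `]s * x, +oo[ `&`
  (fun z : R * (R * R) => z.2.2 * expR (b1 * z.1)) @^-1` `]t * x, +oo[).
  by apply: measurableI; rewrite -[X in measurable X]setTI; [exact: m1|exact: m2].
by apply/seteqP; split => z /=; rewrite !in_itv /= !andbT.
Qed.

Definition joint_tail (b0 b1 s t x : R) : R := fine (P [set w |
  s * x < V0 w * expR (b0 * U w) /\ t * x < V1 w * expR (b1 * U w)]).

Lemma joint_tailE b0 b1 s t x :
  (joint_tail b0 b1 s t x)%:E = P [set w | exceed b0 b1 s t x (U w, V w)].
Proof.
rewrite fineK// fin_num_measure//; change (measurable ((fun w => (U w, V w)) @^-1` exceed b0 b1 s t x)).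
rewrite -[X in measurable X]setTI; apply: measurable_fun_pair => //.
exact: measurable_exceed.
Qed.

Variables b0 b1 : R.
Hypothesis (b0_ge0 : 0 <= b0) (b1_ge0 : 0 <= b1).
Let F z := fine (P [set w | z < U w]).
Hypothesis F_gt0 : forall z, 0 < F z.
Hypothesis F_shift : forall m : R, F (z + m) / F z @[z --> +oo] --> expR (- m).

Let PF z : P [set w | z < U w] = (F z)%:E.
Proof. by rewrite fineK// fin_num_measure//; exact: measurable_gt_set. Qed.

Lemma ray_shift (m e : R) : 0 < e -> exists Z : R, forall A : set R,
  (forall u v, A u -> u <= v -> A v) -> (forall u, A u -> exists2 v, v < u & A v) ->
  ~ A Z ->
  (P [set w | A (U w - m)%R] <= (expR (- m) + e)%:E * P [set w | A (U w)])%E /\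
  ((expR (- m))%:E * P [set w | A (U w)] <=
     P [set w | A (U w - m)%R] + e%:E * P [set w | A (U w)])%E.
Proof.
move=> e0; have [Z0 _ ZP] : exists2 Z0 : R, 0 < Z0 &
    forall z, Z0 <= z -> `|expR (- m) - F (z + m) / F z| < e.
  by apply: near_pinfty_exists; move/cvgrPdist_lt : (@F_shift m); exact.
exists Z0 => A up op nA; have [->|[tau Ztau ->]] := up_ray up op nA.
  have E1 : P [set w | set0 (U w - m)%R] = 0%E := measure0 P.
  have E2 : P [set w | set0 (U w)] = 0%E := measure0 P.
  by rewrite E1 ?E2 !mule0 adde0.
have -> : [set w | [set u | tau < u] (U w - m)] = [set w | tau + m < U w].
  by apply/seteqP; split => w /=; rewrite ltrBrDr.
rewrite /= !PF -!EFinM -EFinD !lee_fin.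
have := ZP _ Ztau; rewrite ltr_norml => /andP[lo hi].
split.
  by rewrite -ler_pdivrMr//; lra.
by rewrite -lerBlDr -mulrBl -ler_pdivlMr//; lra.
Qed.

(** With [V0] and [V1] frozen, the exceedance set of [U] either misses [Z], and [ray_shift] applies,
    or contains it, and then [V0] and [V1] alone already exceed a multiple of [x]. The second case
    is the error term. *)
Lemma joint_tail_shift_le (s t m e : R) : 0 < s -> 0 < t -> 0 < e ->
  exists2 C : R, 0 < C & forall x, 0 < x ->
  `|joint_tail b0 b1 (s * expR (b0 * m)) (t * expR (b1 * m)) x
    - expR (- m) * joint_tail b0 b1 s t x|
  <= e * joint_tail b0 b1 s t x
     + (1 + expR (- m)) * fine (P [set w | C * x < V0 w /\ C * x < V1 w]).
Proof.
move=> s0 t0 e0; have [Z ZP] := ray_shift m e0.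
(* At noise value [Z] the event asks for [V0] and [V1] above [s * expR (- (b0 * Z)) * x] and
   [t * expR (- (b1 * Z)) * x]; [C] is the smaller constant. *)
pose C := Num.min (s * expR (- (b0 * Z))) (t * expR (- (b1 * Z))).
have C0 : 0 < C by rewrite lt_min !mulr_gt0 ?expR_gt0.
exists C => // x x0.
pose A v := [set u | exceed b0 b1 s t x (u, v)].
have up v : forall u u', A v u -> u <= u' -> A v u'.
  have mono a b u u' : 0 < a -> 0 <= b -> u <= u' -> forall y, a < y * expR (b * u) ->
      a < y * expR (b * u').
    move=> a0 bb uu' y ay; apply: (lt_le_trans ay); rewrite ler_wpM2l//.
      by rewrite ltW// -(pmulr_lgt0 _ (expR_gt0 (b * u))) (lt_trans a0).
    by rewrite ler_expR ler_wpM2l.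
  move=> u u' [/= h1 h2] uu'; split => /=.
    by apply: mono uu' _ h1 => //; rewrite mulr_gt0.
  by apply: mono uu' _ h2 => //; rewrite mulr_gt0.
have op v : forall u, A v u -> exists2 u', u' < u & A v u'.
  move=> u [/= h1 h2].
  have near1 a b y : a < y * expR (b * u) -> \forall u' \near u^'-, a < y * expR (b * u').
    move=> ay; have : y * expR (b * u') @[u' --> u^'-] --> y * expR (b * u).
      apply: cvgM; first exact: cvg_cst.
      apply: continuous_cvg; first exact: continuous_expR.
      apply: cvgM; first exact: cvg_cst.
      by apply: cvg_at_left_filter; exact: cvg_id.
    by move=> /cvgr_gt; apply.
  near u^'- => u'; exists u'; first by near: u'; exact: nbhs_left_lt.
  by split => /=; near: u'; exact: near1.
have jm : (joint_tail b0 b1 (s * expR (b0 * m)) (t * expR (b1 * m)) x)%:E =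
    (\int[P]_w P [set w' | A (V w) (U w' - m)%R])%E.
  rewrite joint_tailE (prob_section (measurable_exceed b0 b1 (s * expR (b0 * m)) (t * expR (b1 * m)) x)).
  apply: eq_integral => w _; congr (P _).
  have key b a y u : (a * expR (b * m) * x < y * expR (b * u)) = (a * x < y * expR (b * (u - m))).
    by rewrite mulrBr expRD expRN mulrA ltr_pdivlMr ?expR_gt0// mulrAC.
  by apply/seteqP; split => w' /=; rewrite /exceed /= !key.
have j0 : (joint_tail b0 b1 s t x)%:E = (\int[P]_w P [set w' | A (V w) (U w')])%E.
  by rewrite joint_tailE; exact: (prob_section (measurable_exceed b0 b1 s t x)).
have mG : measurable_fun setT (fun w => P [set w' | A (V w) (U w')]).
  exact: (measurable_section (measurable_exceed b0 b1 s t x)).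
have mGm : measurable_fun setT (fun w => P [set w' | A (V w) (U w' - m)%R]).
  have := measurable_section (measurable_exceed b0 b1 (s * expR (b0 * m)) (t * expR (b1 * m)) x).
  apply: eq_measurable_fun => w _; congr (P _).
  have key b a y u : (a * expR (b * m) * x < y * expR (b * u)) = (a * x < y * expR (b * (u - m))).
    by rewrite mulrBr expRD expRN mulrA ltr_pdivlMr ?expR_gt0// mulrAC.
  by apply/seteqP; split => w' /=; rewrite /exceed /= !key.
pose B := [set w | A (V w) Z].
have mB : measurable B.
  change (measurable ((fun w => (Z, V w)) @^-1` exceed b0 b1 s t x)).
  rewrite -[X in measurable X]setTI.
  by apply: measurable_fun_pair => //; exact: measurable_exceed.
set N := fine (P [set w | C * x < V0 w /\ C * x < V1 w]).
have BN : (P B <= N%:E)%E.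
  have mN : measurable [set w | C * x < V0 w /\ C * x < V1 w].
    rewrite (_ : [set w | _] = V0 @^-1` `]C * x, +oo[ `&` V1 @^-1` `]C * x, +oo[).
      by apply: measurableI; rewrite -[X in measurable X]setTI; [exact: mV0|exact: mV1].
    by apply/seteqP; split => w /=; rewrite !in_itv /= !andbT.
  rewrite /N fineK ?fin_num_measure//; apply: le_measure; rewrite ?inE// => w [/= h1 h2].
  have key b a y : a * x < y * expR (b * Z) -> a * expR (- (b * Z)) * x < y.
    by rewrite expRN mulrAC ltr_pdivrMr ?expR_gt0.
  split; (apply: le_lt_trans; last first); [exact: key h1| |exact: key h2|].
    by rewrite ler_pM2r// ge_min lexx.
  by rewrite ler_pM2r// ge_min lexx orbT.
have PS S : (0 <= P S)%E by exact: measure_ge0.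
have m1B : measurable_fun setT (fun w => (\1_B w)%:E : \bar R).
  exact/measurable_EFinP/measurable_indic.
(* Two upper bounds without subtraction, so that they can be integrated in the extended reals. On
   [B] all probabilities are merely bounded by 1. *)
have step w : (P [set w' | A (V w) (U w' - m)%R] <=
      (expR (- m) + e)%:E * P [set w' | A (V w) (U w')] + (\1_B w)%:E)%E /\
    ((expR (- m))%:E * P [set w' | A (V w) (U w')] <=
      P [set w' | A (V w) (U w' - m)%R] + e%:E * P [set w' | A (V w) (U w')]
      + (expR (- m))%:E * (\1_B w)%:E)%E.
  have [wB|wB] := pselect (B w); last first.
    by have := ZP _ (@up (V w)) (@op (V w)) wB; rewrite indicE memNset// mule0 !adde0.
  have PA (f : T -> R) : measurable_fun setT f -> (P [set w' | A (V w) (f w')] <= 1)%E.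
    move=> mf; apply: probability_le1.
    change (measurable ((fun w' => (f w', V w)) @^-1` exceed b0 b1 s t x)).
    rewrite -[X in measurable X]setTI.
    by apply: measurable_fun_pair => //; exact: measurable_exceed.
  rewrite indicE mem_set// mule1; split.
    apply: (le_trans (PA (fun w' => U w' - m) _)).
      by apply: measurable_funB => //; exact: measurable_funP.
    by rewrite leeDr// mule_ge0// lee_fin addr_ge0 ?expR_ge0// ltW.
  apply: (@le_trans _ _ (expR (- m))%:E).
    by rewrite -[leRHS]mule1 lee_wpmul2l ?lee_fin ?expR_ge0//; exact: PA.
  by rewrite leeDr// adde_ge0// mule_ge0// lee_fin ltW.
have E0 : 0 <= expR (- m) := expR_ge0 _.
have hi : ((joint_tail b0 b1 (s * expR (b0 * m)) (t * expR (b1 * m)) x)%:E <=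
    (expR (- m) + e)%:E * (joint_tail b0 b1 s t x)%:E + N%:E)%E.
  rewrite jm j0; apply: (@le_trans _ _ (\int[P]_w ((expR (- m) + e)%:E *
      P [set w' | A (V w) (U w')] + (\1_B w)%:E))%E).
    apply: ge0_le_integral => //.
    - by apply: emeasurable_funD => //; apply: emeasurable_funM.
    - by move=> w _; exact: (step w).1.
  rewrite ge0_integralD//; last 2 first.
  - by move=> w _; rewrite mule_ge0// lee_fin addr_ge0// ltW.
  - by apply: emeasurable_funM.
  rewrite ge0_integralZl//; last by rewrite lee_fin addr_ge0// ltW.
  by apply: leeD2l; rewrite -integral_indicT.
have lo : ((expR (- m))%:E * (joint_tail b0 b1 s t x)%:E <=
    (joint_tail b0 b1 (s * expR (b0 * m)) (t * expR (b1 * m)) x)%:E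
    + e%:E * (joint_tail b0 b1 s t x)%:E + (expR (- m))%:E * N%:E)%E.
  have e0' : (0 <= e%:E)%E by rewrite lee_fin ltW.
  rewrite jm j0 -ge0_integralZl//.
  apply: (@le_trans _ _ (\int[P]_w (P [set w' | A (V w) (U w' - m)%R] +
      e%:E * P [set w' | A (V w) (U w')] + (expR (- m))%:E * (\1_B w)%:E))%E).
    apply: ge0_le_integral => //.
    - by move=> w _; rewrite mule_ge0.
    - by apply: emeasurable_funM.
    - by apply: emeasurable_funD; [apply: emeasurable_funD => //|]; apply: emeasurable_funM.
    - by move=> w _; exact: (step w).2.
  rewrite ge0_integralD//; last 3 first.
  - by move=> w _; rewrite adde_ge0// mule_ge0.
  - by apply: emeasurable_funD => //; apply: emeasurable_funM.
  - by apply: emeasurable_funM.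
  rewrite ge0_integralD//; last 2 first.
  - by move=> w _; rewrite mule_ge0.
  - by apply: emeasurable_funM.
  rewrite !ge0_integralZl//.
  by apply: leeD2l; rewrite -integral_indicT// lee_wpmul2l// lee_fin.
have N0 : 0 <= N by exact: fine_ge0.
move: hi lo; rewrite -!EFinM -!EFinD !lee_fin => hi lo.
rewrite ler_norml; apply/andP; split; nra.
Unshelve. all: by end_near. Qed.

Lemma joint_tail_shift (s t m : R) : 0 < s -> 0 < t ->
  (forall C, 0 < C -> fine (P [set w | C * x < V0 w /\ C * x < V1 w])
    / joint_tail b0 b1 s t x @[x --> +oo] --> 0) ->
  (\forall x \near +oo, 0 < joint_tail b0 b1 s t x) ->
  joint_tail b0 b1 (s * expR (b0 * m)) (t * expR (b1 * m)) x
    / joint_tail b0 b1 s t x @[x --> +oo] --> expR (- m).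
Proof.
move=> s0 t0 negl pos; apply/cvgrPdist_le => e e0.
have [C C0 CP] := joint_tail_shift_le m s0 t0 (divr_gt0 e0 (ltr0n _ 2)).
have E0 : 0 < 1 + expR (- m) by rewrite addr_gt0 ?expR_gt0.
have e20 : 0 < e / 2 / (1 + expR (- m)) by rewrite !divr_gt0.
near=> x.
have x0 : 0 < x by near: x; exact: nbhs_pinfty_gt.
have J0 : 0 < joint_tail b0 b1 s t x by near: x.
have small : fine (P [set w | C * x < V0 w /\ C * x < V1 w]) / joint_tail b0 b1 s t x
    < e / 2 / (1 + expR (- m)).
  by near: x; exact: (cvgr_lt _ (@negl _ C0) _ e20).
rewrite distrC -(ler_pM2r J0) -[X in _ * X](gtr0_norm J0) -normrM mulrBl divfK ?gt_eqF//.
move: small; rewrite ltr_pdivlMr// mulrAC ltr_pdivrMr// => small.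
by apply: (le_trans (CP x x0)); lra.
Unshelve. all: by end_near. Qed.

End one_noise.

(** * Breiman's lemma *)

Lemma cvgr_lny (R : realType) : ln x @[x --> +oo] --> (+oo : set_system R).
Proof.
apply/cvgryPge => A; near=> x.
have h : expR A <= x by near: x; exact: (nbhs_pinfty_ge (num_real _)).
by rewrite -ler_expR lnK// posrE (lt_le_trans (expR_gt0 _) h).
Unshelve. all: by end_near. Qed.

Section breiman.
Context d (T : measurableType d) (R : realType) (P : probability T R).
Variables (U : {RV P >-> R}) (W : T -> R) (a e : R).
Hypothesis mW : measurable_fun setT W.
Hypothesis W_ge0 : forall w, 0 <= W w.
Hypothesis UW : forall (A B : set R), measurable A -> measurable B ->
  P (U @^-1` A `&` W @^-1` B) = (P (U @^-1` A) * P (W @^-1` B))%E.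
Let F z := fine (P [set w | z < U w]).
Hypothesis F_gt0 : forall z, 0 < F z.
Hypothesis F_shift : forall m : R, F (z + m) / F z @[z --> +oo] --> expR (- m).
Hypotheses (a_gt0 : 0 < a) (e01 : 0 < e < 1).
Hypothesis W_up : (\int[P]_w (W w `^ ((1 + e) / a))%:E < +oo)%E.
Hypothesis W_dn : (\int[P]_w (W w `^ ((1 - e) / a))%:E < +oo)%E.

(** The tail of [v * expR (a * U)] at [x], divided by [F (ln x / a)]; for [v <= 0 < x] the event is
    empty. *)
Let psi (x v : R) : R := if 0 < v then F (ln x / a - ln v / a) / F (ln x / a) else 0.

Let F_anti x y : x <= y -> F y <= F x.
Proof. exact: tail_anti. Qed.

Let F_le1 x : F x <= 1.
Proof. exact: tail_le1. Qed.

Let mpsi x : measurable_fun setT (fun w => psi x (W w)).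
Proof.
have mF : measurable_fun setT F.
  by apply: nonincreasing_measurable => // u v; exact: F_anti.
apply: measurable_fun_ifT.
- by apply: measurable_fun_ltr.
- apply: measurable_funM => //; apply: (measurableT_comp mF).
  apply: measurable_funB => //; apply: measurable_funM => //.
  by apply: (measurableT_comp _ mW); exact: measurable_ln.
- exact: measurable_cst.
Qed.

Lemma tail_product (x : R) : 0 < x ->
  P [set w | x < W w * expR (a * U w)] =
  (\int[P]_w ((F (ln x / a))%:E * (psi x (W w))%:E))%E.
Proof.
move=> x0.
pose E : set (R * R) := [set z | x < z.2 * expR (a * z.1)].
have mprod : measurable_fun [set: R * R] (fun z : R * R => z.2 * expR (a * z.1)).
  apply: measurable_funM; first exact: measurable_snd.
  by apply: measurableT_comp => //; apply: measurable_funM; [exact: measurable_cst|exact: measurable_fst].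
have mE : measurable E.
  rewrite (_ : E = (fun z : R * R => z.2 * expR (a * z.1)) @^-1` `]x, +oo[).
    by rewrite -[X in measurable X]setTI; exact: mprod.
  by apply/seteqP; split => z /=; rewrite in_itv /= andbT.
pose f (z : R * R) := (\1_E z)%:E : \bar R.
have mS : measurable [set w | E (U w, W w)].
  rewrite -[X in measurable X]setTI.
  have : measurable_fun setT (fun w => (U w, W w)) by exact: measurable_fun_pair.
  by apply.
transitivity (\int[P]_w f (U w, W w))%E.
  by rewrite (integral_indicT P mS); apply: eq_integral => w _; rewrite /f !indicE.
rewrite (integral_independent (measurable_funP U) mW _ _ UW); last 2 first.
- exact/measurable_EFinP/measurable_indic.
- by move=> z; rewrite lee_fin.
apply: eq_integral => w _; rewrite /psi.
have [w0|w0] := ltP 0 (W w); last first.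
  rewrite mule0; apply: integral0_eq => w' _; rewrite /f indicE memNset// /E /=.
  apply/negP; rewrite -leNgt (le_trans _ (ltW x0))//.
  by rewrite mulr_le0_ge0// expR_ge0.
rewrite -EFinM mulrCA mulfV ?gt_eqF// mulr1.
have mU : measurable [set w' | ln x / a - ln (W w) / a < U w'] by exact: measurable_gt_set.
rewrite /F fineK ?fin_num_measure// (integral_indicT P mU).
apply: eq_integral => w' _; rewrite /f !indicE; congr ((nat_of_bool _)%:R)%:E.
have key : (x < W w * expR (a * U w')) = (ln x / a - ln (W w) / a < U w').
  rewrite -mulrBl ltr_pdivrMr// (mulrC (U w')) -[in RHS]ltr_expR expRD expRN !lnK ?posrE//.
  by rewrite ltr_pdivrMr// [X in _ < X]mulrC.
apply/idP/idP; rewrite !inE /E /=; by rewrite key.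
Qed.

(** Given [W = v], the normalized tail tends to [v ^ (1 / a)]. The Potter bound dominates it by a
    multiple of [v ^ ((1 + e) / a)] if [1 <= v] and of [v ^ ((1 - e) / a)] if [v < 1]; hence the two
    moment hypotheses. *)
Lemma breiman : fine (P [set w | x < W w * expR (a * U w)]) / F (ln x / a)
  @[x --> +oo] --> fine (\int[P]_w (W w `^ (1 / a))%:E).
Proof.
have [C C0 [z0 z00 potter]] := tail_potter F_anti F_gt0 F_le1 (@F_shift) e01.
pose dom w := (C * (W w `^ ((1 + e) / a) + W w `^ ((1 - e) / a)))%:E.
have mpow p : measurable_fun setT (fun w => W w `^ p).
  exact: (measurableT_comp (measurable_powR p)).
have mEpow p : measurable_fun setT (fun w => (W w `^ p)%:E) by exact/measurable_EFinP.
have psi0 x v : 0 <= psi x v.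
  by rewrite /psi; case: ifP => // _; rewrite divr_ge0// ltW.
have psi_le x v : 0 <= v -> z0 <= ln x / a ->
    psi x v <= C * (v `^ ((1 + e) / a) + v `^ ((1 - e) / a)).
  move=> v0 xz; rewrite /psi; case: ifP => [v0'|_]; last first.
    by rewrite mulr_ge0 ?(ltW C0)// addr_ge0// powR_ge0.
  rewrite ler_pdivrMr//; apply: (le_trans (potter _ (- (ln v / a)) xz)).
  rewrite ler_pM2r// ler_pM2l// opprK /powR gt_eqF//.
  have [h|h] := leP 0 (ln v / a).
    rewrite normrN ger0_norm//; apply: (@le_trans _ _ (expR ((1 + e) / a * ln v))).
      by rewrite ler_expR le_eqVlt; apply/orP; left; apply/eqP; ring.
    by rewrite lerDl expR_ge0.
  rewrite normrN ltr0_norm//; apply: (@le_trans _ _ (expR ((1 - e) / a * ln v))).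
    by rewrite ler_expR le_eqVlt; apply/orP; left; apply/eqP; ring.
  by rewrite lerDr expR_ge0.
have psi_cvg v (u : nat -> R) : 0 <= v -> u n @[n --> \oo] --> +oo ->
    psi (u n) v @[n --> \oo] --> v `^ (1 / a).
  move=> v0 uoo; have [v0'|v0'] := ltP 0 v; last first.
    have -> : v = 0 by apply/eqP; rewrite eq_le v0' v0.
    rewrite powR0 ?div1r ?invr_eq0 ?gt_eqF// /psi ltxx; exact: cvg_cst.
  have zoo : ln (u n) / a @[n --> \oo] --> +oo.
    have : ln (u n) @[n --> \oo] --> +oo by apply: cvg_comp uoo _; exact: cvgr_lny.
    move=> /cvgryPge H; apply/cvgryPge => A; apply: filterS (H (A * a)) => n.
    by rewrite ler_pdivlMr.
  have : F (ln (u n) / a + - (ln v / a)) / F (ln (u n) / a) @[n --> \oo] --> expR (- - (ln v / a)).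
    exact: (cvg_comp _ _ zoo (@F_shift (- (ln v / a)))).
  rewrite opprK /powR gt_eqF// (_ : 1 / a * ln v = ln v / a); last by rewrite div1r mulrC.
  by rewrite /psi v0'.
apply/cvg_pinftyP => u uoo.
(* Truncating the sequence from below makes the Potter bound hold for every [n], not only
   eventually. *)
pose x0 := Num.max 1 (expR (z0 * a)).
pose u' n := Num.max (u n) x0.
have u'oo : u' n @[n --> \oo] --> +oo.
  move/cvgryPge : uoo => H; apply/cvgryPge => A; apply: filterS (H A) => n An.
  by rewrite le_max An.
have u'E : \forall n \near \oo, u' n = u n.
  move/cvgryPge : uoo => /(_ x0); apply: filterS => n x0n.
  by rewrite /u' maxElt ltNge x0n.
suff : fine (P [set w | u' n < W w * expR (a * U w)]) / F (ln (u' n) / a)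
    @[n --> \oo] --> fine (\int[P]_w (W w `^ (1 / a))%:E).
  by apply: cvg_near_eq; apply: filterS u'E => n ->.
have u'0 n : 0 < u' n by rewrite lt_max; apply/orP; right; rewrite lt_max ltr01.
have zu' n : z0 <= ln (u' n) / a.
  by rewrite ler_pdivlMr// -ler_expR lnK ?posrE// /u' /x0 !le_max lexx !orbT.
have dom_int : P.-integrable setT dom.
  apply/integrableP; split.
    by apply/measurable_EFinP; apply: measurable_funM => //; exact: measurable_funD.
  under eq_integral do rewrite gee0_abs ?lee_fin ?mulr_ge0 ?(ltW C0) ?addr_ge0 ?powR_ge0//.
  rewrite (eq_integral (fun w => C%:E * ((W w `^ ((1 + e) / a))%:E + (W w `^ ((1 - e) / a))%:E))%E)//.
  rewrite ge0_integralZl//; last 3 first.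
  - exact: emeasurable_funD.
  - by move=> w _; rewrite -EFinD lee_fin addr_ge0// powR_ge0.
  - by rewrite lee_fin ltW.
  rewrite ge0_integralD//; last 2 first.
  - by move=> w _; rewrite lee_fin powR_ge0.
  - by move=> w _; rewrite lee_fin powR_ge0.
  rewrite lte_mul_pinfty ?lee_fin ?(ltW C0)//.
  by rewrite lte_add_pinfty.
have [int_lim _ cvg_int] := @dominated_convergence _ _ _ P setT measurableT
  (fun n w => (psi (u' n) (W w))%:E) (fun w => (W w `^ (1 / a))%:E) dom
  ltac:(by move=> n; exact/measurable_EFinP)
  (mEpow (1 / a))
  ltac:(by apply: aeW => w _; apply: cvg_EFin; [exact: nearW|exact: psi_cvg])
  dom_int
  ltac:(by apply: aeW => w n _; rewrite gee0_abs ?lee_fin// psi_le).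
have E n : fine (P [set w | u' n < W w * expR (a * U w)]) / F (ln (u' n) / a) =
    fine (\int[P]_w (psi (u' n) (W w))%:E)%E.
  rewrite tail_product// ge0_integralZl//; last 3 first.
  - exact/measurable_EFinP.
  - by move=> w _; rewrite lee_fin.
  - by rewrite lee_fin ltW.
  rewrite fineM//; last first.
    rewrite ge0_fin_numE; last by apply: integral_ge0 => w _; rewrite lee_fin.
    have /integrableP[_] := dom_int; apply: le_lt_trans.
    apply: ge0_le_integral => //.
    - by move=> w _; rewrite lee_fin.
    - exact/measurable_EFinP.
    - by apply: measurableT_comp => //; have /integrableP[] := dom_int.
    - by move=> w _; rewrite (le_trans _ (lee_abs _))// lee_fin psi_le.
  by rewrite /= mulrAC mulfV ?gt_eqF// mul1r.
under eq_fun do rewrite E.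
have /fine_cvgP[_] : (\int[P]_w (psi (u' n) (W w))%:E)%E @[n --> \oo] -->
    (fine (\int[P]_w (W w `^ (1 / a))%:E))%:E.
  by rewrite fineK//; exact: integrable_fin_num.
by [].
Qed.

End breiman.

(** * Limits of the joint tails *)

Lemma prob_ae_eq d (T : measurableType d) (R : realType) (P : probability T R)
    (A B : set T) : measurable A -> measurable B ->
  {ae P, forall w, A w <-> B w} -> P A = P B.
Proof.
move=> mA mB AB; rewrite (integral_indicT P mA) (integral_indicT P mB).
apply: ge0_ae_eq_integral => //; try exact/measurable_EFinP/measurable_indic.
apply: filterS AB => w AB _; rewrite !indicE.
suff -> : (w \in A) = (w \in B) by [].
by apply/idP/idP; rewrite !inE AB.
Qed.

Lemma prob_ae_le d (T : measurableType d) (R : realType) (P : probability T R)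
    (A B : set T) : measurable A -> measurable B ->
  {ae P, forall w, A w -> B w} -> (P A <= P B)%E.
Proof.
move=> mA mB AB; rewrite (@prob_ae_eq _ _ _ P A (A `&` B))//.
- by apply: le_measure; rewrite ?inE//; exact: measurableI.
- exact: measurableI.
- by apply: filterS AB => w AB; split=> [Aw|[]//]; split => //; exact: AB.
Qed.

Lemma measurable_above d (T : measurableType d) (R : realType) (X Y : T -> R) (a b : R) :
  measurable_fun setT X -> measurable_fun setT Y ->
  measurable [set w | a < X w /\ b < Y w].
Proof.
move=> mX mY.
rewrite (_ : [set w | _] = X @^-1` `]a, +oo[ `&` Y @^-1` `]b, +oo[).
  by apply: measurableI; rewrite -[X in measurable X]setTI; [exact: mX|exact: mY].
by apply/seteqP; split => w /=; rewrite !in_itv /= !andbT.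
Qed.

(** Only finitely many terms exceed 1/2, so finitely many strict inequalities decide the bound. *)
Lemma uniform_gap (R : realType) (b : nat -> R) (S : pred nat) :
  b n @[n --> \oo] --> 0 -> (forall k, ~~ S k -> b k < 1) ->
  exists2 rho : R, 0 < rho < 1 & forall k, ~~ S k -> b k <= rho.
Proof.
move=> b0 b1; have half : 0 < (1 : R) / 2 by rewrite divr_gt0.
have [N _ NP] := cvgr_lt _ b0 _ half.
pose rho := \big[Num.max/(1 / 2)]_(k < N | ~~ S k) b k.
have hrho : 1 / 2 <= rho by exact: bigmax_ge_id.
exists rho.
  rewrite (lt_le_trans half hrho)/=; apply/bigmax_ltP; split; first by lra.
  by move=> k; exact: b1.
move=> k kS; have [Nk|kN] := leqP N k; first by rewrite (le_trans (ltW (NP _ Nk))).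
exact: (@le_bigmax_cond _ _ _ _ (Ordinal kN)).
Qed.

Lemma expR_ln_cvg0 (R : realType) (A a : R) : 0 <= A -> 0 < a ->
  A * expR (- a * ln x) @[x --> +oo] --> 0.
Proof.
move=> A0 a0; apply/cvgrPdist_le => e e0; near=> x.
have big : expR (A / (e * a)) <= x by near: x; exact: (nbhs_pinfty_ge (num_real _)).
have x0 : 0 < x by apply: lt_le_trans big; exact: expR_gt0.
rewrite sub0r normrN ger0_norm ?mulr_ge0 ?expR_ge0// mulNr expRN ler_pdivrMr ?expR_gt0//.
have h : A / e <= a * ln x.
  have : A / (e * a) <= ln x by rewrite -ler_expR lnK// posrE.
  rewrite ler_pdivrMr ?mulr_gt0// => h.
  by rewrite ler_pdivrMr//; apply: (le_trans h); rewrite le_eqVlt; apply/orP; left; apply/eqP; ring.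
rewrite -ler_pdivrMl// mulrC; apply: (le_trans h).
by apply: (le_trans _ (expR_ge1Dx _)); rewrite lerDr.
Unshelve. all: by end_near. Qed.

(** * Joint tails of two products driven by the same noise *)

Section sv_pair.
Context d (T : measurableType d) (R : realType) (P : probability T R).
Variables (eta eps : int -> {RV P >-> R}) (h : nat).
Hypothesis eta_indep : independent_family eta.
Hypothesis eta_ident : identically_distributed eta.
Hypothesis eta_eps : independent_of eta eps.
Let F z := fine (P [set w | z < eta 0 w]).
Hypothesis F_gt0 : forall z, 0 < F z.
Hypothesis F_shift : forall m : R, F (z + m) / F z @[z --> +oo] --> expR (- m).
Let xi := noise eta h.

Variables (c0 c1 : nat -> R) (S : R).
Hypothesis c0_01 : forall k, 0 <= c0 k <= 1.
Hypothesis c1_01 : forall k, 0 <= c1 k <= 1.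
Hypothesis c0_cvg : convergent_noise eta h c0.
Hypothesis c1_cvg : convergent_noise eta h c1.
Hypothesis c0_to0 : c0 n @[n --> \oo] --> (0 : R).
Hypothesis c1_to0 : c1 n @[n --> \oo] --> (0 : R).
Hypothesis c0_sum : forall n, \sum_(k < n) c0 k <= S.
Hypothesis c1_sum : forall n, \sum_(k < n) c1 k <= S.

Variables (e0 e1 : T -> R) (Q : R).
Hypothesis e0_meas : eps_measurable eta eps e0.
Hypothesis e1_meas : eps_measurable eta eps e1.
Hypothesis e0_ge0 : forall w, 0 <= e0 w.
Hypothesis e1_ge0 : forall w, 0 <= e1 w.
Hypothesis e_moment : forall q0 q1, 0 <= q0 <= Q -> 0 <= q1 <= Q ->
  (\int[P]_w (e0 w `^ q0 * e1 w `^ q1)%:E < +oo)%E.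
Hypothesis e_pos : (0 < P [set w | (0 < e0 w)%R /\ (0 < e1 w)%R])%E.

(** For the coefficients of a volatility, [e = 1] gives back the volatility almost surely, and
    [e = Num.max eps 0] the positive part of the observed process. *)
Definition sv_product (e : T -> R) (c : nat -> R) (w : T) : R := e w * exp_series eta h c w.

Lemma sv_product_measurable e c : eps_measurable eta eps e ->
  measurable_fun setT (sv_product e c).
Proof.
move=> me; apply: measurable_funM; first exact: eps_measurableT me.
exact: exp_series_measurable.
Qed.

Definition sv_joint (s t x : R) : R :=
  fine (P [set w | s * x < sv_product e0 c0 w /\ t * x < sv_product e1 c1 w]).

Lemma sv_product_indep r (a0 a1 : nat -> R) (A : set R) (B : set (R * R)) :
  a0 r = 0 -> a1 r = 0 -> measurable A -> measurable B ->
  P (xi r @^-1` A `&` (fun w => (sv_product e0 a0 w, sv_product e1 a1 w)) @^-1` B) =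
  (P (xi r @^-1` A) *
   P ((fun w => (sv_product e0 a0 w, sv_product e1 a1 w)) @^-1` B))%E.
Proof.
move=> a0r a1r mA mB.
apply: (eta_indep_others eta_indep eta_eps _ mA mB).
by apply: measurable_fun_pair; apply: measurable_funM => //; exact: exp_series_others.
Qed.

Lemma sv_joint_drop r s t x : sv_joint s t x =
  joint_tail (xi r) (sv_product e0 (zero_at r c0)) (sv_product e1 (zero_at r c1))
    (c0 r) (c1 r) s t x.
Proof.
congr fine; apply: prob_ae_eq.
- by apply: measurable_above; exact: sv_product_measurable.
- have mexp b : measurable_fun setT (fun w => expR (b * xi r w)).
    by apply: measurableT_comp => //; apply: measurable_funM => //; exact: measurable_funP.
  by apply: measurable_above; apply: measurable_funM => //; exact: sv_product_measurable.
have := exp_series_zero_at r c0_cvg; have := exp_series_zero_at r c1_cvg.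
apply: filterS2 => w E1 E0; rewrite /= /sv_product -!mulrA.
by rewrite E0 E1; exact: iff_refl.
Qed.

Let F_anti x y : x <= y -> F y <= F x.
Proof. exact: tail_anti. Qed.

Let F_le1 x : F x <= 1.
Proof. exact: tail_le1. Qed.

Lemma sv_product_pos (a0 a1 : nat -> R) :
  convergent_noise eta h a0 -> convergent_noise eta h a1 -> exists2 v : R, 0 < v &
  0 < fine (P [set w | v < sv_product e0 a0 w /\ v < sv_product e1 a1 w]).
Proof.
move=> cv0 cv1.
have mA v : measurable [set w | v < sv_product e0 a0 w /\ v < sv_product e1 a1 w].
  by apply: measurable_above; exact: sv_product_measurable.
have pos : (0 < P [set w | (0 < sv_product e0 a0 w)%R /\ (0 < sv_product e1 a1 w)%R])%E.
  rewrite (@prob_ae_eq _ _ _ P _ [set w | 0 < e0 w /\ 0 < e1 w])//.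
    by apply: measurable_above; exact: eps_measurableT.
  have := exp_series_ae cv0; have := exp_series_ae cv1.
  apply: filterS2 => w [_ p1] [_ p0] /=.
  by rewrite /sv_product !pmulr_lgt0.
apply: contrapT => no.
suff : P (\bigcup_n [set w | n.+1%:R^-1 < sv_product e0 a0 w /\
                         n.+1%:R^-1 < sv_product e1 a1 w]) = 0%E.
  rewrite (_ : \bigcup_n _ = [set w | 0 < sv_product e0 a0 w /\ 0 < sv_product e1 a1 w]).
    by move=> P0; rewrite P0 ltxx in pos.
  apply/seteqP; split => w /=.
    by move=> [n _ [/= p0 p1]]; split; [apply: lt_trans p0|apply: lt_trans p1]; rewrite invr_gt0.
  move=> [p0 p1].
  have m0 : 0 < Num.min (sv_product e0 a0 w) (sv_product e1 a1 w) by rewrite lt_min p0.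
  have [n] := ltr_add_invr m0; rewrite add0r lt_min => /andP[? ?].
  by exists n.
apply/eqP; rewrite eq_le measure_ge0 andbT.
apply: le_trans (generalized_Boole_inequality P _ _) _ => //.
  by apply: bigcup_measurable => n _; exact: mA.
rewrite eseries0// => n _ _; apply/eqP; rewrite eq_le measure_ge0 andbT leNgt; apply/negP => Pn.
apply: no; exists n.+1%:R^-1; rewrite ?invr_gt0//.
by rewrite fine_gt0// Pn ltey_eq fin_num_measure.
Qed.

Lemma sv_moment (rho q0 q1 : R) (r : nat) : 0 < rho < 1 ->
  0 <= q0 <= Q -> 0 <= q1 <= Q ->
  (forall k, k != r -> q0 * c0 k + q1 * c1 k <= rho) ->
  (\int[P]_w (sv_product e0 (zero_at r c0) w `^ q0 *
    sv_product e1 (zero_at r c1) w `^ q1)%:E < +oo)%E.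
Proof.
move=> rho01 q0Q q1Q qrho; have /andP[q00 q0Q'] := q0Q; have /andP[q10 q1Q'] := q1Q.
have ge0 (c : nat -> R) k : (forall k, 0 <= c k <= 1) -> 0 <= zero_at r c k.
  by move=> c01; rewrite /zero_at; case: ifP => // _; have /andP[] := c01 k.
have Q0 : 0 <= Q by rewrite (le_trans q00).
have sum_le (c : nat -> R) n : (forall k, 0 <= c k <= 1) ->
    \sum_(k < n) zero_at r c k <= \sum_(k < n) c k.
  move=> c01; apply: ler_sum => k _; rewrite /zero_at; case: ifP => // _.
  by have /andP[] := c01 k.
apply: (exp_series_moment eta_indep eta_ident eta_eps F_gt0 (@F_shift) (S := Q * S + Q * S) rho01) => //.
- by move=> k; exact: ge0.
- by move=> k; exact: ge0.
- move=> k; have [->|kr] := eqVneq k r.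
    by rewrite /zero_at eqxx !mulr0 addr0; case/andP: rho01 => /ltW.
  by rewrite /zero_at (negbTE kr) qrho.
- move=> n; rewrite big_split /= -!mulr_sumr; apply: lerD.
    apply: (@le_trans _ _ (Q * \sum_(k < n) zero_at r c0 k)).
      by rewrite ler_wpM2r// sumr_ge0// => k _; exact: ge0.
    by rewrite ler_wpM2l// (le_trans (sum_le _ _ c0_01)).
  apply: (@le_trans _ _ (Q * \sum_(k < n) zero_at r c1 k)).
    by rewrite ler_wpM2r// sumr_ge0// => k _; exact: ge0.
  by rewrite ler_wpM2l// (le_trans (sum_le _ _ c1_01)).
- exact: e_moment.
- exact: convergent_zero_at.
- exact: convergent_zero_at.
Qed.

Section lower_bound.
Variables (i j : nat) (ki kj : R).
Hypotheses (ij : i != j) (ki0 : 0 < ki) (kj0 : 0 < kj).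
Hypothesis k_c0 : c0 i * ki + c0 j * kj = 1.
Hypothesis k_c1 : c1 i * ki + c1 j * kj = 1.

(** The cheapest way to exceed both levels: [xi i] and [xi j] above [ki * ln x] and [kj * ln x], up
    to constants. Since both constraints are tight, this multiplies each product by at least [x],
    and independence gives a probability of order at least [x ^ (- (1 + e) * (ki + kj))]. *)
Lemma sv_joint_lower (s t e : R) : 0 < s -> 0 < t -> 0 < e < 1 ->
  exists2 c : R, 0 < c & \forall x \near +oo,
    c * expR (- ((1 + e) * (ki + kj)) * ln x) <= sv_joint s t x.
Proof.
move=> s0 t0 e01.
(* Removing both indices makes the remaining products independent of [xi i] and [xi j]; the level
   [v] is one they jointly exceed with positive probability. *)
pose a0 := zero_at j (zero_at i c0); pose a1 := zero_at j (zero_at i c1).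
have cv0 : convergent_noise eta h a0 by do 2 apply: convergent_zero_at.
have cv1 : convergent_noise eta h a1 by do 2 apply: convergent_zero_at.
have [v v0 pv] := sv_product_pos cv0 cv1.
have [cc cc0 [z0 z00 low]] := tail_lower F_anti F_gt0 (@F_shift) e01.
(* Chosen so that [v * expR g] is at least both [s] and [t]. *)
pose g := Num.max (ln (s / v)) (ln (t / v)).
set pW := fine _ in pv.
exists (cc ^+ 2 * pW * expR (- ((1 + e) * (ki + kj)) * g)).
  by rewrite !mulr_gt0 ?expR_gt0 ?exprn_gt0.
near=> x.
have x0 : 0 < x by near: x; exact: nbhs_pinfty_gt.
have kz k : 0 < k -> z0 / k - g <= ln x -> z0 <= k * (ln x + g).
  by move=> k0; rewrite lerBlDr ler_pdivrMr// mulrC.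
have lnx a : a <= ln x = (expR a <= x) by rewrite -ler_expR lnK.
have zi : z0 <= ki * (ln x + g).
  by apply: kz => //; rewrite lnx; near: x; exact: (nbhs_pinfty_ge (num_real _)).
have zj : z0 <= kj * (ln x + g).
  by apply: kz => //; rewrite lnx; near: x; exact: (nbhs_pinfty_ge (num_real _)).
pose Ei := [set w | ki * (ln x + g) < xi i w].
pose Ej := [set w | kj * (ln x + g) < xi j w].
pose EW := [set w | v < sv_product e0 a0 w /\ v < sv_product e1 a1 w].
have mEi : measurable Ei by exact: measurable_gt_set.
have mEj : measurable Ej by exact: measurable_gt_set.
have mEW : measurable EW by apply: measurable_above; exact: sv_product_measurable.
have a0i : a0 i = 0 by rewrite /a0 /zero_at (negbTE ij) eqxx.
have a1i : a1 i = 0 by rewrite /a1 /zero_at (negbTE ij) eqxx.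
have a0j : a0 j = 0 by rewrite /a0 /zero_at eqxx.
have a1j : a1 j = 0 by rewrite /a1 /zero_at eqxx.
have mitv (a : R) : measurable (`]a, +oo[%classic : set R) by exact: measurable_itv.
have EWE : EW = (fun w => (sv_product e0 a0 w, sv_product e1 a1 w)) @^-1`
    (`]v, +oo[%classic `*` `]v, +oo[%classic).
  by apply/seteqP; split => w /=; rewrite !in_itv /= !andbT.
have PE : P (Ei `&` (Ej `&` EW)) = (P Ei * (P Ej * P EW))%E.
  have EjE : Ej = xi j @^-1` `]kj * (ln x + g), +oo[%classic.
    by apply/seteqP; split => w /=; rewrite in_itv /= andbT.
  have EiE : Ei = xi i @^-1` `]ki * (ln x + g), +oo[%classic.
    by apply/seteqP; split => w /=; rewrite in_itv /= andbT.
  have <- : P (Ej `&` EW) = (P Ej * P EW)%E.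
    rewrite EjE EWE; apply: sv_product_indep => //.
    by apply: measurableX.
  rewrite [in RHS]EiE.
  pose V w := (xi j w, (sv_product e0 a0 w, sv_product e1 a1 w)).
  have EVE : Ej `&` EW = V @^-1` (`]kj * (ln x + g), +oo[%classic `*`
      (`]v, +oo[%classic `*` `]v, +oo[%classic)).
    by rewrite EjE EWE.
  rewrite EVE EiE; apply: (eta_indep_others eta_indep eta_eps) => //; last first.
    by apply: measurableX => //; exact: measurableX.
  apply: measurable_fun_pair; first by apply: noise_others; rewrite eq_sym.
  by apply: measurable_fun_pair; apply: measurable_funM => //; exact: exp_series_others.
have sub : (P (Ei `&` (Ej `&` EW)) <= (sv_joint s t x)%:E)%E.
  have mJ : measurable [set w | s * x < sv_product e0 c0 w /\ t * x < sv_product e1 c1 w].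
    by apply: measurable_above; exact: sv_product_measurable.
  rewrite fineK ?fin_num_measure//; apply: prob_ae_le => //.
    by do 2 apply: measurableI => //.
  have key (c : nat -> R) (e' : T -> R) (b : R) (w : T) :
      exp_series eta h c w = exp_series eta h (zero_at i c) w * expR (c i * xi i w) ->
      exp_series eta h (zero_at i c) w =
        exp_series eta h (zero_at j (zero_at i c)) w * expR (zero_at i c j * xi j w) ->
      0 <= c i -> 0 <= c j -> c i * ki + c j * kj = 1 -> ln (b / v) <= g -> 0 < b ->
      Ei w -> Ej w -> v < sv_product e' (zero_at j (zero_at i c)) w ->
      b * x < sv_product e' c w.
    move=> E1 E2 ci cj k1 gb b0 /= wi wj wv.
    rewrite /sv_product E1 E2 /zero_at (eq_sym j) (negbTE ij) -mulrA -expRD mulrA.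
    apply: (@lt_le_trans _ _ (sv_product e' (zero_at j (zero_at i c)) w * expR (ln x + g))).
      apply: (@le_lt_trans _ _ (v * expR (ln x + g))); last by rewrite ltr_pM2r ?expR_gt0.
      rewrite expRD lnK// mulrCA mulrC ler_pM2l//.
      by rewrite -ler_pdivrMl// mulrC -[leLHS]lnK ?ler_expR// posrE divr_gt0.
    rewrite ler_pM2l ?ler_expR//; last exact: lt_trans wv.
    rewrite -[leLHS]mul1r -k1 mulrDl -!mulrA [leRHS]addrC.
    by rewrite lerD// ler_wpM2l// ltW.
  have AE r (b0 b1 : nat -> R) : convergent_noise eta h b0 -> convergent_noise eta h b1 ->
      {ae P, forall w,
        exp_series eta h b0 w = exp_series eta h (zero_at r b0) w * expR (b0 r * xi r w) /\
        exp_series eta h b1 w = exp_series eta h (zero_at r b1) w * expR (b1 r * xi r w)}.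
    move=> h0 h1; have := exp_series_zero_at r h1; have := exp_series_zero_at r h0.
    by apply: filterS2.
  have := AE j _ _ (convergent_zero_at i c0_cvg) (convergent_zero_at i c1_cvg).
  have := AE i _ _ c0_cvg c1_cvg.
  apply: filterS2 => w [E01 E11] [E02 E12] [wi [wj [w0 w1]]] /=.
  have /andP[c0i _] := c0_01 i; have /andP[c0j _] := c0_01 j.
  have /andP[c1i _] := c1_01 i; have /andP[c1j _] := c1_01 j.
  split.
    by apply: (key c0 e0 s w E01 E02) => //; rewrite le_max lexx.
  by apply: (key c1 e1 t w E11 E12) => //; rewrite le_max lexx orbT.
have PF k b : P [set w | b < xi k w] = (F b)%:E.
  have -> : F b = fine (P [set w | b < xi k w]) by rewrite (tail_noise h eta_ident).
  by rewrite fineK// fin_num_measure//; exact: measurable_gt_set.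
have PW : P EW = pW%:E by rewrite fineK// fin_num_measure.
move: sub; rewrite PE !PF PW -!EFinM lee_fin; apply: le_trans.
have Fi := low _ zi; have Fj := low _ zj.
rewrite [leRHS]mulrA; apply: (@le_trans _ _ ((cc * expR (- (1 + e) * (ki * (ln x + g)))) *
   (cc * expR (- (1 + e) * (kj * (ln x + g)))) * pW)).
  rewrite [leRHS](_ : _ = cc ^+ 2 * pW * (expR (- (1 + e) * (ki * (ln x + g))) *
    expR (- (1 + e) * (kj * (ln x + g))))); last by ring.
  rewrite -mulrA ler_pM2l ?mulr_gt0 ?exprn_gt0// -!expRD ler_expR.
  by rewrite le_eqVlt; apply/orP; left; apply/eqP; ring.
by rewrite ler_pM2r// ler_pM// mulr_ge0 ?expR_ge0// ltW.
Unshelve. all: by end_near. Qed.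

Lemma sv_joint_gt0 (s t : R) : 0 < s -> 0 < t ->
  \forall x \near +oo, 0 < sv_joint s t x.
Proof.
move=> s0 t0; have e01 : 0 < (1 : R) / 2 < 1 by lra.
have [c cc0] := sv_joint_lower s0 t0 e01; apply: filterS => x; apply: lt_le_trans.
by rewrite mulr_gt0 ?expR_gt0.
Qed.

Variables y0 y1 : R.
Hypotheses (y00 : 0 < y0) (y10 : 0 < y1).
Hypothesis y_i : y0 * c0 i + y1 * c1 i = 1.
Hypothesis y_j : y0 * c0 j + y1 * c1 j = 1.
Hypothesis y_other : forall k, k != i -> k != j -> y0 * c0 k + y1 * c1 k < 1.
Hypothesis det0 : c0 i * c1 j - c0 j * c1 i != 0.
Hypothesis kQ : ki + kj < Q.

(* Tilting the dual weights [y] towards [j] makes their total exceed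
   [ki + kj], at the price of [q . c j > 1]: this is harmless once the
   summand of index [j] has been removed. *)
Lemma sv_negligible (s t C : R) : 0 < s -> 0 < t -> 0 < C ->
  fine (P [set w | C * x < sv_product e0 (zero_at j c0) w /\
                   C * x < sv_product e1 (zero_at j c1) w])
  / sv_joint s t x @[x --> +oo] --> 0.
Proof.
move=> s0 t0 C0.
(* Equality of the dual and the primal value. *)
have sum_y : y0 + y1 = ki + kj.
  have -> : ki + kj = ki * (y0 * c0 i + y1 * c1 i) + kj * (y0 * c0 j + y1 * c1 j).
    by rewrite y_i y_j !mulr1.
  rewrite -[y0 in LHS]mulr1 -[y1 in LHS]mulr1 -[in X in X + _ = _]k_c0 -k_c1; ring.
pose D := c0 i * c1 j - c0 j * c1 i.
(* The tilt is prescribed by its effects [- kj] on the coefficients of [i] and [2 * ki] on those of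
   [j]. The first brings the moment order at [i] below 1; weighted with [ki] and [kj], they raise
   the total exponent by [ki * kj > 0]. *)
pose th0 := (- kj * c1 j - 2 * ki * c1 i) / D.
pose th1 := (c0 i * (2 * ki) + kj * c0 j) / D.
have th_i : th0 * c0 i + th1 * c1 i = - kj by rewrite /th0 /th1 /D; field.
have th_j : th0 * c0 j + th1 * c1 j = 2 * ki by rewrite /th0 /th1 /D; field.
have sum_th : th0 + th1 = ki * kj.
  transitivity (ki * (th0 * c0 i + th1 * c1 i) + kj * (th0 * c0 j + th1 * c1 j)).
    rewrite -[th0 in LHS]mulr1 -[th1 in LHS]mulr1 -[in X in X + _ = _]k_c0 -k_c1; ring.
  by rewrite th_i th_j; ring.
have yc0 : y0 * c0 n + y1 * c1 n @[n --> \oo] --> (0 : R).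
  have : y0 * c0 n + y1 * c1 n @[n --> \oo] --> y0 * 0 + y1 * 0.
    by apply: cvgD; apply: cvgM => //; exact: cvg_cst.
  by rewrite !mulr0 addr0.
have [|rho0 rho001 rho0P] := @uniform_gap R _ [pred k | (k == i) || (k == j)] yc0.
  by move=> k /=; rewrite negb_or => /andP[? ?]; exact: y_other.
have /andP[rho00 rho01] := rho001.
have [e [[e_gt0 e1' ey0 ey1] [eQ0 eQ1 egap]]] : exists e : R,
   [/\ 0 < e, e * kj <= 1 / 2, e * - th0 <= y0 & e * - th1 <= y1] /\
   [/\ e * th0 <= Q - y0, e * th1 <= Q - y1 & e * (`|th0| + `|th1|) <= (1 - rho0) / 2].
  near (0 : R)^'+ => e; exists e; split; split.
  - by near: e; exact: nbhs_right_gt.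
  - by near: e; apply: small_near; rewrite divr_gt0.
  - by near: e; exact: small_near.
  - by near: e; exact: small_near.
  - by near: e; apply: small_near; rewrite subr_gt0 (le_lt_trans _ kQ)// -sum_y lerDl ltW.
  - by near: e; apply: small_near; rewrite subr_gt0 (le_lt_trans _ kQ)// -sum_y lerDr ltW.
  - by near: e; apply: small_near; rewrite divr_gt0// subr_gt0.
pose q0 := y0 + e * th0; pose q1 := y1 + e * th1.
have q0Q : 0 <= q0 <= Q by apply/andP; split; rewrite /q0; lra.
have q1Q : 0 <= q1 <= Q by apply/andP; split; rewrite /q1; lra.
(* The first bound covers index [i]; the second lies halfway between [rho0] and 1 and covers the
   indices other than [i] and [j]. *)
pose rho := Num.max (1 - e * kj) ((1 + rho0) / 2).
have rho_01 : 0 < rho < 1.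
  apply/andP; split; first by rewrite lt_max; apply/orP; left; lra.
  rewrite gt_max; apply/andP; split; last lra.
  by rewrite ltrBlDr ltrDl mulr_gt0.
have qrho k : k != j -> q0 * c0 k + q1 * c1 k <= rho.
  move=> kj'; rewrite le_max; apply/orP.
  have [->|ki'] := eqVneq k i; [left|right].
    rewrite (_ : q0 * _ + _ = (y0 * c0 i + y1 * c1 i) + e * (th0 * c0 i + th1 * c1 i)).
      by rewrite y_i th_i; lra.
    by rewrite /q0 /q1; ring.
  rewrite (_ : q0 * _ + _ = (y0 * c0 k + y1 * c1 k) + e * (th0 * c0 k + th1 * c1 k)).
    have h1 : y0 * c0 k + y1 * c1 k <= rho0 by apply: rho0P; rewrite /= negb_or ki'.
    have h2 : th0 * c0 k + th1 * c1 k <= `|th0| + `|th1|.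
      have /andP[a0 a1] := c0_01 k; have /andP[b0 b1] := c1_01 k.
      by apply: lerD; apply: (le_trans (ler_norm _)); rewrite normrM ?(ger0_norm a0) ?(ger0_norm b0) ler_piMr.
    have h3 : e * (th0 * c0 k + th1 * c1 k) <= e * (`|th0| + `|th1|) by rewrite ler_pM2l.
    lra.
  by rewrite /q0 /q1; ring.
have mom := sv_moment rho_01 q0Q q1Q qrho.
pose p := ki + kj; have p0 : 0 < p by rewrite addr_gt0.
have sum_q : q0 + q1 = p + e * (ki * kj).
  by rewrite /q0 /q1 -sum_th /p -sum_y; ring.
have d0 : 0 < e * (ki * kj) by rewrite !mulr_gt0.
(* The loss [f * p] in the lower bound of the joint tail is kept to at most half of the gain
   [e * (ki * kj)] from the tilt, which leaves a positive power of [x]. *)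
pose f := Num.min (1 / 2) (e * (ki * kj) / (2 * p)).
have f01 : 0 < f < 1.
  by rewrite lt_min gt_min !divr_gt0//= ?mulr_gt0// ltr_pdivrMr// mul1r ltrDl ltr01.
have fp : f * p <= e * (ki * kj) / 2.
  apply: (@le_trans _ _ (e * (ki * kj) / (2 * p) * p)).
    by rewrite ler_pM2r// ge_min lexx orbT.
  by rewrite le_eqVlt; apply/orP; left; apply/eqP; field; exact: lt0r_neq0.
have [c cc0 low] := sv_joint_lower s0 t0 f01.
set M := fine (\int[P]_w (sv_product e0 (zero_at j c0) w `^ q0 *
    sv_product e1 (zero_at j c1) w `^ q1)%:E) in mom.
pose b := q0 + q1 - (1 + f) * p.
have b0 : 0 < b by rewrite /b sum_q; lra.
have /andP[q00 _] := q0Q; have /andP[q10 _] := q1Q.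
have M0 : 0 <= M.
  by apply/fine_ge0/integral_ge0 => w _; rewrite lee_fin mulr_ge0 ?powR_ge0.
apply: (@squeeze_cvgr _ _ _ _ (cst 0) (fun x : R => M * C `^ (- (q0 + q1)) / c * expR (- b * ln x))); last 2 first.
- exact: cvg_cst.
- by apply: expR_ln_cvg0 => //; rewrite divr_ge0 ?mulr_ge0 ?powR_ge0// ltW.
near=> x.
have x0 : 0 < x by near: x; exact: nbhs_pinfty_gt.
have lowx : c * expR (- ((1 + f) * (ki + kj)) * ln x) <= sv_joint s t x by near: x.
have J0 : 0 < sv_joint s t x by apply: lt_le_trans lowx; rewrite mulr_gt0 ?expR_gt0.
apply/andP; split; first by rewrite divr_ge0 ?fine_ge0// ltW.
rewrite ler_pdivrMr//.
have ch := joint_chernoff (sv_product_measurable _ e0_meas) (sv_product_measurable _ e1_meas) q00 q10 C0 x0 mom.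
apply: (le_trans ch).
apply: (@le_trans _ _ (M * C `^ (- (q0 + q1)) / c * expR (- b * ln x) *
   (c * expR (- ((1 + f) * (ki + kj)) * ln x)))); last first.
  by rewrite ler_wpM2l// mulr_ge0 ?expR_ge0// divr_ge0 ?mulr_ge0 ?powR_ge0// ltW.
rewrite powRM ?(ltW C0) ?(ltW x0)// le_eqVlt; apply/orP; left; apply/eqP.
rewrite (_ : x `^ (- (q0 + q1)) = expR (- b * ln x) * expR (- ((1 + f) * (ki + kj)) * ln x)).
  by rewrite -/M; field; exact: lt0r_neq0.
rewrite /powR gt_eqF// -expRD; congr expR; rewrite /b /p; ring.
Unshelve. all: by end_near. Qed.

End lower_bound.

Lemma sv_shift r (s t m : R) : 0 < s -> 0 < t ->
  (forall C, 0 < C -> fine (P [set w | C * x < sv_product e0 (zero_at r c0) w /\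
                                      C * x < sv_product e1 (zero_at r c1) w])
    / sv_joint s t x @[x --> +oo] --> 0) ->
  (\forall x \near +oo, 0 < sv_joint s t x) ->
  sv_joint (s * expR (c0 r * m)) (t * expR (c1 r * m)) x / sv_joint s t x
    @[x --> +oo] --> expR (- m).
Proof.
move=> s0 t0 negl pos.
have /andP[c0r _] := c0_01 r; have /andP[c1r _] := c1_01 r.
have tail z : fine (P [set w | z < xi r w]) = F z by exact: tail_noise.
have xi_gt0 z : 0 < fine (P [set w | z < xi r w]) by rewrite tail.
have xi_shift m' : fine (P [set w | z + m' < xi r w]) / fine (P [set w | z < xi r w])
    @[z --> +oo] --> expR (- m').
  by under eq_fun do rewrite !tail; exact: F_shift.
have indep (A : set R) (B : set (R * R)) : measurable A -> measurable B ->
    P (xi r @^-1` A `&` (fun w => (sv_product e0 (zero_at r c0) w,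
                                   sv_product e1 (zero_at r c1) w)) @^-1` B) =
    (P (xi r @^-1` A) * P ((fun w => (sv_product e0 (zero_at r c0) w,
                                   sv_product e1 (zero_at r c1) w)) @^-1` B))%E.
  by move=> mA mB; apply: sv_product_indep => //; rewrite /zero_at eqxx.
have := joint_tail_shift (sv_product_measurable _ e0_meas) (sv_product_measurable _ e1_meas)
  indep c0r c1r xi_gt0 xi_shift (m := m) s0 t0.
have E s' t' : joint_tail (xi r) (sv_product e0 (zero_at r c0)) (sv_product e1 (zero_at r c1))
    (c0 r) (c1 r) s' t' = sv_joint s' t' by apply/funext => x; rewrite (sv_joint_drop r).
by rewrite !E; apply.
Qed.

Lemma sv_joint_limit_two i j (ki kj y0 y1 s t : R) : i != j -> 0 < ki -> 0 < kj ->
  c0 i * ki + c0 j * kj = 1 -> c1 i * ki + c1 j * kj = 1 ->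
  0 < y0 -> 0 < y1 -> y0 * c0 i + y1 * c1 i = 1 -> y0 * c0 j + y1 * c1 j = 1 ->
  (forall k, k != i -> k != j -> y0 * c0 k + y1 * c1 k < 1) ->
  c0 i * c1 j - c0 j * c1 i != 0 -> ki + kj < Q -> 0 < s -> 0 < t ->
  sv_joint s t x / sv_joint 1 1 x @[x --> +oo] --> expR (- (y0 * ln s + y1 * ln t)).
Proof.
move=> ij ki0 kj0 k0 k1 y00 y10 yi yj yo det kQ s0 t0.
have k0' : c0 j * kj + c0 i * ki = 1 by rewrite addrC.
have k1' : c1 j * kj + c1 i * ki = 1 by rewrite addrC.
have det' : c0 j * c1 i - c0 i * c1 j != 0 by rewrite -oppr_eq0 opprB.
have kQ' : kj + ki < Q by rewrite addrC.
have yo' k : k != j -> k != i -> y0 * c0 k + y1 * c1 k < 1 by move=> ? ?; exact: yo.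
have ji : j != i by rewrite eq_sym.
set D := c0 i * c1 j - c0 j * c1 i in det.
(* The shifts [mi] along [i] and [mj] along [j] solve [c0 i * mi + c0 j * mj = ln s] and
   [c1 i * mi + c1 j * mj = ln t]. Pairing these equations with the dual weights turns the limit
   [expR (- (mi + mj))] into the stated one. *)
pose mi := (ln s * c1 j - ln t * c0 j) / D.
pose mj := (c0 i * ln t - c1 i * ln s) / D.
pose s' := 1 * expR (c0 i * mi); pose t' := 1 * expR (c1 i * mi).
have s'0 : 0 < s' by rewrite /s' mul1r expR_gt0.
have t'0 : 0 < t' by rewrite /t' mul1r expR_gt0.
have sE : s = s' * expR (c0 j * mj).
  rewrite /s' mul1r -expRD (_ : _ + _ = ln s) ?lnK//.
  by rewrite /mi /mj /D; field.
have tE : t = t' * expR (c1 j * mj).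
  rewrite /t' mul1r -expRD (_ : _ + _ = ln t) ?lnK//.
  by rewrite /mi /mj /D; field.
have pos a b : 0 < a -> 0 < b -> \forall x \near +oo, 0 < sv_joint a b x.
  by move=> a0 b0; exact: (sv_joint_gt0 ij ki0 kj0 k0 k1).
have L1 : sv_joint s' t' x / sv_joint 1 1 x @[x --> +oo] --> expR (- mi).
  apply: sv_shift => //; last exact: pos.
  by move=> C C0; apply: (sv_negligible ji kj0 ki0 k0' k1' y00 y10 yj yi yo' det' kQ').
have L2 : sv_joint s t x / sv_joint s' t' x @[x --> +oo] --> expR (- mj).
  rewrite {1}sE {1}tE; apply: sv_shift => //; last exact: pos.
  by move=> C C0; apply: (sv_negligible ij ki0 kj0 k0 k1 y00 y10 yi yj yo det kQ).
have -> : expR (- (y0 * ln s + y1 * ln t)) = expR (- mj) * expR (- mi).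
  rewrite -expRD; congr expR.
  rewrite {1}sE {1}tE /s' /t' !mul1r -!expRD !expRK.
  transitivity (- (mi * (y0 * c0 i + y1 * c1 i) + mj * (y0 * c0 j + y1 * c1 j))); first by ring.
  by rewrite yi yj !mulr1 opprD addrC.
have : sv_joint s t x / sv_joint s' t' x * (sv_joint s' t' x / sv_joint 1 1 x)
    @[x --> +oo] --> expR (- mj) * expR (- mi) by exact: cvgM.
apply: cvg_near_eq; near=> x.
have : 0 < sv_joint s' t' x by near: x; exact: pos.
by move=> /lt0r_neq0 h0; rewrite mulrA divfK.
Unshelve. all: by end_near. Qed.

(** * A common leading coefficient *)

Section one_index.
Variables (i : nat) (a y0 y1 : R).
Hypotheses (a0 : 0 < a) (c0i : c0 i = a) (c1i : c1 i = a).
Hypotheses (y00 : 0 < y0) (y10 : 0 < y1) (sum_y : y0 + y1 = 1 / a).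
Hypothesis y_other : forall k, k != i -> y0 * c0 k + y1 * c1 k < 1.
Hypothesis aQ : 1 / a < Q.
Let V0 := sv_product e0 (zero_at i c0).
Let V1 := sv_product e1 (zero_at i c1).

Definition min_product (s t : R) (w : T) : R := Num.min (s^-1 * V0 w) (t^-1 * V1 w).

Let mV0 : measurable_fun setT V0.
Proof. exact: sv_product_measurable. Qed.

Let mV1 : measurable_fun setT V1.
Proof. exact: sv_product_measurable. Qed.

Lemma min_product_measurable s t : measurable_fun setT (min_product s t).
Proof. by apply: measurable_minr; apply: measurable_funM. Qed.

Lemma exp_series_ge0 (c : nat -> R) w : 0 <= exp_series eta h c w.
Proof.
rewrite /exp_series; have [cv|ncv] := pselect (cvgn (fun n => exp_prod eta h c n w)).
  by apply: limr_ge => //; apply: nearW => n; rewrite ltW// exp_prod_gt0.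
by rewrite dvgP.
Qed.

Lemma sv_product_ge0 e c w : (forall w, 0 <= e w) -> 0 <= sv_product e c w.
Proof. by move=> e_ge0; rewrite mulr_ge0// exp_series_ge0. Qed.

Lemma min_product_ge0 s t w : 0 < s -> 0 < t -> 0 <= min_product s t w.
Proof.
move=> s0 t0; rewrite le_min; apply/andP; split; apply: mulr_ge0;
  by [rewrite invr_ge0 ltW|exact: sv_product_ge0].
Qed.

(** A minimum to the power [q0 + q1] is at most the product of its entries to the powers [q0] and
    [q1]. Splitting the order by the dual weights matters: a moment of order [1 / a] of one entry
    alone may be infinite, since single coefficients can exceed [a]. *)
Lemma min_product_moment (f s t : R) : 0 < s -> 0 < t -> 0 < 1 + f ->
  (1 + f) * y0 <= Q -> (1 + f) * y1 <= Q ->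
  (exists2 rho : R, 0 < rho < 1 &
    forall k, k != i -> (1 + f) * (y0 * c0 k + y1 * c1 k) <= rho) ->
  (\int[P]_w (min_product s t w `^ ((1 + f) / a))%:E < +oo)%E.
Proof.
move=> s0 t0 f0 fQ0 fQ1 [rho rho01 rhoP].
pose q0 := (1 + f) * y0; pose q1 := (1 + f) * y1.
have q00 : 0 < q0 by rewrite mulr_gt0.
have q10 : 0 < q1 by rewrite mulr_gt0.
have sum_q : (1 + f) / a = q0 + q1 by rewrite -mulrDr sum_y div1r.
have mom : (\int[P]_w (V0 w `^ q0 * V1 w `^ q1)%:E < +oo)%E.
  apply: (sv_moment rho01); rewrite ?(ltW q00) ?(ltW q10)//.
  by move=> k /rhoP; rewrite mulrDr !mulrA.
have mV : measurable_fun setT (fun w => (V0 w `^ q0 * V1 w `^ q1)%:E).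
  by apply/measurable_EFinP; apply: measurable_funM; exact: (measurableT_comp (measurable_powR _)).
pose k := s^-1 `^ q0 * t^-1 `^ q1.
apply: (@le_lt_trans _ _ (\int[P]_w (k%:E * (V0 w `^ q0 * V1 w `^ q1)%:E))%E).
  apply: ge0_le_integral => //.
  - by move=> w _; rewrite lee_fin powR_ge0.
  - apply/measurable_EFinP; apply: (measurableT_comp (measurable_powR _)).
    exact: min_product_measurable.
  - by apply: emeasurable_funM.
  move=> w _; rewrite -EFinM lee_fin sum_q powRD; last first.
    by rewrite gt_eqF// addr_gt0.
  have V0w : 0 <= V0 w by exact: sv_product_ge0.
  have V1w : 0 <= V1 w by exact: sv_product_ge0.
  rewrite /k mulrACA -!powRM ?invr_ge0 ?(ltW s0) ?(ltW t0)//.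
  have m0 := min_product_ge0 w s0 t0.
  apply: ler_pM; rewrite ?powR_ge0//; apply: ge0_ler_powR; rewrite ?nnegrE ?(ltW q00) ?(ltW q10)//.
  - by rewrite mulr_ge0// invr_ge0 ltW.
  - by rewrite ge_min lexx.
  - by rewrite mulr_ge0// invr_ge0 ltW.
  - by rewrite ge_min lexx orbT.
rewrite ge0_integralZl//; last 2 first.
- by move=> w _; rewrite lee_fin mulr_ge0 ?powR_ge0.
- by rewrite lee_fin mulr_ge0 ?powR_ge0.
rewrite lte_mul_pinfty ?lee_fin ?mulr_ge0 ?powR_ge0//.
Qed.

Lemma min_product_tail (s t x : R) : 0 < s -> 0 < t -> 0 < x ->
  sv_joint s t x = fine (P [set w | x < min_product s t w * expR (a * xi i w)]).
Proof.
move=> s0 t0 x0; rewrite (sv_joint_drop i) c0i c1i; congr (fine (P _)).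
apply/seteqP; split => w /=; rewrite /min_product minr_pMl ?expR_ge0// lt_min.
  move=> [h0 h1]; apply/andP; split.
    by rewrite -mulrA ltr_pdivlMl.
  by rewrite -mulrA ltr_pdivlMl.
by move=> /andP[]; rewrite -!mulrA !ltr_pdivlMl.
Qed.

Lemma min_product_limit (s t : R) : 0 < s -> 0 < t ->
  [/\ (\int[P]_w (min_product s t w `^ (1 / a))%:E < +oo)%E,
    0 < fine (\int[P]_w (min_product s t w `^ (1 / a))%:E) &
    sv_joint s t x / F (ln x / a) @[x --> +oo] -->
      fine (\int[P]_w (min_product s t w `^ (1 / a))%:E)].
Proof.
move=> s0 t0.
have yc0 : y0 * c0 n + y1 * c1 n @[n --> \oo] --> (0 : R).
  have : y0 * c0 n + y1 * c1 n @[n --> \oo] --> y0 * 0 + y1 * 0.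
    by apply: cvgD; apply: cvgM => //; exact: cvg_cst.
  by rewrite !mulr0 addr0.
have [|rho0 rho001 rho0P] := @uniform_gap R _ [pred k | k == i] yc0.
  by move=> k /=; exact: y_other.
have /andP[rho00 rho01] := rho001.
have yQ0 : y0 < Q by apply: lt_trans aQ; rewrite -sum_y ltrDl.
have yQ1 : y1 < Q by apply: lt_trans aQ; rewrite -sum_y ltrDr.
(* Strictness leaves room to scale the dual weights by [1 + f] and [1 - f], staying below [Q] and
   with combined coefficients below 1; this gives the two moments around order [1 / a] that
   Breiman's lemma asks for. *)
have [f [f0 f1 fy0 fy1 frho]] : exists f : R,
   [/\ 0 < f, f * 2 <= 1, f * y0 <= Q - y0, f * y1 <= Q - y1 & f * rho0 <= (1 - rho0) / 2].
  near (0 : R)^'+ => f; exists f; split.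
  - by near: f; exact: nbhs_right_gt.
  - by near: f; exact: small_near.
  - by near: f; apply: small_near; rewrite subr_gt0.
  - by near: f; apply: small_near; rewrite subr_gt0.
  - by near: f; apply: small_near; rewrite divr_gt0// subr_gt0.
have gap g : g <= f -> exists2 rho : R, 0 < rho < 1 &
    forall k, k != i -> (1 + g) * (y0 * c0 k + y1 * c1 k) <= rho.
  move=> gf; exists ((1 + rho0) / 2); first by lra.
  move=> k nk; have := rho0P k nk.
  have /andP[k0 _] := c0_01 k; have /andP[k1 _] := c1_01 k.
  have : 0 <= y0 * c0 k + y1 * c1 k by rewrite addr_ge0// mulr_ge0// ltW.
  by set b := _ + _ => b0 br; nra.
have mom g : - f <= g <= f -> (\int[P]_w (min_product s t w `^ ((1 + g) / a))%:E < +oo)%E.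
  move=> /andP[fg gf].
  have g0 : g * y0 <= f * y0 by rewrite ler_pM2r.
  have g1 : g * y1 <= f * y1 by rewrite ler_pM2r.
  by apply: min_product_moment => //; [lra|rewrite mulrDl mul1r; lra|rewrite mulrDl mul1r; lra|exact: gap].
have mom0 : (\int[P]_w (min_product s t w `^ (1 / a))%:E < +oo)%E.
  by have := mom 0; rewrite addr0; apply; lra.
have mm : measurable_fun setT (min_product s t) := min_product_measurable s t.
split => //.
  have [v v0 Pv] := sv_product_pos (convergent_zero_at i c0_cvg) (convergent_zero_at i c1_cvg).
  pose m := Num.min (s^-1 * v) (t^-1 * v).
  have m0 : 0 < m by rewrite lt_min !mulr_gt0 ?invr_gt0.
  rewrite fine_gt0// mom0 andbT.
  have mS : measurable [set w | v < V0 w /\ v < V1 w] by exact: measurable_above.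
  apply: (@lt_le_trans _ _ (\int[P]_w ((m `^ (1 / a))%:E * (\1_[set w | v < V0 w /\ v < V1 w] w)%:E))%E).
    rewrite ge0_integralZl//; last 2 first.
    - exact/measurable_EFinP/measurable_indic.
    - by rewrite lee_fin powR_ge0.
    rewrite -integral_indicT// mule_gt0 ?lte_fin ?powR_gt0//.
    by move: Pv; apply: contraTT; rewrite -!leNgt => ?; apply: fine_le0.
  apply: ge0_le_integral => //.
  - by move=> w _; rewrite -EFinM lee_fin mulr_ge0// powR_ge0.
  - by apply: emeasurable_funM => //; exact/measurable_EFinP/measurable_indic.
  - by apply/measurable_EFinP; exact: (measurableT_comp (measurable_powR _)).
  move=> w _; rewrite -EFinM lee_fin indicE.
  have [|_] := boolP (w \in [set w | v < V0 w /\ v < V1 w]); last first.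
    by rewrite mulr0 powR_ge0.
  rewrite inE /= mulr1 => -[v0w v1w].
  apply: ge0_ler_powR; rewrite ?nnegrE ?(ltW m0)//.
  - by rewrite divr_ge0// ltW.
  - exact: min_product_ge0.
  rewrite le_min; apply/andP; split; rewrite ge_min; apply/orP; [left|right];
    by rewrite ler_pM2l ?invr_gt0// ltW.
have tail z : fine (P [set w | z < xi i w]) = F z by exact: tail_noise.
have xi_gt0 z : 0 < fine (P [set w | z < xi i w]) by rewrite tail.
have xi_shift m' : fine (P [set w | z + m' < xi i w]) / fine (P [set w | z < xi i w])
    @[z --> +oo] --> expR (- m').
  by under eq_fun do rewrite !tail; exact: F_shift.
have indep (A B : set R) : measurable A -> measurable B ->
    P (xi i @^-1` A `&` min_product s t @^-1` B) =
    (P (xi i @^-1` A) * P (min_product s t @^-1` B))%E.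
  move=> mA mB; apply: (eta_indep_others eta_indep eta_eps) => //.
  have m0 (e : T -> R) c : eps_measurable eta eps e ->
      measurable_fun [set: g_sigma_algebraType (others eta eps (h%:Z - i%:Z))] (sv_product e (zero_at i c)).
    by move=> me; apply: measurable_funM => //; apply: exp_series_others; rewrite /zero_at eqxx.
  by apply: measurable_minr; apply: measurable_funM => //; exact: m0.
have f01 : 0 < f < 1 by apply/andP; split => //; lra.
have up := mom f ltac:(by apply/andP; split; lra).
have dn := mom (- f) ltac:(by apply/andP; split; lra).
have := breiman mm (fun w => min_product_ge0 w s0 t0) indep xi_gt0 xi_shift a0 f01 up dn.
apply: cvg_near_eq; near=> x.
by rewrite tail min_product_tail//; near: x; exact: nbhs_pinfty_gt.
Unshelve. all: by end_near. Qed.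

Lemma sv_joint_gt0_one (s t : R) : 0 < s -> 0 < t ->
  \forall x \near +oo, 0 < sv_joint s t x.
Proof.
move=> s0 t0; have [_ I0 L] := min_product_limit s0 t0.
apply: filterS (cvgr_gt _ L _ I0) => x.
by rewrite pmulr_lgt0// invr_gt0.
Qed.

Lemma sv_joint_limit_one (s t : R) : 0 < s -> 0 < t ->
  sv_joint s t x / sv_joint 1 1 x @[x --> +oo] -->
    fine (\int[P]_w (min_product s t w `^ (1 / a))%:E) /
    fine (\int[P]_w (min_product 1 1 w `^ (1 / a))%:E).
Proof.
move=> s0 t0; have [_ _ L] := min_product_limit s0 t0.
have [_ I1 L1] := min_product_limit ltr01 ltr01.
have : (sv_joint s t x / F (ln x / a)) / (sv_joint 1 1 x / F (ln x / a)) @[x --> +oo] -->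
    fine (\int[P]_w (min_product s t w `^ (1 / a))%:E) /
    fine (\int[P]_w (min_product 1 1 w `^ (1 / a))%:E).
  have Lv : (sv_joint 1 1 x / F (ln x / a))^-1 @[x --> +oo] -->
      (fine (\int[P]_w (min_product 1 1 w `^ (1 / a))%:E))^-1.
    exact: (cvgV (lt0r_neq0 I1) L1).
  exact: (cvgM L Lv).
apply: cvg_near_eq; near=> x.
have J0 : 0 < sv_joint 1 1 x by near: x; exact: sv_joint_gt0_one.
by rewrite invf_div mulrA divfK// lt0r_neq0.
Unshelve. all: by end_near. Qed.

End one_index.

End sv_pair.

(** * Regular variation *)

(* Kept opaque: the kernel would otherwise compute with [pickle] on tuples of
   rationals. *)
Lemma count_enum (Q : countType) : exists f : nat -> option Q, forall q, exists k, f k = Some q.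
Proof. by exists unpickle => q; exists (pickle q); rewrite pickleK. Qed.

(** * Quadrants, rectangles and the Borel sets they generate *)

Section quadrants.
Variable R : realType.
Implicit Types (s t : R) (A B O : set (R * R)).

Definition quadrant s t : set (R * R) := [set z | s < z.1 /\ t < z.2].

Definition half_open a b c d : set (R * R) :=
  [set z : R * R | a < z.1 <= b /\ c < z.2 <= d].

Definition half_open_rectangle A :=
  exists a b c d, [/\ 0 < a, 0 < c & A = half_open a b c d].

Lemma quadrantE s t : quadrant s t = `]s, +oo[%classic `*` `]t, +oo[%classic.
Proof. by apply/seteqP; split => z /=; rewrite !in_itv/= !andbT. Qed.

Lemma quadrant_measurable s t : measurable (quadrant s t).
Proof. by rewrite quadrantE; apply: measurableX; exact: measurable_itv. Qed.

Lemma quadrantI s t s' t' :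
  quadrant s t `&` quadrant s' t' = quadrant (Num.max s s') (Num.max t t').
Proof.
by apply/seteqP; split => z /=; rewrite /quadrant/= !gt_max;
  [move=> [[-> ->] [-> ->]]|move=> [/andP[-> ->] /andP[-> ->]]].
Qed.

Lemma E2_quadrant : @E2 R = quadrant 0 0. Proof. by []. Qed.

(** Only differences with a subset are used, as these are what additivity handles. The maxima keep
    the quadrants nested when the rectangle is empty. *)
Lemma half_openE a b c d : half_open a b c d =
  (quadrant a c `\` quadrant (Num.max a b) c) `\`
  (quadrant a (Num.max c d) `\` quadrant (Num.max a b) (Num.max c d)).
Proof.
apply/seteqP; split => z /=; rewrite /quadrant /half_open /=.
  move=> [/andP[az zb] /andP[cz zd]]; split.
    by split => // -[]; rewrite gt_max (le_gtF zb) andbF.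
  by move=> [[_]]; rewrite gt_max (le_gtF zd) andbF.
move=> [[[az cz]]]; rewrite !gt_max az cz /= => /not_andP[|//] /negP.
rewrite -leNgt => zb nd; split => //; rewrite leNgt; apply/negP => dz.
by apply: nd; split => // -[]; rewrite ltNge zb.
Qed.

Lemma half_open_rectangleI A B : half_open_rectangle A -> half_open_rectangle B ->
  half_open_rectangle (A `&` B).
Proof.
move=> [a [b [c [d [a0 c0 ->]]]]] [a' [b' [c' [d' [a0' c0' ->]]]]].
exists (Num.max a a'), (Num.min b b'), (Num.max c c'), (Num.min d d'); split.
- by rewrite lt_max a0.
- by rewrite lt_max c0.
apply/seteqP; split => z; rewrite /half_open /= !gt_max !le_min.
  by move=> [[/andP[-> ->] /andP[-> ->]] [/andP[-> ->] /andP[-> ->]]].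
by move=> [/andP[/andP[-> ->] /andP[-> ->]] /andP[/andP[-> ->] /andP[-> ->]]].
Qed.

Lemma open_bigcup_half_open O : open O -> O `<=` @E2 R ->
  exists2 A : nat -> set (R * R), (forall k, half_open_rectangle (A k)) &
    O = \bigcup_k A k.
Proof.
move=> oO OE.
pose box (q : rat * rat * rat * rat) : set (R * R) :=
  half_open (ratr q.1.1.1) (ratr q.1.1.2) (ratr q.1.2) (ratr q.2).
pose good (q : rat * rat * rat * rat) :=
  [/\ (0 : R) < ratr q.1.1.1, (0 : R) < ratr q.1.2 & box q `<=` O].
have [f fP] := count_enum (rat * rat * rat * rat)%type.
(* Codes that do not describe a rectangle inside [O] are sent to an empty rectangle, so that the
   family is indexed by all of [nat]. *)
pose A k := if f k is Some q then
  if `[< good q >] then box q else half_open 1 1 1 1 else half_open 1 1 1 1.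
have empty : half_open 1 1 1 1 = set0.
  by apply/seteqP; split => // z [/andP[/lt_le_trans/[apply]]]; rewrite ltxx.
have emptyP : half_open_rectangle (half_open 1 1 1 1) by exists 1, 1, 1, 1.
exists A.
  move=> k; rewrite /A; case: (f k) => [q|//]; case: asboolP => [[q0 q1 _]|//].
  by do 4!eexists; split; last reflexivity.
apply/seteqP; split => [z Oz|z [k _]]; last first.
  rewrite /A; case: (f k) => [q|]; last by rewrite empty.
  by case: asboolP => [[_ _]|_]; [apply|rewrite empty].
have [e /= e0 eO] : exists2 e : R, 0 < e & ball z e `<=` O.
  by apply/nbhs_ballP; exact: open_nbhs_nbhs.
have [z10 z20] : 0 < z.1 /\ 0 < z.2 by exact: OE.
have [a /[!in_itv]/= /andP[a0 a1]] := @rat_in_itvoo R (Num.max 0 (z.1 - e)) z.1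
  ltac:(by rewrite gt_max z10 /=; lra).
have [b /[!in_itv]/= /andP[b0 b1]] := @rat_in_itvoo R z.1 (z.1 + e) ltac:(by lra).
have [c /[!in_itv]/= /andP[c0 c1]] := @rat_in_itvoo R (Num.max 0 (z.2 - e)) z.2
  ltac:(by rewrite gt_max z20 /=; lra).
have [d /[!in_itv]/= /andP[d0 d1]] := @rat_in_itvoo R z.2 (z.2 + e) ltac:(by lra).
move: a0 c0; rewrite !gt_max => /andP[a00 a0] /andP[c00 c0].
have abcd : good (a, b, c, d).
  split => //= y [/= /andP[ay yb] /andP[cy yd]]; apply: eO.
  by split; rewrite /ball/= ltr_norml; apply/andP; split; lra.
have [k fk] := fP (a, b, c, d).
exists k => //; rewrite /A fk; case: asboolP => [_|//].
by split => /=; apply/andP; split => //; exact: ltW.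
Qed.

Lemma quadrant_sigma_algebra :
  @measurable _ (R * R)%type =
    <<s [set quadrant st.1 st.2 | st in [set: R * R]] >>.
Proof.
set Q := [set _ | _ in _].
apply/seteqP; split; last first.
  apply: smallest_sub; first exact: sigma_algebra_measurable.
  by move=> _ [st _ <-]; exact: quadrant_measurable.
have gQ s t : <<s Q >> (quadrant s t).
  by apply: sub_sigma_algebra; exists (s, t).
apply: smallest_sub; first exact: smallest_sigma_algebra.
have bound (y : R) : exists n : nat, - n%:R < y.
  exists (Num.bound `|y|); rewrite ltrNl; apply: le_lt_trans (archi_boundP (normr_ge0 y)).
  by rewrite -normrN ler_norm.
have m1 : measurable_fun [set: g_sigma_algebraType Q] (fst : g_sigma_algebraType Q -> R).
  apply: (measurability _ (RGenOInfty.measurableE R)) => _ [_ [x ->] <-].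
  have -> : [set: g_sigma_algebraType Q] `&` fst @^-1` `]x, +oo[ = \bigcup_n quadrant x (- n%:R).
    apply/seteqP; split => [z /= [_]|z [n _] [xz _]]; rewrite /= ?in_itv/= ?andbT => //.
    by move=> xz; have [n nz] := bound z.2; exists n.
  by apply: bigcupT_measurable => n; exact: gQ.
have m2 : measurable_fun [set: g_sigma_algebraType Q] (snd : g_sigma_algebraType Q -> R).
  apply: (measurability _ (RGenOInfty.measurableE R)) => _ [_ [x ->] <-].
  have -> : [set: g_sigma_algebraType Q] `&` snd @^-1` `]x, +oo[ = \bigcup_n quadrant (- n%:R) x.
    apply/seteqP; split => [z /= [_]|z [n _] [_ xz]]; rewrite /= ?in_itv/= ?andbT => //.
    by move=> xz; have [n nz] := bound z.1; exists n.
  by apply: bigcupT_measurable => n; exact: gQ.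
by move=> _ [[B mB <-]|[B mB <-]]; [exact: m1|exact: m2].
Qed.

End quadrants.

(** * From quadrants to sets with null boundary *)

Section portmanteau.
Variables (R : realType) (nu : {measure set (R * R) -> \bar R}) (L : R -> set (R * R) -> R).
Implicit Types (A B O : set (R * R)).
Hypothesis L_ge0 : forall x A, 0 <= L x A.
Hypothesis L_setU : forall x A B, measurable A -> measurable B -> A `&` B = set0 ->
  L x (A `|` B) = L x A + L x B.
Hypothesis quadrant_fin : forall s t, 0 < s -> 0 < t -> (nu (quadrant s t) < +oo)%E.
Hypothesis quadrant_cvg : forall s t, 0 < s -> 0 < t ->
  L x (quadrant s t) @[x --> +oo] --> fine (nu (quadrant s t)).

Definition law_cvg A :=
  [/\ measurable A, (nu A < +oo)%E & L x A @[x --> +oo] --> fine (nu A)].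

Lemma L_setD x A B : measurable A -> measurable B -> B `<=` A ->
  L x (A `\` B) = L x A - L x B.
Proof.
move=> mA mB BA; have {2}-> : A = A `\` B `|` B by rewrite setDKU.
rewrite L_setU//; [by rewrite addrK|exact: measurableD|].
by rewrite setIC setDIK.
Qed.

Lemma L_le x A B : measurable A -> measurable B -> A `<=` B -> L x A <= L x B.
Proof. by move=> mA mB AB; rewrite -subr_ge0 -L_setD. Qed.

Lemma law_cvgD A B : law_cvg A -> law_cvg B -> B `<=` A -> law_cvg (A `\` B).
Proof.
move=> [mA Aoo LA] [mB Boo LB] BA; split; first exact: measurableD.
  by apply: le_lt_trans Aoo; rewrite le_measure ?inE//; exact: measurableD.
rewrite measureD// (setIidr BA) fineB; last 2 first.
  by rewrite ge0_fin_numE.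
  by rewrite ge0_fin_numE.
have : L x A - L x B @[x --> +oo] --> fine (nu A) - fine (nu B) by exact: cvgB.
by apply: cvg_near_eq; near=> x; rewrite L_setD.
Unshelve. all: by end_near. Qed.

Lemma law_cvgU A B : law_cvg A -> law_cvg B -> A `&` B = set0 -> law_cvg (A `|` B).
Proof.
move=> [mA Aoo LA] [mB Boo LB] AB.
have nuE : nu (A `|` B) = (nu A + nu B)%E by exact: measureU.
split; first exact: measurableU.
  by rewrite nuE lte_add_pinfty.
rewrite nuE fineD; last 2 first.
  by rewrite ge0_fin_numE.
  by rewrite ge0_fin_numE.
have : L x A + L x B @[x --> +oo] --> fine (nu A) + fine (nu B) by exact: cvgD.
by apply: cvg_near_eq; near=> x; rewrite L_setU.
Unshelve. all: by end_near. Qed.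

Lemma law_cvg_quadrant s t : 0 < s -> 0 < t -> law_cvg (quadrant s t).
Proof.
by move=> s0 t0; split; [exact: quadrant_measurable|exact: quadrant_fin|exact: quadrant_cvg].
Qed.

Lemma law_cvg_half_open A : half_open_rectangle A -> law_cvg A.
Proof.
move=> [a [b [c [d [a0 c0 ->]]]]]; rewrite half_openE.
have ab0 : 0 < Num.max a b by rewrite lt_max a0.
have cd0 : 0 < Num.max c d by rewrite lt_max c0.
apply: law_cvgD; [apply: law_cvgD|apply: law_cvgD|]; try exact: law_cvg_quadrant.
- by move=> z [/=]; rewrite gt_max => /andP[].
- by move=> z [/=]; rewrite gt_max => /andP[].
move=> z [[/= az]]; rewrite gt_max => /andP[cz dz] nz; split; first by split.
by move=> [abz _]; apply: nz; split => //=; rewrite gt_max cz dz.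
Qed.

Lemma law_cvg_bigsetU n (A : nat -> set (R * R)) :
  (forall k, half_open_rectangle (A k)) -> law_cvg (\big[setU/set0]_(k < n) A k).
Proof.
elim: n A => [|n IH] A rA.
  rewrite big_ord0; have := law_cvgD (law_cvg_half_open (rA 0%N)) (law_cvg_half_open (rA 0%N)).
  by rewrite setDv; apply.
rewrite big_ord_recr/=; set U := \big[setU/set0]_(k < n) A k.
(* The overlap of [U] with [A n] is a union of the [n] rectangles [A k]&[A n]; the induction is over
   all families for this reason. *)
have -> : U `|` A n = (A n `\` (U `&` A n)) `|` U.
  apply/seteqP; split => z; last by move=> [[]|]; [right|left].
  by move=> [Uz|Az]; [right|have [Uz|Uz] := pselect (U z); [right|left; split => // -[]]].
apply: law_cvgU; last by apply/seteqP; split => // z [[Az nUA] Uz]; exact: nUA.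
  apply: law_cvgD; [exact: law_cvg_half_open| |by move=> z []].
  rewrite /U big_distrl/=; apply: (IH (fun k => A k `&` A n)) => k.
  exact: half_open_rectangleI.
exact: IH.
Qed.

Lemma open_measurable O : open O -> O `<=` @E2 R -> measurable O.
Proof.
move=> oO OE; have [A rA ->] := open_bigcup_half_open oO OE.
by apply: bigcupT_measurable => k; have [] := law_cvg_half_open (rA k).
Qed.

(** Finite unions of rectangles fill [O] from inside, and monotonicity of [L x] then bounds the mass
    of [O] from below; nothing so far prevents excess mass near its boundary. *)
Lemma law_open_lower O (e : R) : open O -> O `<=` @E2 R -> (nu O < +oo)%E -> 0 < e ->
  \forall x \near +oo, fine (nu O) - e <= L x O.
Proof.
move=> oO OE Ooo e0; have mO := open_measurable oO OE.
have [A rA OA] := open_bigcup_half_open oO OE.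
pose U n := \big[setU/set0]_(k < n) A k.
have mU n : measurable (U n) by have [] := law_cvg_bigsetU n rA.
have UO : \bigcup_n U n = O.
  rewrite OA; apply/seteqP; split => z [n _].
    by rewrite /U -bigcup_mkord => -[k _ Az]; exists k.
  by move=> Az; exists n.+1 => //; rewrite /U -bigcup_mkord; exists n => /=.
have Ule n : U n `<=` O by rewrite -UO; exact: bigcup_sup.
have Uoo n : nu (U n) \is a fin_num.
  by rewrite ge0_fin_numE// (le_lt_trans _ Ooo)// le_measure ?inE.
have nuU : fine (nu (U n)) @[n --> \oo] --> fine (nu O).
  have : (nu \o U) n @[n --> \oo] --> nu (\bigcup_n U n).
    apply: nondecreasing_cvg_mu => //; first by rewrite UO.
    move=> m n mn; apply/subsetPset; rewrite /U -!bigcup_mkord.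
    by move=> z [k /= km Az]; exists k => //=; exact: leq_trans mn.
  rewrite UO -[X in _ --> X]fineK ?ge0_fin_numE//; exact: (@fine_cvg).
have e20 : 0 < e / 2 by rewrite divr_gt0.
have [n _ /(_ n (leqnn n)) /= Un] : \forall n \near \oo, fine (nu O) - e / 2 < fine (nu (U n)).
  by apply: (cvgr_gt _ nuU); rewrite ltrBlDr ltrDl.
have [_ _ LU] := law_cvg_bigsetU n rA.
have : \forall x \near +oo, fine (nu (U n)) - e / 2 < L x (U n).
  by apply: (cvgr_gt _ LU); rewrite ltrBlDr ltrDl.
apply: filterS => x LUx; have := L_le x (mU n) mO (Ule n).
by move: LUx Un => /=; lra.
Qed.

(** The lower bound comes from the interior of [B]. For the upper bound, [B] lies in a quadrant [U]
    of finite limit mass, because it stays away from the axes, and the lower bound is applied to the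
    open set [U] minus the closure of [B]. *)
Lemma portmanteau B : measurable B -> B `<=` @E2 R ->
  bounded_away B (boundary (@E2 R)) -> nu (boundary B) = 0%E ->
  (nu B < +oo)%E /\ L x B @[x --> +oo] --> fine (nu B).
Proof.
move=> mB BE [r r0 far] nuB.
pose C := [set z : R * R | r <= z.1 /\ r <= z.2].
have openQ (s t : R) : open (quadrant s t).
  apply: (@openI _ (fst @^-1` [set u | s < u]) (snd @^-1` [set u | t < u])).
    by apply: open_comp; [move=> z _; exact: cvg_fst|exact: open_gt].
  by apply: open_comp; [move=> z _; exact: cvg_snd|exact: open_gt].
have bndE2 z : 0 <= z.1 -> 0 <= z.2 -> ~ E2 z -> boundary (@E2 R) z.
  move=> z1 z2 nz; split; last by move=> /interior_subset.
  move=> V /nbhs_ballP[e /= e0 eV]; have e2 : 0 < e / 2 by rewrite divr_gt0.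
  exists (z.1 + e / 2, z.2 + e / 2); split.
    by split => /=; rewrite ltr_wpDl.
  apply: eV; split; rewrite /ball/= opprD addNKr normrN gtr0_norm//; lra.
have BC : B `<=` C.
  (* A point of [B] with a coordinate below [r] would be within [r] of its projection to an axis,
     which lies in the boundary of the quadrant. *)
  move=> b Bb; have [b1 b2] := BE _ Bb; split; rewrite leNgt; apply/negP => br.
    apply: (far b (0, b.2) Bb).
      by apply: bndE2 => //=; [exact: ltW|case=> /=; rewrite ltxx].
    by split; rewrite /ball/= ?subr0 ?subrr ?normr0// gtr0_norm.
  apply: (far b (b.1, 0) Bb).
    by apply: bndE2 => //=; [exact: ltW|case=> /=; rewrite ltxx].
  by split; rewrite /ball/= ?subr0 ?subrr ?normr0// gtr0_norm.
have cC : closed C.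
  apply: (@closedI _ (fst @^-1` [set u | r <= u]) (snd @^-1` [set u | r <= u])).
    by apply: closed_comp; [move=> z _; exact: cvg_fst|exact: closed_ge].
  by apply: closed_comp; [move=> z _; exact: cvg_snd|exact: closed_ge].
have clBC : closure B `<=` C.
  by have := closure_subset BC; rewrite -[closure C](proj1 (closure_id C) cC).
have r20 : 0 < r / 2 by rewrite divr_gt0.
pose U := quadrant (r / 2) (r / 2).
have CU : C `<=` U by move=> z [/= rz1 rz2]; split => /=; lra.
have UE : U `<=` @E2 R by move=> z [/= rz1 rz2]; split => /=; lra.
have [mU Uoo LU] := law_cvg_quadrant r20 r20.
pose O := U `\` closure B.
have oO : open O.
  rewrite /O setDE; apply: openI; first exact: openQ.
  by apply: closed_openC; exact: closed_closure.
have mO : measurable O by apply: open_measurable => // z [/UE].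
have BU : B `<=` U by move=> z /BC /CU.
have iE : B° `<=` @E2 R by move=> z /interior_subset /BE.
have mI : measurable B° by apply: open_measurable => //; exact: open_interior.
have clU : closure B `<=` U by move=> z /clBC /CU.
have clE : closure B = U `\` O by rewrite /O setDD setIidr.
have mcl : measurable (closure B) by rewrite clE; exact: measurableD.
have finU A : A `<=` U -> measurable A -> nu A \is a fin_num.
  by move=> AU mA; rewrite ge0_fin_numE// (le_lt_trans _ Uoo)// le_measure ?inE.
have nucl : nu (closure B) = nu B°.
  have -> : closure B = B° `|` boundary B.
    by rewrite /boundary setDUK// => z /interior_subset /subset_closure.
  have mbd : measurable (boundary B) by exact: measurableD.
  have nuU : nu (B° `|` boundary B) = (nu B° + nu (boundary B))%E.
    by apply: measureU => //; rewrite /boundary setDIK.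
  by rewrite nuU nuB adde0.
have nuBI : nu B = nu B°.
  apply/eqP; rewrite eq_le -{1}nucl; apply/andP; split; apply: le_measure; rewrite ?inE//.
    exact: subset_closure.
  exact: interior_subset.
have fO : fine (nu O) = fine (nu U) - fine (nu B).
  have -> : nu O = (nu U - nu (U `&` closure B))%E by exact: measureD.
  by rewrite (setIidr clU) nucl -nuBI fineB//; exact: finU.
split; first by rewrite -ge0_fin_numE//; exact: finU.
apply/cvgrPdist_le => e e0.
have e20 : 0 < e / 2 by rewrite divr_gt0.
near=> x.
have lowI : fine (nu B°) - e <= L x B°.
  near: x; apply: law_open_lower => //; first exact: open_interior.
  by rewrite -nuBI -ge0_fin_numE//; exact: finU.
have lowO : fine (nu O) - e / 2 <= L x O.
  near: x; apply: law_open_lower => //; first by move=> z [/UE].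
  by rewrite -ge0_fin_numE//; apply: finU => // z [].
have upU : L x U <= fine (nu U) + e / 2.
  near: x; apply: (cvgr_le _ LU); by rewrite ltrDl.
have LI := L_le x mI mB (@interior_subset _ B).
have LB : L x B <= L x U - L x O.
  rewrite -L_setD//; last by move=> z [].
  apply: L_le => //; first exact: measurableD.
  by rewrite -clE; exact: subset_closure.
rewrite ler_norml; apply/andP; split; rewrite -?nuBI in lowI; lra.
Unshelve. all: by end_near. Qed.

End portmanteau.

Definition image_measure d d' (T1 : measurableType d) (T2 : measurableType d')
    (R : realType) (m : {measure set T1 -> \bar R}) (f : T1 -> T2)
    (mf : measurable_fun setT f) : {measure set T2 -> \bar R} :=
  measure_function_pushforward__canonical__measure_function_Measure m mf.

Lemma quadrant_cover (R : realType) :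
  \bigcup_k quadrant (- k%:R) (- k%:R) = [set: R * R].
Proof.
apply/seteqP; split => // z _.
pose k := Num.bound (`|z.1| + `|z.2|).
have kz : `|z.1| + `|z.2| < k%:R by apply: archi_boundP; rewrite addr_ge0.
exists k => //; split => /=; rewrite ltrNl; apply: le_lt_trans kz.
  by rewrite -normrN (le_trans (ler_norm _))// lerDl.
by rewrite -(normrN z.2) (le_trans (ler_norm _))// lerDr.
Qed.

(** * Homogeneity on Borel sets *)

Section homogeneous_measure.
Variables (R : realType) (nu : {measure set (R * R) -> \bar R}) (p : R).
Hypothesis quadrant_fin : forall s t, 0 < s -> 0 < t -> (nu (quadrant s t) < +oo)%E.
Hypothesis quadrant_homogeneous : forall l s t, 0 < l -> 0 < s -> 0 < t ->
  nu (quadrant (l * s) (l * t)) = ((l `^ (- p))%:E * nu (quadrant s t))%E.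

Lemma dilateE l (B : set (R * R)) : 0 < l ->
  dilate l B = (fun z => (l^-1 * z.1, l^-1 * z.2)) @^-1` B.
Proof.
move=> l0; have ln : l != 0 by exact: lt0r_neq0.
apply/seteqP; split => [_ [z Bz <-]|z /= Bz] /=.
  by rewrite !mulKf//; case: z Bz.
by exists (l^-1 * z.1, l^-1 * z.2) => //=; rewrite !mulVKf//; case: z Bz.
Qed.

Lemma measurable_dilation l :
  measurable_fun setT (fun z : R * R => (l * z.1, l * z.2)).
Proof.
by apply: measurable_fun_pair; apply: measurable_funM.
Qed.

(** The measure may be infinite near the axes, so uniqueness from the pi-system of quadrants is
    applied to the restrictions to [quadrant (e n) (e n)], where both measures are finite; letting
    [n] grow exhausts [E2]. *)
Lemma measure_dilate l (B : set (R * R)) : 0 < l -> measurable B -> B `<=` @E2 R ->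
  nu (dilate l B) = ((l `^ (- p))%:E * nu B)%E.
Proof.
move=> l0 mB BE.
pose m1 := image_measure nu (measurable_dilation l^-1).
have lp0 : 0 <= l `^ (- p) by exact: powR_ge0.
pose m2 : {measure set (R * R) -> \bar R} := mscale (NngNum lp0) nu.
have m12 s t : 0 < s -> 0 < t -> m1 (quadrant s t) = m2 (quadrant s t).
  move=> s0 t0; rewrite /m2/= /mscale/= -quadrant_homogeneous//.
  congr (nu _); apply/seteqP; split => z /=; rewrite /quadrant /= !ltr_pdivlMl//.
pose e n : R := n.+1%:R^-1.
have e0 n : 0 < e n by rewrite /e invr_gt0.
have mE n : measurable (quadrant (e n) (e n)) by exact: quadrant_measurable.
have mono (m : {measure set (R * R) -> \bar R}) :
    m (B `&` quadrant (e n) (e n)) @[n --> \oo] --> m B.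
  have BU : B = \bigcup_n (B `&` quadrant (e n) (e n)).
    apply/seteqP; split => [z Bz|z [n _ []//]].
    have [z1 z2] := BE _ Bz.
    have z0 : 0 < Num.min z.1 z.2 by rewrite lt_min z1.
    have [n _ /(_ n (leqnn n)) /=] := near_infty_natSinv_lt (PosNum z0).
    by rewrite lt_min => /andP[zn1 zn2]; exists n.
  rewrite [in X in _ --> X]BU; apply: (@nondecreasing_cvg_mu _ _ _ m).
  - by move=> n; exact: measurableI.
  - by rewrite -BU.
  move=> k n kn; apply/subsetPset => z [Bz [/= z1 z2]].
  have en : e n <= e k by rewrite /e lef_pV2 ?posrE// ler_nat ltnS.
  by split => //; split; exact: le_lt_trans en _.
have agree n : m1 (B `&` quadrant (e n) (e n)) = m2 (B `&` quadrant (e n) (e n)).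
  pose r1 : {measure set (R * R) -> \bar R} := mrestr m1 (mE n).
  pose r2 : {measure set (R * R) -> \bar R} := mrestr m2 (mE n).
  have := @measure_unique _ R (R * R)%type _
    (fun k => quadrant (- k%:R) (- k%:R)) (quadrant_sigma_algebra R) _ _ _ r1 r2 _ _ B mB.
  apply.
  - move=> _ _ [st _ <-] [st' _ <-]; rewrite quadrantI.
    by exists (Num.max st.1 st'.1, Num.max st.2 st'.2).
  - by move=> k; exists (- k%:R, - k%:R).
  - exact: quadrant_cover.
  - move=> _ [st _ <-]; rewrite /r1 /r2 /= /mrestr quadrantI; apply: m12; by rewrite lt_max e0 orbT.
  move=> k; rewrite /r1 /= /mrestr quadrantI m12 ?lt_max ?e0 ?orbT//.
  rewrite /m2 /= /mscale /=; rewrite lte_mul_pinfty//; apply: quadrant_fin; by rewrite lt_max e0 orbT.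
have M1 : m1 (B `&` quadrant (e n) (e n)) @[n --> \oo] --> m2 B.
  by under eq_fun do rewrite agree; exact: (mono m2).
transitivity (m1 B); first by rewrite dilateE.
by rewrite -(cvg_lim _ (mono m1))// (cvg_lim _ M1).
Qed.

End homogeneous_measure.

Lemma regularly_varying_quadrants d (T : measurableType d) (R : realType)
    (P : probability T R) (Z1 Z2 : T -> R) (p : R) (G : R -> R -> R)
    (nu0 : {measure set (R * R) -> \bar R}) :
  measurable_fun setT Z1 -> measurable_fun setT Z2 -> 0 < p -> 0 < G 1 1 ->
  (forall s t, 0 < s -> 0 < t -> nu0 (quadrant s t) = (G s t)%:E) ->
  (forall l s t, 0 < l -> 0 < s -> 0 < t -> G (l * s) (l * t) = l `^ (- p) * G s t) ->
  (forall s t, 0 < s -> 0 < t -> joint_tail_ratio P Z1 Z2 s t x @[x --> +oo] --> G s t) ->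
  regularly_varying_E2 P Z1 Z2 p.
Proof.
move=> mZ1 mZ2 p0 G11 nu0G homG ratio; split => //.
have mE : measurable (@E2 R) by rewrite E2_quadrant; exact: quadrant_measurable.
(* The explicit image measures may charge the complement of [E2], because [inv_pow] vanishes on half
   a line. Restriction does not affect quadrants with positive corners. *)
pose nu : {measure set (R * R) -> \bar R} := mrestr nu0 mE.
have nuG s t : 0 < s -> 0 < t -> nu (quadrant s t) = (G s t)%:E.
  move=> s0 t0; rewrite /nu /= /mrestr E2_quadrant quadrantI.
  by rewrite (max_idPl (ltW s0)) (max_idPl (ltW t0)) nu0G.
have quadE x : [set z : R * R | (x < z.1)%R /\ (x < z.2)%R] = quadrant x x by [].
exists nu; split.
- by rewrite /nu /= /mrestr setICl measure0.
- apply: contraTneq G11 => nu0E; have := nuG 1 1 ltr01 ltr01.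
  have : (nu (quadrant 1 1) <= nu (@E2 R))%E.
    apply: le_measure; rewrite ?inE//; first exact: quadrant_measurable.
    by move=> z [/= z1 z2]; split; exact: lt_trans ltr01 _.
  by move=> + nuq; rewrite nuq nu0E lee_fin => /le_gtF ->.
- by move=> x x0; rewrite quadE nuG// ltry.
- move=> l B l0 mB BE; apply: measure_dilate => //.
    by move=> s t s0 t0; rewrite nuG// ltry.
  by move=> l' s t l'0 s0 t0; rewrite !nuG ?mulr_gt0// homG// EFinM.
move=> B mB BE far bnd.
pose L x A := fine (P [set w | A (x^-1 * Z1 w, x^-1 * Z2 w)]) /
   fine (P [set w | x < Num.min (Z1 w) (Z2 w)]).
have mA x (A : set (R * R)) : measurable A -> measurable [set w | A (x^-1 * Z1 w, x^-1 * Z2 w)].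
  move=> mA; rewrite -[X in measurable X]setTI.
  have : measurable_fun setT (fun w => (x^-1 * Z1 w, x^-1 * Z2 w)).
    by apply: measurable_fun_pair; apply: measurable_funM.
  by move=> /(_ measurableT A mA).
have L_ge0 x A : 0 <= L x A by rewrite divr_ge0// fine_ge0.
have L_setU x A A' : measurable A -> measurable A' -> A `&` A' = set0 ->
    L x (A `|` A') = L x A + L x A'.
  move=> mA1 mA2 AA; rewrite /L -mulrDl -fineD; last 2 first.
    by rewrite fin_num_measure//; exact: mA.
    by rewrite fin_num_measure//; exact: mA.
  congr (fine _ / _); rewrite -measureU//; [exact: mA|exact: mA|].
  apply/seteqP; split => // w [Aw A'w].
  by have : (A `&` A') (x^-1 * Z1 w, x^-1 * Z2 w) by []; rewrite AA.
have Lquad s t : 0 < s -> 0 < t -> L x (quadrant s t) @[x --> +oo] --> fine (nu (quadrant s t)).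
  move=> s0 t0; rewrite nuG//=; have := ratio s t s0 t0.
  apply: cvg_near_eq; near=> x; congr (fine (P _) / _).
  have x0 : 0 < x by near: x; exact: nbhs_pinfty_gt.
  by apply/seteqP; split => w /=; rewrite /quadrant/= !ltr_pdivlMl// ![x * _]mulrC.
have [|nuB LB] := portmanteau L_ge0 L_setU _ Lquad mB BE far bnd.
  by move=> s t s0 t0; rewrite nuG// ltry.
have : fine (P [set w | dilate x B (Z1 w, Z2 w)]) /
    fine (P [set w | x < Num.min (Z1 w) (Z2 w)]) @[x --> +oo] --> fine (nu B).
  move: LB; apply: cvg_near_eq; near=> x; congr (fine (P _) / _).
  by rewrite dilateE//; near: x; exact: nbhs_pinfty_gt.
rewrite -[X in _ -> _ --> X]fineK ?ge0_fin_numE// => LB'.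
by apply: (@cvg_EFin R R (pinfty_nbhs R) _ _ (fine (nu B))) => //; exact: nearW.
Unshelve. all: by end_near. Qed.

(** * Explicit limit measures *)

Section limit_measures.
Variable R : realType.
Local Notation leb := (@lebesgue_measure R).

Let J (b : R) : set R := `]0, b[%classic.

Let lebJ b : 0 <= b -> leb (J b) = b%:E.
Proof.
by rewrite le_eqVlt /J lebesgue_measure_itv/= lte_fin oppr0 adde0 => /orP[/eqP<-|->]//; rewrite ltxx.
Qed.

(* The generalized inverse of [s |-> s `^ (- y)]; as [0 `^ r = 0] for [r != 0],
   it vanishes on the negative half-line. *)
Definition inv_pow (y u : R) : R := Num.max u 0 `^ (- y^-1).

Lemma inv_pow_gt y s u : 0 < y -> 0 < s -> (s < inv_pow y u) = (0 < u < s `^ (- y)).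
Proof.
move=> y0 s0; rewrite /inv_pow; have [u0|u0] := leP u 0.
  by rewrite powR0 ?oppr_eq0 ?invr_eq0 ?gt_eqF//= ltNge ltW.
rewrite /= -[LHS]ltr_ln ?posrE ?powR_gt0// -[RHS]ltr_ln ?posrE ?powR_gt0// !ln_powR.
by rewrite !mulNr ltrNr ltr_pdivrMl// mulrN.
Qed.

Lemma inv_pow_measurable y : measurable_fun setT (inv_pow y).
Proof.
by apply: (measurableT_comp (measurable_powR _)); apply: measurable_maxr.
Qed.

(** The limit is a product of two power-law measures with tails [s ^ (- y0)] and [t ^ (- y1)]; each
    is the image of Lebesgue measure under the inverse of its tail. *)
Lemma product_quadrant_measure (y0 y1 : R) : 0 < y0 -> 0 < y1 ->
  exists nu : {measure set (R * R) -> \bar R}, forall s t, 0 < s -> 0 < t ->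
    nu (quadrant s t) = (expR (- (y0 * ln s + y1 * ln t)))%:E.
Proof.
move=> y00 y10.
have mf : measurable_fun setT (fun z : R * R => (inv_pow y0 z.1, inv_pow y1 z.2)).
  by apply: measurable_fun_pair;
    exact: (measurableT_comp (inv_pow_measurable _)).
exists (image_measure (leb \x leb)%E mf) => s t s0 t0.
have -> : image_measure (leb \x leb)%E mf (quadrant s t) =
    (leb \x leb)%E (J (s `^ (- y0)) `*` J (t `^ (- y1))).
  congr ((leb \x leb)%E _); apply/seteqP; split => z /=;
    by rewrite /quadrant/J/= !inv_pow_gt// !in_itv.
transitivity (leb (J (s `^ (- y0))) * leb (J (t `^ (- y1))))%E; first by apply: product_measure1E; exact: measurable_itv.
rewrite !lebJ ?powR_ge0// -EFinM /powR !gt_eqF// -expRD; congr (expR _)%:E; ring.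
Qed.

(** The image of [P] times a radial power law under multiplication: [g * (V0, V1)], where [g]
    exceeds [r] on a set of Lebesgue measure [r ^ (- q) / E]. The quadrant is reached when [g] times
    the minimum exceeds 1. *)
Lemma mixture_quadrant_measure d (T : measurableType d) (P : probability T R)
    (V0 V1 : T -> R) (q E : R) :
  measurable_fun setT V0 -> measurable_fun setT V1 ->
  (forall w, 0 <= V0 w) -> (forall w, 0 <= V1 w) -> 0 < q -> 0 < E ->
  (forall s t, 0 < s -> 0 < t ->
    (\int[P]_w (Num.min (s^-1 * V0 w) (t^-1 * V1 w) `^ q)%:E < +oo)%E) ->
  exists nu : {measure set (R * R) -> \bar R}, forall s t, 0 < s -> 0 < t ->
    nu (quadrant s t) =
      (fine (\int[P]_w (Num.min (s^-1 * V0 w) (t^-1 * V1 w) `^ q)%:E) / E)%:E.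
Proof.
move=> mV0 mV1 V0_ge0 V1_ge0 q0 E0 fin.
pose g (z : T * R) : R := inv_pow q (E * z.2).
have mg : measurable_fun setT g.
  apply: (measurableT_comp (inv_pow_measurable _)).
  exact: measurable_funM.
pose f (z : T * R) : R * R := (g z * V0 z.1, g z * V1 z.1).
have mf : measurable_fun setT f.
  by apply: measurable_fun_pair; apply: measurable_funM => //;
    exact: (measurableT_comp _ (@measurable_fst _ _ _ _)).
exists (image_measure (P \x leb)%E mf) => s t s0 t0.
have -> : image_measure (P \x leb)%E mf (quadrant s t) =
   (\int[P]_w leb (xsection (f @^-1` quadrant s t) w))%E.
  by [].
pose m w := Num.min (s^-1 * V0 w) (t^-1 * V1 w).
have m_ge0 w : 0 <= m w by rewrite le_min !mulr_ge0 ?invr_ge0 ?(ltW s0) ?(ltW t0).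
have mm : measurable_fun setT m by apply: measurable_minr; apply: measurable_funM.
have sec w : xsection (f @^-1` quadrant s t) w =
    J (m w `^ q / E).
  have sectionE u : (s < g (w, u) * V0 w /\ t < g (w, u) * V1 w) <-> 0 < u < m w `^ q / E.
    have g0 : 0 <= g (w, u) by exact: powR_ge0.
    have -> : (s < g (w, u) * V0 w /\ t < g (w, u) * V1 w) <-> 1 < g (w, u) * m w.
      rewrite /m minr_pMr// lt_min ![g _ * (_ * _)]mulrCA !ltr_pdivlMl// !mulr1.
      by split => [[-> ->]|/andP[]].
    have [m0|m0] := eqVneq (m w) 0.
      by rewrite m0 mulr0 powR0 ?gt_eqF// mul0r ltr10; split => // /andP[/lt_trans/[apply]]; rewrite ltxx.
    have mpos : 0 < m w by rewrite lt_neqAle eq_sym m0 m_ge0.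
    rewrite -ltr_pdivrMr// div1r inv_pow_gt ?invr_gt0//= pmulr_rgt0// -ltr_pdivlMl//.
    rewrite -[(m w)^-1]powR_inv1// -powRrM mulN1r opprK [E^-1 * _]mulrC //.
  by apply/seteqP; split => u; rewrite /xsection /J /= inE /= /quadrant /= in_itv /=; apply sectionE.
rewrite (eq_integral (fun w => ((E^-1)%:E * (m w `^ q)%:E)%E)); last first.
  by move=> w _; rewrite sec lebJ ?divr_ge0 ?powR_ge0 ?ltW// -EFinM mulrC.
rewrite ge0_integralZl//; last 3 first.
- by apply/measurable_EFinP; exact: (measurableT_comp (measurable_powR _)).
- by move=> w _; rewrite lee_fin powR_ge0.
- by rewrite lee_fin invr_ge0 ltW.
rewrite -[in LHS](@fineK _ (\int[P]_w _)%E).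
  by rewrite -EFinM mulrC.
rewrite ge0_fin_numE ?fin//; apply: integral_ge0 => w _; by rewrite lee_fin powR_ge0.
Qed.

End limit_measures.

(** * Summability of the coefficients *)

(** The integral comparison for [x ^ (- theta)], without integrals: [b^-1 <= ln b - ln a] for
    [b = a + 1], followed by [1 + x <= expR x]. The right side telescopes. *)
Lemma riemann_step (R : realType) (theta : R) k : 1 < theta ->
  (theta - 1) * k.+2%:R `^ (- theta) <=
    k.+1%:R `^ (1 - theta) - k.+2%:R `^ (1 - theta) :> R.
Proof.
move=> th1; pose s := theta - 1; have s0 : 0 < s by rewrite subr_gt0.
pose a : R := k.+1%:R; pose b : R := k.+2%:R.
have a0 : 0 < a by rewrite ltr0n.
have b0 : 0 < b by rewrite ltr0n.
have ab : b = a + 1 by rewrite /a /b -natr1.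
have lnab : b^-1 <= ln b - ln a.
  rewrite -lerN2 opprB -ln_div ?posrE//.
  have -> : a / b = 1 + (- b^-1).
    by rewrite -[a](addrK 1) -ab mulrBl divff ?gt_eqF// div1r.
  apply: le_ln1Dx; rewrite ltrN2 invf_lt1// ab ltrDr //.
have sN : 1 - theta = - s by rewrite /s opprB.
rewrite -/a -/b -/s sN /powR !gt_eqF//.
have -> : - theta * ln b = - s * ln b - ln b by rewrite /s; ring.
rewrite expRD expRN lnK ?posrE//.
have -> : - s * ln a = - s * ln b + s * (ln b - ln a) by ring.
rewrite expRD mulrCA.
have -> (u v : R) : u * v - u = u * (v - 1) by ring.
rewrite ler_pM2l ?expR_gt0// lerBrDl.
apply: le_trans (expR_ge1Dx _).
by rewrite lerD2l ler_pM2l.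
Qed.

Lemma riemann_bounded (R : realType) (theta : R) n : 1 < theta ->
  \sum_(k < n) k.+1%:R `^ (- theta) <= 1 + (theta - 1)^-1 :> R.
Proof.
move=> th1; have s0 : 0 < theta - 1 by rewrite subr_gt0.
have tel m : \sum_(k < m) k.+2%:R `^ (- theta) <= (theta - 1)^-1 * (1 - m.+1%:R `^ (1 - theta)) :> R.
  rewrite mulrC ler_pdivlMr//; elim: m => [|m IH]; first by rewrite big_ord0 mul0r powR1 subrr.
  rewrite big_ord_recr/= mulrDl; have := riemann_step m th1; lra.
case: n => [|n]; first by rewrite big_ord0 addr_ge0// invr_ge0 ltW.
rewrite big_ord_recl powR1 lerD2l; apply: le_trans (tel n) _.
by rewrite ler_piMr ?invr_ge0 ?(ltW s0)// gerBl powR_ge0.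
Qed.

Lemma bigO_power_summable (R : realType) (alpha : nat -> R) (theta : R) :
  (forall i, 0 <= alpha i <= 1) -> 1 < theta ->
  (alpha : nat -> R^o) =O_\oo (fun i : nat => i%:R `^ (- theta) : R^o) ->
  exists S : R, forall n, \sum_(k < n) alpha k <= S.
Proof.
move=> a01 th1 /eqOP [M [_ HM]].
have th0 : 0 < theta by apply: lt_trans th1.
(* The O-estimate is available for every constant above [M]; this one is also positive. *)
pose C := Num.max M 0 + 1; have C0 : 0 < C by rewrite ltr_wpDl// le_max lexx orbT.
have [N _ aN] : \forall n \near \oo, `|alpha n| <= C * `|n%:R `^ (- theta)|.
  by apply: (HM C); rewrite /C ltr_pwDr// le_max lexx.
(* The first term dominates [alpha k <= 1] for [k <= N.+1], which includes the index 0. The second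
   pays for replacing [k] by [k.+1 <= 2 * k] beyond. *)
pose C' := N.+2%:R `^ theta + C * 2 `^ theta.
exists (C' * (1 + (theta - 1)^-1)) => n.
apply: (@le_trans _ _ (\sum_(k < n) C' * k.+1%:R `^ (- theta))); last first.
  rewrite -mulr_sumr ler_wpM2l ?riemann_bounded//.
  by rewrite addr_ge0 ?mulr_ge0 ?powR_ge0// ltW.
apply: ler_sum => k _; rewrite mulrDl.
have [kN|Nk] := leqP k N.+1.
  apply: (@le_trans _ _ 1); first by have /andP[] := a01 k.
  rewrite -[leLHS]addr0 lerD ?mulr_ge0 ?powR_ge0 ?(ltW C0)//.
  rewrite powRN -div1r mulrA mulr1 ler_pdivlMr ?powR_gt0// mul1r.
  by rewrite ge0_ler_powR ?nnegrE ?(ltW th0)// ler_nat.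
have := aN k (ltnW (ltnW Nk)); rewrite !ger0_norm ?powR_ge0//; last by have /andP[] := a01 k.
move=> /le_trans; apply; rewrite -[leLHS]add0r lerD ?mulr_ge0 ?powR_ge0//.
rewrite -mulrA ler_pM2l//.
have k0 : 0 < (k : nat)%:R :> R by rewrite ltr0n (leq_trans _ Nk).
rewrite !powRN ler_pdivlMr ?powR_gt0// mulrC ler_pdivrMr ?powR_gt0//.
rewrite -powRM// ge0_ler_powR ?nnegrE ?(ltW th0) ?mulr_ge0//.
by rewrite -natrM ler_nat mul2n -addnn -addn1 leq_add2l (leq_trans _ Nk).
Qed.

Lemma bounded_sums_cvg0 (R : realType) (c : nat -> R) (S : R) :
  (forall k, 0 <= c k) -> (forall n, \sum_(k < n) c k <= S) -> c n @[n --> \oo] --> 0.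
Proof.
move=> c0 cS; apply: cvg_series_cvg_0; apply: nondecreasing_is_cvgn.
  by apply/nondecreasing_seqP => n; rewrite /series /= big_nat_recr//= lerDl.
by exists S => _ [n _ <-]; rewrite /series /= big_mkord.
Qed.

Lemma sum_lagged (R : realType) (alpha f : nat -> R) h n :
  \sum_(k < n) lagged alpha h k * f k = \sum_(k < (n - h)%N) alpha k * f (h + k)%N.
Proof.
elim: n => [|n IH]; first by rewrite !big_ord0.
rewrite big_ord_recr/= IH /lagged; have [hn|nh] := leqP h n.
  by rewrite subSn// big_ord_recr/= subnKC.
by rewrite mul0r addr0; move: nh => /[dup] /ltnW + ; rewrite -!subn_eq0 => /eqP -> /eqP ->.
Qed.

Lemma sum_lagged_le (R : realType) (alpha : nat -> R) h (S : R) :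
  (forall n, \sum_(k < n) alpha k <= S) ->
  forall n, \sum_(k < n) lagged alpha h k <= S.
Proof.
move=> aS n; have := sum_lagged alpha (fun=> 1) h n.
by under eq_bigr do rewrite mulr1; under [RHS]eq_bigr do rewrite mulr1; move=> ->.
Qed.

Lemma cvg_sum_lagged (R : realType) (alpha f g : nat -> R) h (S : R) :
  (forall k, f (h + k)%N = g k) ->
  \sum_(k < n) alpha k * g k @[n --> \oo] --> S ->
  \sum_(k < n) lagged alpha h k * f k @[n --> \oo] --> S.
Proof.
move=> fg; rewrite -[X in _ -> X](cvg_shiftn h).
suff -> : [sequence \sum_(k < n + h) lagged alpha h k * f k]_n = (fun n => \sum_(k < n) alpha k * g k) by [].
by apply/funext => n /=; rewrite sum_lagged addnK; apply: eq_bigr => k _; rewrite fg.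
Qed.

Lemma dual_limitE (R : realType) (ai aj li lj s t : R) : 0 < s -> 0 < t ->
  li * aj - lj * ai != 0 ->
  expR (- ((aj - ai) / (li * aj - lj * ai) * ln s + (li - lj) / (li * aj - lj * ai) * ln t)) =
  (s `^ (ai - aj) * t `^ (lj - li)) `^ (1 / (aj * li - ai * lj)).
Proof.
move=> s0 t0 D0; rewrite {2 3}/powR !gt_eqF// -expRD powR_expR; congr expR.
have -> : aj * li - ai * lj = li * aj - lj * ai by ring.
by field.
Qed.

(** * The stochastic volatility model *)

Section gamma_SV.
Context d (T : measurableType d) (R : realType) (P : probability T R).
Variables (alpha : nat -> R) (theta beta K : R) (eps eta sigma X : int -> {RV P >-> R}).
Hypothesis model : gamma_SV_model alpha theta beta K eps eta sigma X.
Variables (h : nat) (kappa : nat -> R).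
Hypothesis kappa_opt : unique (solution alpha h) kappa.

Let alpha01 := sv_alpha01 model.
Let alpha_max := sv_alpha_max model.
Let l := lagged alpha h.
Let F z := fine (P [set w | z < eta 0 w]).

Lemma model_tail_gt0 z : 0 < F z.
Proof.
have anti (x y : R) : x <= y -> F y <= F x by exact: tail_anti.
have ge0 x : 0 <= F x by exact: fine_ge0.
exact: gamma_tail_gt0 anti ge0 (sv_eta_tail model) z.
Qed.

Lemma model_tail_shift (m : R) : F (z + m) / F z @[z --> +oo] --> expR (- m).
Proof.
have anti (x y : R) : x <= y -> F y <= F x by exact: tail_anti.
have ge0 x : 0 <= F x by exact: fine_ge0.
exact: (@gamma_tail_shift _ _ _ _ (sv_K model) anti ge0 (sv_eta_tail model)).
Qed.

Lemma model_summable : exists S : R, forall n, \sum_(k < n) alpha k <= S.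
Proof. exact: bigO_power_summable alpha01 (sv_theta model) (sv_alphaO model). Qed.

Lemma model_alpha_cvg0 : alpha n @[n --> \oo] --> (0 : R).
Proof.
have [S aS] := model_summable.
by apply: (@bounded_sums_cvg0 _ alpha S) => // k; have /andP[] := alpha01 k.
Qed.

Lemma model_lagged_cvg0 : l n @[n --> \oo] --> (0 : R).
Proof.
have [S aS] := model_summable.
apply: (@bounded_sums_cvg0 _ l S); last exact: sum_lagged_le.
by move=> k; have /andP[] := lagged01 h alpha01 k.
Qed.

Lemma log_sigma_h : {ae P, forall w, 0 < sigma h%:Z w /\
  \sum_(k < n) alpha k * noise eta h k w @[n --> \oo] --> ln (sigma h%:Z w)}.
Proof.
move: (sv_log_sigma model h%:Z); apply: filterS => w [s0 H]; split => //.
by under eq_fun do rewrite -(big_mkord xpredT (fun k => alpha k * noise eta h k w)).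
Qed.

Lemma log_sigma_0 : {ae P, forall w, 0 < sigma 0 w /\
  \sum_(k < n) l k * noise eta h k w @[n --> \oo] --> ln (sigma 0 w)}.
Proof.
move: (sv_log_sigma model 0); apply: filterS => w [s0 H]; split => //.
apply: (@cvg_sum_lagged _ alpha (fun k => noise eta h k w) (fun k => eta (0 - k%:Z) w)).
  move=> k; rewrite /noise; congr (eta _ w); rewrite PoszD; ring.
by under eq_fun do rewrite -(big_mkord xpredT (fun k => alpha k * eta (0 - k%:Z) w)).
Qed.

Lemma exp_series_ln (c : nat -> R) (s : R) w : 0 < s ->
  \sum_(k < n) c k * noise eta h k w @[n --> \oo] --> ln s ->
  exp_series eta h c w = s.
Proof.
move=> s0 cs; apply: cvg_lim => //; rewrite -[X in _ --> X]lnK ?posrE//.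
under eq_fun do rewrite exp_prod_sum.
by apply: continuous_cvg => //; exact: continuous_expR.
Qed.

Lemma convergent_h : convergent_noise eta h alpha.
Proof. by move: log_sigma_h; apply: filterS => w [_ H]; eexists; exact: H. Qed.

Lemma convergent_0 : convergent_noise eta h l.
Proof. by move: log_sigma_0; apply: filterS => w [_ H]; eexists; exact: H. Qed.

Lemma sigma_h_series : {ae P, forall w, 0 < sigma h%:Z w /\ exp_series eta h alpha w = sigma h%:Z w}.
Proof. by move: log_sigma_h; apply: filterS => w [s0 H]; split => //; exact: exp_series_ln. Qed.

Lemma sigma_0_series : {ae P, forall w, 0 < sigma 0 w /\ exp_series eta h l w = sigma 0 w}.
Proof. by move: log_sigma_0; apply: filterS => w [s0 H]; split => //; exact: exp_series_ln. Qed.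

Lemma two_sums i j : i != j -> 0 < kappa i -> 0 < kappa j ->
  [/\ objective kappa = (kappa i + kappa j)%:E,
    l i * kappa i + l j * kappa j = 1 & alpha i * kappa i + alpha j * kappa j = 1].
Proof.
move=> ij ki kj; have supp := two_support alpha01 alpha_max kappa_opt ij ki kj.
have [-> E0 E1] := support_totals alpha01 alpha_max kappa_opt ij supp.
rewrite -[l i * _ + _]E0 -[alpha i * _ + _]E1.
by rewrite (two_lag_total alpha01 alpha_max kappa_opt ij ki kj)
  (two_total alpha01 alpha_max kappa_opt ij ki kj).
Qed.

(** * Volatility and observed process in a common form *)

Section pair.
Variables (e0 e1 Y0 Y1 : T -> R) (Q : R).
Hypothesis mY0 : measurable_fun setT Y0.
Hypothesis mY1 : measurable_fun setT Y1.
Hypothesis e0_meas : eps_measurable eta eps e0.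
Hypothesis e1_meas : eps_measurable eta eps e1.
Hypothesis e0_ge0 : forall w, 0 <= e0 w.
Hypothesis e1_ge0 : forall w, 0 <= e1 w.
Hypothesis e_moment : forall q0 q1, 0 <= q0 <= Q -> 0 <= q1 <= Q ->
  (\int[P]_w (e0 w `^ q0 * e1 w `^ q1)%:E < +oo)%E.
Hypothesis e_pos : (0 < P [set w | (0 < e0 w)%R /\ (0 < e1 w)%R])%E.
(** Only positive levels are compared: the observed process is negative where [eps] is, while the
    product with the positive part vanishes there. *)
Hypothesis Y0E : {ae P, forall w, forall u, 0 < u ->
  (u < Y0 w <-> u < sv_product eta h e0 l w)}.
Hypothesis Y1E : {ae P, forall w, forall u, 0 < u ->
  (u < Y1 w <-> u < sv_product eta h e1 alpha w)}.
Hypothesis pQ : fine (objective kappa) < Q.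

Let J := sv_joint eta h l alpha e0 e1.

Let ratioE (s t x : R) : 0 < s -> 0 < t -> 0 < x ->
  joint_tail_ratio P Y0 Y1 s t x = J s t x / J 1 1 x.
Proof.
move=> s0 t0 x0.
have main a b : 0 < a -> 0 < b ->
    P [set w | a < Y0 w /\ b < Y1 w] =
    P [set w | a < sv_product eta h e0 l w /\ b < sv_product eta h e1 alpha w].
  move=> a0 b0; apply: prob_ae_eq.
  - exact: measurable_above.
  - by apply: measurable_above; exact: sv_product_measurable.
  move: Y0E Y1E; apply: filterS2 => w H0 H1 /=.
  by rewrite H0// H1.
rewrite /joint_tail_ratio /J /sv_joint !mul1r -!main ?mulr_gt0//.
congr (_ / fine (P _)); apply/seteqP; split => w /=; rewrite lt_min => /andP//.
Qed.

Let ratio_cvg (s t L : R) : 0 < s -> 0 < t ->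
  J s t x / J 1 1 x @[x --> +oo] --> L ->
  joint_tail_ratio P Y0 Y1 s t x @[x --> +oo] --> L.
Proof.
move=> s0 t0; apply: cvg_near_eq; near=> x.
have x0 : 0 < x by near: x; exact: nbhs_pinfty_gt.
by rewrite ratioE.
Unshelve. all: by end_near. Qed.

Let D i j := l i * alpha j - l j * alpha i.
Let y0 i j := (alpha j - alpha i) / D i j.
Let y1 i j := (l i - l j) / D i j.

Lemma two_ratio i j (s t : R) : i != j -> 0 < kappa i -> 0 < kappa j -> 0 < s -> 0 < t ->
  joint_tail_ratio P Y0 Y1 s t x @[x --> +oo] --> expR (- (y0 i j * ln s + y1 i j * ln t)).
Proof.
move=> ij ki kj s0 t0; apply: ratio_cvg => //.
have [obj El Ea] := two_sums ij ki kj.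
have D0 : D i j != 0 := two_det_neq0 alpha01 alpha_max kappa_opt ij ki kj.
have [y00 y10] := two_dual_gt0 alpha01 alpha_max kappa_opt ij ki kj.
have ylt := two_dual_lt1 alpha01 alpha_max kappa_opt ij ki kj.
have [S aS] := model_summable.
apply: (@sv_joint_limit_two _ _ _ _ _ _ _ (sv_eta_iid model).1 (sv_eta_iid model).2
  (sv_eta_eps model) model_tail_gt0 model_tail_shift l alpha S
  (lagged01 h alpha01) alpha01 convergent_0 convergent_h model_lagged_cvg0 model_alpha_cvg0
  (sum_lagged_le h aS) aS e0 e1 Q e0_meas e1_meas e0_ge0 e1_ge0 e_moment e_pos
  i j (kappa i) (kappa j)) => //.
- by rewrite /y0 /y1 /D; field; rewrite -/(D i j).
- by rewrite /y0 /y1 /D; field; rewrite -/(D i j).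
- by have := pQ; rewrite obj.
Qed.

Lemma two_regularly_varying i j : i != j -> 0 < kappa i -> 0 < kappa j ->
  regularly_varying_E2 P Y0 Y1 (fine (objective kappa)).
Proof.
move=> ij ki kj.
have [obj El Ea] := two_sums ij ki kj.
have D0 : D i j != 0 := two_det_neq0 alpha01 alpha_max kappa_opt ij ki kj.
have [y00 y10] := two_dual_gt0 alpha01 alpha_max kappa_opt ij ki kj.
have [nu nuE] := product_quadrant_measure y00 y10.
(* The order of homogeneity of the limit measure is the sum of the dual weights, which equals the
   optimal value. *)
have py : kappa i + kappa j = y0 i j + y1 i j.
  rewrite -[y0 i j]mulr1 -[y1 i j]mulr1 -{1}El -Ea.
  rewrite /y0 /y1 /D; field; rewrite -/(D i j)//.
apply: (regularly_varying_quadrants mY0 mY1 _ _ nuE) => //.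
- by rewrite obj addr_gt0.
- by rewrite expR_gt0.
- move=> c s t c0 s0 t0; rewrite obj /= py /powR gt_eqF// -expRD !lnM ?posrE//.
  by congr expR; rewrite -/(D i j) -/(y0 i j) -/(y1 i j); ring.
by move=> s t s0 t0; exact: two_ratio.
Qed.

Lemma one_ratio i (s t : R) : 0 < kappa i -> (forall k, k != i -> kappa k = 0) -> 0 < s -> 0 < t ->
  let I s t := (\int[P]_w (min_product eta h l alpha e0 e1 i s t w `^ (1 / alpha i))%:E)%E in
  [/\ (I s t < +oo)%E, 0 < fine (I s t) &
  joint_tail_ratio P Y0 Y1 s t x @[x --> +oo] --> fine (I s t) / fine (I 1 1)].
Proof.
move=> ki k0 s0 t0 I.
have [li0 ai0] := one_coef_gt0 alpha01 alpha_max kappa_opt ki k0.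
have [obj _ _] := one_totals alpha01 alpha_max kappa_opt k0.
have li := one_lagged alpha01 alpha_max kappa_opt ki k0.
have kE := one_kappa alpha01 alpha_max kappa_opt ki k0.
have [lam [/andP[lam0 lam1] lamP]] := one_dual alpha01 alpha_max model_alpha_cvg0 kappa_opt ki k0.
have [S aS] := model_summable.
have y00 : 0 < lam / alpha i by rewrite divr_gt0.
have y10 : 0 < (1 - lam) / alpha i by rewrite divr_gt0// subr_gt0.
have sum_y : lam / alpha i + (1 - lam) / alpha i = 1 / alpha i.
  by rewrite -mulrDl addrCA subrr addr0.
have y_other k : k != i -> lam / alpha i * l k + (1 - lam) / alpha i * alpha k < 1.
  move=> /lamP; rewrite ![_ / alpha i * _]mulrAC -mulrDl ltr_pdivrMr// mul1r //.
have aQ : 1 / alpha i < Q by have := pQ; rewrite obj /= kE div1r.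
have [I0 I1 _] := @min_product_limit _ _ _ _ _ _ _ (sv_eta_iid model).1 (sv_eta_iid model).2
  (sv_eta_eps model) model_tail_gt0 model_tail_shift l alpha S
  (lagged01 h alpha01) alpha01 convergent_0 convergent_h model_lagged_cvg0 model_alpha_cvg0
  (sum_lagged_le h aS) aS e0 e1 Q e0_meas e1_meas e0_ge0 e1_ge0 e_moment e_pos
  i (alpha i) _ _ ai0 li erefl y00 y10 sum_y y_other aQ s t s0 t0.
split => //; apply: ratio_cvg => //.
exact: (@sv_joint_limit_one _ _ _ _ _ _ _ (sv_eta_iid model).1 (sv_eta_iid model).2
  (sv_eta_eps model) model_tail_gt0 model_tail_shift l alpha S
  (lagged01 h alpha01) alpha01 convergent_0 convergent_h model_lagged_cvg0 model_alpha_cvg0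
  (sum_lagged_le h aS) aS e0 e1 Q e0_meas e1_meas e0_ge0 e1_ge0 e_moment e_pos
  i (alpha i) _ _ ai0 li erefl y00 y10 sum_y y_other aQ s t s0 t0).
Qed.

Lemma one_regularly_varying i : 0 < kappa i -> (forall k, k != i -> kappa k = 0) ->
  regularly_varying_E2 P Y0 Y1 (fine (objective kappa)).
Proof.
move=> ki k0.
have [li0 ai0] := one_coef_gt0 alpha01 alpha_max kappa_opt ki k0.
have [obj _ _] := one_totals alpha01 alpha_max kappa_opt k0.
have kE := one_kappa alpha01 alpha_max kappa_opt ki k0.
have q0 : 0 < 1 / alpha i by rewrite divr_gt0.
pose V0 := sv_product eta h e0 (zero_at i l).
pose V1 := sv_product eta h e1 (zero_at i alpha).
have mV0 : measurable_fun setT V0 by exact: sv_product_measurable.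
have mV1 : measurable_fun setT V1 by exact: sv_product_measurable.
pose I s t := (\int[P]_w (Num.min (s^-1 * V0 w) (t^-1 * V1 w) `^ (1 / alpha i))%:E)%E.
have V0_ge0 w : 0 <= V0 w by exact: sv_product_ge0.
have V1_ge0 w : 0 <= V1 w by exact: sv_product_ge0.
have Ioo s t : 0 < s -> 0 < t -> (I s t < +oo)%E.
  by move=> s0 t0; have [] := one_ratio ki k0 s0 t0.
have I11 : 0 < fine (I 1 1) by have [] := one_ratio ki k0 ltr01 ltr01.
have [nu nuE] := mixture_quadrant_measure mV0 mV1 V0_ge0 V1_ge0 q0 I11 Ioo.
apply: (regularly_varying_quadrants mY0 mY1 _ _ nuE) => //.
- by rewrite obj.
- by rewrite divr_gt0.
- move=> c s t c0 s0 t0; rewrite mulrA; congr (_ / _).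
  have cN0 : 0 <= c `^ (- fine (objective kappa)) by exact: powR_ge0.
  rewrite -/(I (c * s) (c * t)) -/(I s t).
  have -> : I (c * s) (c * t) = ((c `^ (- fine (objective kappa)))%:E * I s t)%E.
    rewrite -ge0_integralZl//; last 2 first.
    - apply/measurable_EFinP; apply: (measurableT_comp (measurable_powR _)).
      by apply: measurable_minr; apply: measurable_funM.
    - by move=> w _; rewrite lee_fin powR_ge0.
    apply: eq_integral => w _; rewrite -EFinM obj /= kE !div1r.
    rewrite !invfM -!mulrA -minr_pMr ?invr_ge0 ?(ltW c0)//.
    rewrite powRM ?invr_ge0 ?(ltW c0)//; last first.
      by rewrite le_min; apply/andP; split; apply: mulr_ge0 => //; rewrite invr_ge0 ltW.
    by rewrite -(powR_inv1 (ltW c0)) -powRrM mulN1r.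
  by rewrite fineM// ge0_fin_numE ?Ioo//; apply: integral_ge0 => w _; rewrite lee_fin powR_ge0.
by move=> s t s0 t0; have [] := one_ratio ki k0 s0 t0.
Qed.

Lemma sv_pair_limits :
  [/\ (forall i j, i != j -> 0 < kappa i -> 0 < kappa j -> forall s t : R, 0 < s -> 0 < t ->
    joint_tail_ratio P Y0 Y1 s t x @[x --> +oo] -->
      (s `^ (alpha i - alpha j) * t `^ (l j - l i))
        `^ (1 / (alpha j * l i - alpha i * l j))),
    (forall i, 0 < kappa i -> (forall k, k != i -> kappa k = 0) ->
      let V0 := sv_product eta h e0 (zero_at i l) in
      let V1 := sv_product eta h e1 (zero_at i alpha) in
      forall s t : R, 0 < s -> 0 < t ->
      joint_tail_ratio P Y0 Y1 s t x @[x --> +oo] -->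
        min_moment P (1 / alpha i) (fun w => s^-1 * V0 w) (fun w => t^-1 * V1 w) /
        min_moment P (1 / alpha i) V0 V1) &
    (exists i j : nat, [/\ i != j, 0 < kappa i & 0 < kappa j]) \/
    (exists i : nat, 0 < kappa i /\ forall j, j != i -> kappa j = 0) ->
    regularly_varying_E2 P Y0 Y1 (fine (objective kappa))].
Proof.
split.
- move=> i j ij ki kj s t s0 t0; rewrite -dual_limitE//; first exact: two_ratio.
  exact: (two_det_neq0 alpha01 alpha_max kappa_opt ij ki kj).
- move=> i ki k0 V0 V1 s t s0 t0; have [_ _] := one_ratio ki k0 s0 t0.
  rewrite /min_moment unlock; congr (_ --> _ / fine (integral _ _ _)).
  by apply/funext => w; rewrite /min_product invr1 !mul1r.
move=> [[i [j [ij ki kj]]]|[i [ki k0]]].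
  exact: (two_regularly_varying ij ki kj).
exact: (one_regularly_varying ki k0).
Qed.

End pair.

End gamma_SV.

(** * Moments of positive parts of two independent variables *)

Section pair_independence.
Context d (T : measurableType d) (R : realType) (P : probability T R).
Variables (Y : int -> {RV P >-> R}) (t : int).
Hypotheses (Y_iid : iid Y) (t0 : t != 0).

Lemma iid_pair_indep (A B : set R) : measurable A -> measurable B ->
  P (Y 0 @^-1` A `&` Y t @^-1` B) = (P (Y 0 @^-1` A) * P (Y t @^-1` B))%E.
Proof.
move=> mA mB; pose C (i : int) := if i == 0 then A else B.
have mC i : measurable (C i) by rewrite /C; case: ifP.
have mY s D : measurable D -> measurable (Y s @^-1` D).
  by move=> mD; rewrite -[X in measurable X]setTI; exact: (measurable_funP (Y s)).
have := Y_iid.1 [:: 0; t] C; rewrite /= inE eq_sym t0 => /(_ isT mC).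
rewrite !big_cons big_nil mulr1 /C eqxx (negbTE t0) => H.
have capE : \bigcap_(i in [set` [:: 0; t]]) (Y i @^-1` C i) = Y 0 @^-1` A `&` Y t @^-1` B.
  apply/seteqP; split => w /=.
    move=> H'; have := H' 0; have := H' t; rewrite /C /= !inE !eqxx (negbTE t0) orbT.
    by move=> /(_ isT) ? /(_ isT).
  move=> [wA wB] s; rewrite /= !inE => /orP[] /eqP ->; rewrite /C ?eqxx ?(negbTE t0)//.
rewrite capE in H.
rewrite -[LHS]fineK ?fin_num_measure//; last by apply: measurableI; exact: mY.
rewrite H EFinM !fineK ?fin_num_measure//; exact: mY.
Qed.

Let pos (s : int) w := Num.max (Y s w) 0.

Lemma pos_moment (Q : R) (s : int) (q : R) : 0 <= q <= Q ->
  (\int[P]_w (pos 0 w `^ Q)%:E < +oo)%E ->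
  (\int[P]_w (pos s w `^ q)%:E < +oo)%E.
Proof.
move=> /andP[q0 qQ] fin.
have mp (p : R) : measurable_fun setT (fun x : R => Num.max x 0 `^ p).
  by apply: (measurableT_comp (measurable_powR _)); apply: measurable_maxr.
rewrite (@integral_eta _ _ _ _ Y Y_iid.2 s (fun x => (Num.max x 0 `^ q)%:E)); last 2 first.
- by apply/measurable_EFinP.
- by move=> x; rewrite lee_fin powR_ge0.
have mpQ : measurable_fun setT (fun w => (pos 0 w `^ Q)%:E).
  apply/measurable_EFinP; apply: (measurableT_comp (mp Q)); exact: measurable_funP.
apply: (@le_lt_trans _ _ (\int[P]_w (1 + (pos 0 w `^ Q)%:E))%E).
  apply: ge0_le_integral => //.
  - by move=> w _; rewrite lee_fin powR_ge0.
  - by apply/measurable_EFinP; apply: (measurableT_comp (mp q)); exact: measurable_funP.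
  - by apply: emeasurable_funD.
  move=> w _; rewrite -EFinD lee_fin; have [x1|x1] := leP (Num.max (Y 0 w) 0) 1.
    apply: (@le_trans _ _ 1); last by rewrite lerDl powR_ge0.
    have <- : 1 `^ q = 1 :> R by rewrite powR1.
    by apply: ge0_ler_powR; rewrite ?nnegrE// le_max lexx orbT.
  apply: (@le_trans _ _ (pos 0 w `^ Q)); last by rewrite lerDr.
  by rewrite ler_powR// ltW.
rewrite ge0_integralD//; last by move=> w _; rewrite lee_fin powR_ge0.
rewrite lte_add_pinfty// integral_cst// mul1e.
by apply: (@le_lt_trans _ _ 1%E); [exact: probability_le1|rewrite ltry].
Qed.

Lemma pos_pair_moment (Q q0 q1 : R) : 0 <= q0 <= Q -> 0 <= q1 <= Q ->
  (\int[P]_w (pos 0 w `^ Q)%:E < +oo)%E ->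
  (\int[P]_w (pos 0 w `^ q0 * pos t w `^ q1)%:E < +oo)%E.
Proof.
move=> q0Q q1Q fin.
have mp (p : R) : measurable_fun setT (fun x : R => Num.max x 0 `^ p).
  by apply: (measurableT_comp (measurable_powR _)); apply: measurable_maxr.
have mom (s : int) q : 0 <= q <= Q -> (\int[P]_w (Num.max (Y s w) 0 `^ q)%:E < +oo)%E.
  by move=> qQ; exact: (@pos_moment Q s q qQ fin).
have ge0 (s : int) q : (0 <= \int[P]_w (Num.max (Y s w) 0 `^ q)%:E)%E.
  by apply: integral_ge0 => w _; rewrite lee_fin powR_ge0.
rewrite (@integral_independent_mul _ _ _ _ _ _ _ _ (Y 0) (Y t)
  (fun x => Num.max x 0 `^ q0) (fun x => Num.max x 0 `^ q1))//.
- apply: lte_mul_pinfty; [exact: ge0| |exact: mom].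
  by rewrite ge0_fin_numE; [exact: mom|exact: ge0].
- by move=> u; exact: powR_ge0.
- by move=> u; exact: powR_ge0.
by move=> A B mA mB; exact: iid_pair_indep.
Qed.

Lemma pos_pair_gt0 : (0 < P [set w | (0 < Y 0 w)%R])%E ->
  (0 < P [set w | (0 < pos 0 w)%R /\ (0 < pos t w)%R])%E.
Proof.
move=> P0; pose A := `]0 : R, +oo[%classic.
have mA : measurable A by exact: measurable_itv.
have AE s : Y s @^-1` A = [set w | 0 < Y s w].
  by apply/seteqP; split => w; rewrite /A /= in_itv/= andbT.
have -> : [set w | 0 < pos 0 w /\ 0 < pos t w] = Y 0 @^-1` A `&` Y t @^-1` A.
  rewrite !AE; apply/seteqP; split => w /=; rewrite /pos !lt_max ltxx !orbF//.
rewrite iid_pair_indep//.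
have PA : P (Y t @^-1` A) = P (Y 0 @^-1` A) by exact: (Y_iid.2 t 0 A mA).
by rewrite PA AE mule_gt0.
Qed.

End pair_independence.

Section products_without.
Context d (T : measurableType d) (R : realType) (P : probability T R).
Variables (alpha : nat -> R) (eta : int -> {RV P >-> R}) (h i : nat).

Lemma sigmah_withoutE w :
  sigmah_without alpha eta h i w = exp_series eta h (zero_at i alpha) w.
Proof.
rewrite /sigmah_without /exp_series; congr (limn _); apply/funext => n.
rewrite big_mkord big_mkcond.
by apply: eq_bigr => k _; rewrite /zero_at; case: eqVneq => //= _; rewrite mul0r expR0.
Qed.

Lemma sigma0_withoutE w :
  sigma0_without alpha eta h i w = exp_series eta h (zero_at i (lagged alpha h)) w.
Proof.
rewrite /sigma0_without /exp_series; congr (limn _); apply/funext => n.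
rewrite big_geq_mkord big_mkcond.
apply: eq_bigr => k _; rewrite /zero_at /lagged.
by case: eqVneq => //= _; rewrite ?mul0r ?expR0//; case: leqP => //= _; rewrite mul0r expR0.
Qed.

End products_without.

Section instances.
Context d (T : measurableType d) (R : realType) (P : probability T R).
Variables (alpha : nat -> R) (theta beta K : R) (eps eta sigma X : int -> {RV P >-> R}).
Hypothesis model : gamma_SV_model alpha theta beta K eps eta sigma X.
Variable h : nat.

Let pos (t : int) w := Num.max (eps t w) 0.

Lemma pos_eps_measurable t : eps_measurable eta eps (pos t).
Proof. by move=> s; apply: measurable_maxr => //; exact: eps_others. Qed.

Lemma pos_tail (t : int) (c : nat -> R) :
  {ae P, forall w, 0 < sigma t w /\ exp_series eta h c w = sigma t w} ->
  {ae P, forall w, forall u, 0 < u -> (u < X t w <-> u < sv_product eta h (pos t) c w)}.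
Proof.
apply: filterS => w [s0 E] u u0; rewrite /sv_product E (sv_X model) /pos mulrC.
have [e0|e0] := ltP 0 (eps t w); first by [].
rewrite mul0r; split => /(lt_trans u0); last by rewrite ltxx.
by rewrite ltNge pmulr_lle0// e0.
Qed.

Lemma cst1_tail (t : int) (c : nat -> R) :
  {ae P, forall w, 0 < sigma t w /\ exp_series eta h c w = sigma t w} ->
  {ae P, forall w, forall u, 0 < u -> (u < sigma t w <-> u < sv_product eta h (cst 1) c w)}.
Proof. by apply: filterS => w [s0 E] u u0; rewrite /sv_product E mul1r. Qed.

Lemma cst1_moment (q0 q1 : R) : (\int[P]_w (cst 1 w `^ q0 * cst 1 w `^ q1)%:E < +oo)%E.
Proof.
under eq_integral do rewrite /= powR1 mulr1.
rewrite integral_cst// mul1e.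
by apply: (@le_lt_trans _ _ 1%E); [exact: probability_le1|rewrite ltry].
Qed.

Lemma cst1_pos : (0 < P [set w | (0 < cst 1 w :> R)%R /\ (0 < cst 1 w :> R)%R])%E.
Proof.
have -> : [set w : T | 0 < cst 1 w :> R /\ 0 < cst 1 w :> R] = setT.
  by apply/seteqP; split.
by rewrite probability_setT.
Qed.

End instances.

Theorem theorem5p1 (d : measure_display) (T : measurableType d) (R : realType)
    (P : probability T R) (alpha : nat -> R) (theta beta K : R)
    (eps eta sigma X : int -> {RV P >-> R})
    (model : gamma_SV_model alpha theta beta K eps eta sigma X)
    (h : nat) (h_gt0 : (0 < h)%N) (kappa : nat -> R)
    (kappa_opt : unique (solution alpha h) kappa)
    (eps_moment : exists2 delta : R, 0 < delta &
      ('E_P[fun w => (Num.max (eps 0 w) 0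
               `^ (fine (objective kappa) + delta))%R] < +oo)%E) :
  [/\ (forall i j : nat, i != j -> 0 < kappa i -> 0 < kappa j ->
        forall s0 sh : R, 0 < s0 -> 0 < sh ->
        let L := (s0 `^ (alpha i - alpha j)
                  * sh `^ (lagged alpha h j - lagged alpha h i))
                 `^ (1 / (alpha j * lagged alpha h i
                          - alpha i * lagged alpha h j)) in
        joint_tail_ratio P (sigma 0) (sigma h%:Z) s0 sh x @[x --> +oo] --> L /\
        joint_tail_ratio P (X 0) (X h%:Z) s0 sh x @[x --> +oo] --> L),
      (forall i : nat, 0 < kappa i -> (forall j, j != i -> kappa j = 0) ->
        let A := sigma0_without alpha eta h i in
        let B := sigmah_without alpha eta h i in
        let E := min_moment P (1 / alpha i) in
        [/\ (h <= i)%N, alpha i = alpha (i - h)%N &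
          forall s0 sh : R, 0 < s0 -> 0 < sh ->
          (joint_tail_ratio P (sigma 0) (sigma h%:Z) s0 sh x @[x --> +oo] -->
            E (fun w => s0^-1 * A w) (fun w => sh^-1 * B w) / E A B) /\
          (joint_tail_ratio P (X 0) (X h%:Z) s0 sh x @[x --> +oo] -->
            E (fun w => s0^-1 * Num.max (eps 0 w) 0 * A w)
              (fun w => sh^-1 * Num.max (eps h%:Z w) 0 * B w) /
            E (fun w => Num.max (eps 0 w) 0 * A w)
              (fun w => Num.max (eps h%:Z w) 0 * B w))]) &
      ((exists i j : nat, [/\ i != j, 0 < kappa i & 0 < kappa j]) \/
       (exists i : nat, 0 < kappa i /\ forall j, j != i -> kappa j = 0)) ->
      regularly_varying_E2 P (sigma 0) (sigma h%:Z) (fine (objective kappa)) /\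
      regularly_varying_E2 P (X 0) (X h%:Z) (fine (objective kappa))].

Proof.
(* A positive lag makes [eps 0] and [eps h] distinct members of the family, hence independent. *)
have t0 : h%:Z != 0 by rewrite eqz_nat -lt0n.
have S0 := sigma_0_series model h; have Sh := sigma_h_series model h.
have mRV (Y : {RV P >-> R}) : measurable_fun setT Y by exact: measurable_funP.
have me1 : eps_measurable eta eps (cst 1 : T -> R) by move=> s; exact: measurable_cst.
(* The constant factor 1 has all moments, so any bound above the optimal value serves for the
   volatility. *)
have Q1 : fine (objective kappa) < fine (objective kappa) + 1 by rewrite ltrDl.
have [Ds Ms Vs] := sv_pair_limits model kappa_opt (mRV _) (mRV _) me1 me1
  (fun=> ler01) (fun=> ler01) (fun q0 q1 _ _ => cst1_moment P q0 q1) (cst1_pos P)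
  (cst1_tail S0) (cst1_tail Sh) Q1.
have [delta d0] := eps_moment; rewrite unlock => mom.
have Qd : fine (objective kappa) < fine (objective kappa) + delta by rewrite ltrDl.
have mpos t : eps_measurable eta eps (fun w => Num.max (eps t w) 0).
  exact: pos_eps_measurable.
have max_ge0 t w : 0 <= Num.max (eps t w) 0 by rewrite le_max lexx orbT.
have [Dx Mx Vx] := sv_pair_limits model kappa_opt (mRV _) (mRV _)
  (mpos 0) (mpos h%:Z) (max_ge0 _) (max_ge0 _)
  (fun q0 q1 H0 H1 => pos_pair_moment (sv_eps_iid model) t0 H0 H1 mom)
  (pos_pair_gt0 (sv_eps_iid model) t0 (sv_eps_pos model))
  (pos_tail model S0) (pos_tail model Sh) Qd.
split.
- by move=> i j ij ki kj s0 sh s00 sh0 L; split; [exact: Ds|exact: Dx].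
- move=> i ki k0 A B E.
  have hi := one_lag_le (sv_alpha01 model) (sv_alpha_max model) kappa_opt ki k0.
  have li := one_lagged (sv_alpha01 model) (sv_alpha_max model) kappa_opt ki k0.
  split => //; first by rewrite -li /lagged hi.
  have EE Y0 Z0 Y1 Z1 : (forall w, Y0 w = Y1 w) -> (forall w, Z0 w = Z1 w) -> E Y0 Z0 = E Y1 Z1.
    by move=> /funext -> /funext ->.
  have cvgE (f : R -> R) (a b a' b' : R) : a = a' -> b = b' ->
      f x @[x --> +oo] --> a / b -> f x @[x --> +oo] --> a' / b' by move=> -> ->.
  move=> s0 sh s00 sh0; split.
    apply: cvgE (Ms i ki k0 s0 sh s00 sh0); apply: EE => w;
      by rewrite /sv_product /A /B ?sigma0_withoutE ?sigmah_withoutE mul1r.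
  apply: cvgE (Mx i ki k0 s0 sh s00 sh0); apply: EE => w;
    by rewrite /sv_product /A /B ?sigma0_withoutE ?sigmah_withoutE ?mulrA.
by move=> H; split; [exact: Vs|exact: Vx].
Qed.
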